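(* Let $n\ge4$, $k\ge1$, $n_j\ge2$ be integers and $r_j>0$ reals ($1\le j\le k$), let $(N_0^n,g_{N_0})$ be the complete Ricci-flat Riemannian Schwarzschild–Tangherlini manifold (defined in the context), and let $W_k^m=N_0^n\times\prod_{j=1}^k\mathbb{S}^{n_j}(r_j)$ be the Riemannian product, with $m=n+\sum_{j=1}^k n_j$. Put $\rho_j:=\frac{n_j-1}{r_j^2}$. (a) Every local isometric immersion of $W_k^m$ into Euclidean space whose second fundamental form is adapted to the product structure has codimension at least $k+2$. This holds regardless of whether the $\rho_j$ are distinct. (b) If the $\rho_j$ are pairwise distinct and $\Phi\colon W_k^m\to\mathbb{R}^{m+q}$ is a local isometric immersion with $q\le k+1$, then the second fundamental form of $\Phi$ is not adapted to the product structure, and the normal bundle of $\Phi$ is not flat.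
   Context: A local isometric immersion of $W_k^m$ is an isometric immersion defined on a nonempty open subset of $W_k^m$. $\mathbb{S}^{n_j}(r_j)$ is the round sphere of dimension $n_j$ and radius $r_j$. Write $P_0=N_0^n$ and $P_j=\mathbb{S}^{n_j}(r_j)$ for $1\le j\le k$, so that $TW_k^m=\bigoplus_{j=0}^k TP_j$. The second fundamental form $\alpha$ of an isometric immersion of (an open subset of) $W_k^m$ is adapted to the product structure if its mixed terms vanish, i.e. $\alpha(TP_i,TP_j)=0$ for all $i\neq j$ (at every point of the domain). Riemannian Schwarzschild–Tangherlini manifold: fix $n\ge4$ and set $\mu=\frac{n-3}{2}$. Let $\varphi\in C^\infty([0,\infty))$ be the unique nonconstant solution of $$\varphi'^2=1-\left(\frac{\mu}{\varphi}\right)^{n-3},\qquad \varphi(0)=\mu,\quad \varphi'(0)=0,$$ characterized by $\varphi'(t)>0$ for every $t>0$; equivalently, $\varphi$ solves $\varphi''=\frac{n-3}{2}\frac{\mu^{n-3}}{\varphi^{n-2}}$, $\varphi(0)=\mu$, $\varphi'(0)=0$. It extends to a smooth even function on $\mathbb{R}$ with $\varphi''(0)=1$. Let $L_0^2\cong\mathbb{R}^2$ with origin $o$ and polar coordinates $(t,\theta)$, $t\ge0$, $\theta\in[0,2\pi)$, with the metric $g_{L_0}=dt^2+\varphi'(t)^2\,d\theta^2$ on $L_0^2\setminus\{o\}$, which extends smoothly across $o$. Then $$N_0^n=L_0^2\times_\varphi\mathbb{S}^{n-2},\qquad g_{N_0}=dt^2+\varphi'(t)^2\,d\theta^2+\varphi(t)^2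 g_{\mathbb{S}^{n-2}},$$ where $g_{\mathbb{S}^{n-2}}$ is the unit round metric and the metric is extended smoothly across $\{o\}\times\mathbb{S}^{n-2}$. *)

(* Defs.v *)
From mathcomp Require Import all_boot all_order all_algebra.
From mathcomp Require Import all_classical all_reals all_analysis.
Set Implicit Arguments.
Unset Strict Implicit.
Unset Printing Implicit Defensive.
Import Order.TTheory GRing.Theory Num.Theory.
Import numFieldNormedType.Exports.
Local Open Scope classical_set_scope.
Local Open Scope ring_scope.

(* Euclidean inner product and norm; the library norm on 'rV[R]_N is the sup
   norm, which induces the same topology and the same derivatives. *)
Definition dot (R : realType) (N : nat) (u v : 'rV[R]_N) : R :=
  \sum_(i < N) u ord0 i * v ord0 i.

Definition enorm (R : realType) (N : nat) (u : 'rV[R]_N) : R :=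
  Num.sqrt (dot u u).

(* Only meaningful when O is open. *)
Fixpoint Ck_on (R : realType) (N M : nat) (O : set 'rV[R]_N) (s : nat)
    (f : 'rV[R]_N -> 'rV[R]_M) : Prop :=
  match s with
  | 0 => forall x, O x -> {for x, continuous f}
  | s'.+1 => (forall x, O x -> differentiable f x) /\
             (forall v, Ck_on O s' ('D_v f))
  end.

Definition smooth_on (R : realType) (N M : nat) (O : set 'rV[R]_N)
    (f : 'rV[R]_N -> 'rV[R]_M) : Prop :=
  forall s, Ck_on O s f.

Definition ST_mass (R : realType) (n : nat) : R := (n - 3)%:R / 2.

(* The profile function phi, extended to the real line as an even function. *)
Record ST_profile (R : realType) (n : nat) (phi : R -> R) : Prop := STProfile {
  ST_smooth : forall i t, derivable (derive1n i phi) t 1;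
  ST_even : forall t, phi (- t) = phi t;
  ST_at0 : phi 0 = ST_mass R n;
  ST_deriv0 : derive1 phi 0 = 0;
  ST_ode : forall t, 0 <= t ->
    derive1 phi t ^+ 2 = 1 - (ST_mass R n / phi t) ^+ (n - 3);
  ST_increasing : forall t, 0 < t -> 0 < derive1 phi t
}.

(* The metric dt^2 + phi'(t)^2 dtheta^2 of L_0 at x, in Cartesian coordinates:
   t = |x|, dt(a) = <x, a> / t and dtheta(a) = (x_0 a_1 - x_1 a_0) / t^2. As
   phi'(t) / t tends to phi''(0) = 1, its smooth extension to the origin is the
   Euclidean inner product there. *)
Definition L0_metric (R : realType) (phi : R -> R) (x a b : 'rV[R]_2) : R :=
  if x == 0 then dot a b else
  let t := enorm x in
  let dt (c : 'rV[R]_2) := dot x c / t in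
  let dtheta (c : 'rV[R]_2) :=
    (x ord0 0 * c ord0 1 - x ord0 1 * c ord0 0) / t ^+ 2 in
  dt a * dt b + derive1 phi t ^+ 2 * (dtheta a * dtheta b).

(* The product W of N_0 = L_0 x_phi S^(n-2) and the spheres S^(d j)(r j),
   j < k, realized as a submanifold of
     E = R^2 x R^(n-1) x prod_j R^(d j + 1). *)
Section ProductManifold.

Variables (R : realType) (n k : nat) (d : 'I_k -> nat) (r : 'I_k -> R).

Notation E := 'rV[R]_(2 + n.-1 + \sum_(j < k) (d j).+1).

Definition L0_part (v : E) : 'rV[R]_2 := lsubmx (lsubmx v).
Definition fiber_part (v : E) : 'rV[R]_n.-1 := rsubmx (lsubmx v).
Definition sphere_part (v : E) (j : 'I_k) : 'rV[R]_(d j).+1 :=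
  submxrow (rsubmx v) j.

Definition W_set : set E :=
  [set p | enorm (fiber_part p) = 1 /\
           forall j, enorm (sphere_part p j) = r j].

Definition W_tangent (p : E) : set E :=
  [set v | dot (fiber_part p) (fiber_part v) = 0 /\
           forall j, dot (sphere_part p j) (sphere_part v j) = 0].

(* The subspaces T_p P_i; None is the factor N_0 and Some j is S^(d j)(r j). *)
Definition factor_tangent (i : option 'I_k) (p : E) : set E :=
  match i with
  | None => [set v | W_tangent p v /\ forall j, sphere_part v j = 0]
  | Some j => [set v | [/\ W_tangent p v, L0_part v = 0, fiber_part v = 0 &
                           forall j', j' != j -> sphere_part v j' = 0]]
  end.

Definition W_metric (phi : R -> R) (p u v : E) : R :=
  L0_metric phi (L0_part p) (L0_part u) (L0_part v)
  + phi (enorm (L0_part p)) ^+ 2 * dot (fiber_part u) (fiber_part v)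
  + \sum_(j < k) dot (sphere_part u j) (sphere_part v j).

(* The retraction normalizing each sphere component: a smooth submersion onto W
   from the open set where these components are all nonzero. Where one of them
   vanishes its value is not in W, because x / 0 = 0. *)
Definition retr (p : E) : E :=
  row_mx
    (row_mx (L0_part p) ((enorm (fiber_part p))^-1 *: fiber_part p))
    (\mxrow_(j < k) ((r j / enorm (sphere_part p j)) *: sphere_part p j)).

Definition W_open (U : set E) : Prop :=
  exists O : set E, open O /\ U = O `&` W_set.

(* A map on U, open in W, is given by a function on E whose values off U are
   irrelevant. Composing with the retraction makes its smoothness and its
   differential those of a map on an open subset of E. *)
Definition W_smooth (M : nat) (U : set E) (f : E -> 'rV[R]_M) : Prop :=
  smooth_on (retr @^-1` U) (f \o retr).

Definition W_diff (M : nat) (f : E -> 'rV[R]_M) (p v : E) : 'rV[R]_M :=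
  'D_v (f \o retr) p.

Definition local_isometric_immersion (phi : R -> R) (N : nat) (U : set E)
    (Phi : E -> 'rV[R]_N) : Prop :=
  [/\ W_open U, U !=set0, W_smooth U Phi &
      forall p u v, U p -> W_tangent p u -> W_tangent p v ->
        dot (W_diff Phi p u) (W_diff Phi p v) = W_metric phi p u v].

(* Orthogonal projection of w onto the normal space of Phi at p. The row space
   of J is dPhi(T_p W), since the retraction maps T_p E onto T_p W, and the row
   space of kermx J^T is its orthogonal complement. *)
Definition normal_part (N : nat) (Phi : E -> 'rV[R]_N) (p : E) (w : 'rV[R]_N) :
    'rV[R]_N :=
  let J := jacobian (Phi \o retr) p in
  w *m proj_mx (kermx J^T) <<J>>%MS.

(* Gauss formula: X and Y in T_p W, Y being extended to the tangent vector
   field q |-> d(retr)_q Y of W, which dPhi maps to q |-> W_diff Phi q Y. This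
   field stays in T P_i when Y does. *)
Definition second_fundamental_form (N : nat) (Phi : E -> 'rV[R]_N)
    (p X Y : E) : 'rV[R]_N :=
  normal_part Phi p (W_diff (fun q => W_diff Phi q Y) p X).

Definition adapted (N : nat) (U : set E) (Phi : E -> 'rV[R]_N) : Prop :=
  forall p (i j : option 'I_k) X Y, U p -> i != j ->
    factor_tangent i p X -> factor_tangent j p Y ->
    second_fundamental_form Phi p X Y = 0.

Definition tangent_field (U : set E) (X : E -> E) : Prop :=
  W_smooth U X /\ forall p, U p -> W_tangent p (X p).

Definition normal_field (N : nat) (U : set E) (Phi xi : E -> 'rV[R]_N) : Prop :=
  W_smooth U xi /\
  forall p, U p -> forall v, W_tangent p v -> dot (W_diff Phi p v) (xi p) = 0.

Definition lie_bracket (X Y : E -> E) (p : E) : E :=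
  W_diff Y p (X p) - W_diff X p (Y p).

Definition normal_connection (N : nat) (Phi : E -> 'rV[R]_N) (X : E -> E)
    (xi : E -> 'rV[R]_N) (p : E) : 'rV[R]_N :=
  normal_part Phi p (W_diff xi p (X p)).

Definition normal_curvature (N : nat) (Phi : E -> 'rV[R]_N) (X Y : E -> E)
    (xi : E -> 'rV[R]_N) (p : E) : 'rV[R]_N :=
  normal_connection Phi X (normal_connection Phi Y xi) p
  - normal_connection Phi Y (normal_connection Phi X xi) p
  - normal_connection Phi (lie_bracket X Y) xi p.

Definition flat_normal_bundle (N : nat) (U : set E) (Phi : E -> 'rV[R]_N) :
    Prop :=
  forall X Y xi, tangent_field U X -> tangent_field U Y ->
    normal_field U Phi xi ->
    forall p, U p -> normal_curvature Phi X Y xi p = 0.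

End ProductManifold.

(* Main.v *)
(** Write F for the immersion composed with the retraction of the ambient space
onto W, alpha for its second fundamental form, and fix a point over a nonzero
x in L_0. Near it, the fields generated by dilation and rotation of L_0 and by
translations of the other factors commute, and F pulls the Euclidean metric back
to an explicit Gram matrix, so that Koszul's and Gauss's formulas reduce the
curvature of W to second derivatives of that matrix, and hence to phi.

(a) If alpha is adapted, Gauss's equation makes the images of alpha on distinct
factors pairwise orthogonal. Each sphere contributes a nonzero normal vector, and
N_0 contributes two independent ones, since the Schwarzschild curvature tensor is
not the square of a single symmetric form. This gives k + 2 normal directions.

(b) If the normal bundle is flat, Ricci's equation says that the shape operators
S_a commute. Hence they all commute with the sum of the tr(S_a) S_a - S_a^2,
which by Gauss's equation is the Ricci operator: 0 on N_0 and rho_j on the j-th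
sphere. As 0 and the rho_j are distinct, the S_a preserve the factors, so that
alpha is adapted, and (a) applies. Flatness is turned into commutation by
differentiating the matrix P of the projection onto the normal bundle: it says
that [D_u P, D_v P] P = 0, and alpha(u, w) = - dF(w) D_u P. *)
From HB Require Import structures.
Require Import Defs.
From mathcomp Require Import all_boot all_order all_algebra.
From mathcomp Require Import all_classical all_reals all_analysis.
From mathcomp Require Import ring lra zify.
Set Implicit Arguments.
Unset Strict Implicit.
Unset Printing Implicit Defensive.
Import Order.TTheory GRing.Theory Num.Theory.
Import numFieldNormedType.Exports.
Local Open Scope classical_set_scope.
Local Open Scope ring_scope.

(** * Smooth functions *)

(** No orthonormal frame of W is ever chosen. F lives on an open subset of a vector space of
    dimension m + k + 1 and is constant along k + 1 radial directions, so the linear algebra uses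
    redundant frames: the coordinate vectors for the Jacobian, and their images under [sharp] for
    traces. The radial directions must then be controlled everywhere: they span the kernel of dF,
    and they are added to the Gram matrix when it has to be inverted.

    The base point is taken over a nonzero x because dilation and rotation, which are t d/dt and
    d/dtheta there, both vanish over the origin and no longer span L_0. Nothing is lost: every
    nonempty open subset of W contains such a point, and the count of normal directions uses alpha
    at one point only.

    Commuting fields are preferred to covariant derivatives because Koszul's formula then has no
    bracket terms, and Gauss's equation follows from cancelling third derivatives of F. The
    tangential part of second derivatives, that is, the Christoffel symbols of W, is then subtracted
    explicitly. *)

Section ScalarSmoothness.
Variables (R : realType) (V : normedModType R) (O : set V).
Hypothesis oO : open O.
Implicit Types (f g : V -> R) (s : nat).

(** The scalar counterpart of [Ck_on], over any normed space: products and inverses make sense here,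
    and [smooth_on] is recovered coordinate by coordinate. *)
Fixpoint Cks s f : Prop :=
  match s with
  | 0 => forall x, O x -> {for x, continuous f}
  | s'.+1 => (forall x, O x -> differentiable f x) /\
             (forall v, Cks s' ('D_v f))
  end.

Definition smooth f := forall s, Cks s f.

Lemma eq_on_near f g x : (forall y, O y -> f y = g y) -> O x ->
  \near x, f x = g x.
Proof. by move=> fg Ox; apply: filterS (open_nbhs_nbhs (conj oO Ox)). Qed.

Lemma derive_ext f g x v : (forall y, O y -> f y = g y) -> O x ->
  'D_v f x = 'D_v g x.
Proof. by move=> fg Ox; apply/near_eq_derive/eq_on_near. Qed.

Lemma differentiable_ext f g x : (forall y, O y -> f y = g y) -> O x ->
  differentiable f x -> differentiable g x.
Proof.
move=> fg Ox df; have [dc E] := (diff_locallyP x f).1 df.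
(* The first-order expansion of [f] at [x] is also one of [g], the two functions being equal near
   [x]; uniqueness of the differential concludes. *)
have Eg : g \o shift x = cst (g x) + 'd f x +o_ 0 id.
  rewrite -(fg x Ox); apply/eqaddoP => _/posnumP[e].
  have /eqaddoP /(_ e%:num) /(_ [gt0 of e%:num]) := E.
  have : \near x, f x = g x by exact: eq_on_near.
  rewrite (near_shift 0) /= subr0 => fgx; apply: filter_app.
  by apply: filterS fgx => y /=; rewrite !fctE /= => ->.
apply/diff_locallyP; have -> := diff_unique dc Eg.
by split.
Qed.

Lemma Cks_ext s f g : (forall x, O x -> f x = g x) -> Cks s f -> Cks s g.
Proof.
elim: s f g => [|s IH] f g fg /=.
  move=> cf x Ox; have cfx : f y @[y --> x] --> f x by exact: cf.
  suff : g y @[y --> x] --> g x by [].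
  rewrite -(fg x Ox); apply: cvg_trans cfx; apply: near_eq_cvg.
  exact: eq_on_near.
move=> [df Df]; split.
  by move=> x Ox; apply: (differentiable_ext fg) => //; exact: df.
move=> v; apply: IH (Df v) => x Ox; exact: derive_ext.
Qed.

Lemma Cks_le s f : Cks s.+1 f -> Cks s f.
Proof.
elim: s f => [|s IH] f [df Df].
  by move=> x Ox; apply/differentiable_continuous/df.
by split=> // v; apply/IH/Df.
Qed.

Lemma Cks_cst s (c : R) : Cks s (fun=> c).
Proof.
elim: s c => [|s IH] c; first by move=> x Ox; exact: cst_continuous.
split; first by move=> x Ox; exact: differentiable_cst.
move=> v; apply: (Cks_ext _ (IH 0)) => x _; exact/esym/derive_cst.
Qed.

Lemma CksD s f g : Cks s f -> Cks s g -> Cks s (fun x => f x + g x).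
Proof.
elim: s f g => [|s IH] f g /=.
  by move=> cf cg x Ox; apply: continuousD; [exact: cf|exact: cg].
move=> [df Df] [dg Dg]; split.
  by move=> x Ox; apply: differentiableD; [exact: df|exact: dg].
move=> v; apply: Cks_ext (IH _ _ (Df v) (Dg v)) => x Ox.
by rewrite -deriveD //; apply: diff_derivable; [exact: df|exact: dg].
Qed.

Lemma CksM s f g : Cks s f -> Cks s g -> Cks s (fun x => f x * g x).
Proof.
elim: s f g => [|s IH] f g.
  by move=> cf cg x Ox; apply: continuousM; [exact: cf|exact: cg].
move=> Cf Cg; have [df Df] := Cf; have [dg Dg] := Cg; split.
  by move=> x Ox; apply: differentiableM; [exact: df|exact: dg].
move=> v; apply: (@Cks_ext _ (fun x => f x * 'D_v g x + g x * 'D_v f x)).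
  move=> x Ox.
  by rewrite [RHS]deriveM //; apply: diff_derivable; [exact: df|exact: dg].
by apply: CksD; apply: IH; [exact: (Cks_le Cf)|exact: Dg|exact: (Cks_le Cg)|exact: Df].
Qed.

Lemma CksV s f : (forall x, O x -> f x != 0) -> Cks s f ->
  Cks s (fun x => (f x)^-1).
Proof.
move=> f0; elim: s => [|s IH].
  by move=> cf x Ox; exact: (continuousV (f0 x Ox) (cf x Ox)).
move=> Cf; have [df Df] := Cf; split.
  by move=> x Ox; apply: differentiableV; [exact: df|exact: f0].
move=> v; apply: (@Cks_ext _ (fun x => (-1) * ((f x)^-1 * (f x)^-1 * 'D_v f x))).
  move=> x Ox; rewrite deriveV; [|exact: f0|exact/diff_derivable/df].
  by rewrite expr2 invfM mulN1r scaleNr.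
apply: CksM; first exact: Cks_cst.
by apply: CksM; [apply: CksM; exact: IH (Cks_le Cf)|exact: Df].
Qed.

Lemma smooth_ext f g : (forall x, O x -> f x = g x) -> smooth f -> smooth g.
Proof. by move=> fg sf s; exact: Cks_ext (sf s). Qed.

Lemma smooth_cst c : smooth (fun=> c).
Proof. by move=> s; exact: Cks_cst. Qed.

Lemma smoothD f g : smooth f -> smooth g -> smooth (fun x => f x + g x).
Proof. by move=> sf sg s; exact: CksD. Qed.

Lemma smoothM f g : smooth f -> smooth g -> smooth (fun x => f x * g x).
Proof. by move=> sf sg s; exact: CksM. Qed.

Lemma smoothV f : (forall x, O x -> f x != 0) -> smooth f ->
  smooth (fun x => (f x)^-1).
Proof. by move=> f0 sf s; exact: CksV. Qed.

Lemma smoothN f : smooth f -> smooth (fun x => - f x).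
Proof.
move=> sf; apply: (@smooth_ext (fun x => (-1) * f x)).
  by move=> x _; rewrite mulN1r.
by apply: smoothM => //; exact: smooth_cst.
Qed.

Lemma smoothB f g : smooth f -> smooth g -> smooth (fun x => f x - g x).
Proof. by move=> sf sg; apply: smoothD => //; exact: smoothN. Qed.

Lemma smooth_sum (I : Type) (r : seq I) (P : pred I) (F : I -> V -> R) :
  (forall i, smooth (F i)) -> smooth (fun x => \sum_(i <- r | P i) F i x).
Proof.
move=> sF; elim: r => [|i r IH].
  by apply: smooth_ext (smooth_cst 0) => x _; rewrite big_nil.
case Pi : (P i); last by apply: smooth_ext IH => x _; rewrite big_cons Pi.
by apply: smooth_ext (smoothD (sF i) IH) => x _; rewrite big_cons Pi.
Qed.

Lemma smooth_prod (I : Type) (r : seq I) (P : pred I) (F : I -> V -> R) :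
  (forall i, smooth (F i)) -> smooth (fun x => \prod_(i <- r | P i) F i x).
Proof.
move=> sF; elim: r => [|i r IH].
  by apply: smooth_ext (smooth_cst 1) => x _; rewrite big_nil.
case Pi : (P i); last by apply: smooth_ext IH => x _; rewrite big_cons Pi.
by apply: smooth_ext (smoothM (sF i) IH) => x _; rewrite big_cons Pi.
Qed.

Lemma smooth_derive f v : smooth f -> smooth ('D_v f).
Proof. by move=> sf s; have [_] := sf s.+1; apply. Qed.

Lemma smooth_differentiable f x : smooth f -> O x -> differentiable f x.
Proof. by move=> sf; have [+ _] := sf 1; apply. Qed.

Lemma smooth_derivable f x v : smooth f -> O x -> derivable f x v.
Proof. by move=> sf Ox; exact/diff_derivable/smooth_differentiable. Qed.

Lemma smooth_det n (A : V -> 'M[R]_n) :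
  (forall i j, smooth (fun x => A x i j)) -> smooth (fun x => \det (A x)).
Proof.
move=> sA; rewrite /determinant; apply: smooth_sum => s.
by apply: smoothM; [exact: smooth_cst|exact: smooth_prod].
Qed.

(** Cramer's rule: the entries are cofactors divided by the determinant. *)
Lemma smooth_invmx n (A : V -> 'M[R]_n) :
  (forall x, O x -> A x \in unitmx) ->
  (forall i j, smooth (fun x => A x i j)) ->
  forall i j, smooth (fun x => invmx (A x) i j).
Proof.
move=> uA sA i j.
apply: (@smooth_ext (fun x => (\det (A x))^-1 * cofactor (A x) j i)).
  by move=> x Ox; rewrite /invmx uA // !mxE.
apply: smoothM.
  apply: smoothV; last exact: smooth_det.
  by move=> x Ox; have := uA x Ox; rewrite unitmxE unitfE.
rewrite /cofactor; apply: smoothM; first exact: smooth_cst.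
by apply: smooth_det => a b; apply: smooth_ext (sA _ _) => x _; rewrite !mxE.
Qed.

Lemma smooth_mulmx m n p (A : V -> 'M[R]_(m, n)) (B : V -> 'M[R]_(n, p)) :
  (forall i j, smooth (fun x => A x i j)) ->
  (forall i j, smooth (fun x => B x i j)) ->
  forall i j, smooth (fun x => (A x *m B x) i j).
Proof.
move=> sA sB i j.
apply: (@smooth_ext (fun x => \sum_k A x i k * B x k j)).
  by move=> x _; rewrite mxE.
by apply: smooth_sum => k; exact: smoothM.
Qed.

Lemma smooth_linear (f : {linear V -> R}) : continuous f -> smooth f.
Proof.
move=> cf; have df x : differentiable f x by exact: linear_differentiable.
have E v : 'D_v f = fun=> f v.
  by apply/funext => x; rewrite deriveE // diff_lin.
case=> [|s] /=; first by move=> x _; exact: cf.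
by split=> // v; rewrite E; exact: Cks_cst.
Qed.

End ScalarSmoothness.

(** * Symmetry of second derivatives *)

Section Schwarz.
Variables (R : realType) (V : normedModType R).

Lemma line_MVT (f : V -> R) (p u : V) (h : R) : 0 < h ->
  (forall s : R, 0 <= s <= h -> differentiable f (p + s *: u)) ->
  exists2 s, 0 < s < h & f (p + h *: u) - f p = h * 'D_u f (p + s *: u).
Proof.
move=> h0 df.
have D (s : R) : 0 <= s <= h -> is_derive s 1 (fun s : R => f (p + s *: u)) ('D_u f (p + s *: u)).
  move=> sh; have dfs := df s sh.
  have dl : is_diff s (fun s : R => p + s *: u) (fun s => s *: u).
    have := is_diffD (is_diff_cst p s) (is_diff_scalel s u).
    by rewrite add0r.
  have /= dc := is_diff_comp dl (differentiableP dfs).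
  case: dc => dd dv; split; first exact: (diff_derivable dd).
  have E := congr1 (fun k : R -> R => k 1) dv.
  by rewrite (deriveE _ dfs) (deriveE _ dd) E /= scale1r.
have cf : {within `[0, h], continuous (fun s : R => f (p + s *: u))}.
  apply: derivable_within_continuous => s; rewrite in_itv /= => s01.
  by have [] := D s s01.
have D' (s : R) : s \in `]0, h[ -> is_derive s 1 (fun s : R => f (p + s *: u))
  ('D_u f (p + s *: u)).
  by rewrite in_itv /= => /andP[/ltW a /ltW b]; apply: D; rewrite a b.
have [s s01 E] := MVT h0 D' cf.
exists s; first by move: s01; rewrite in_itv.
by move: E; rewrite scale0r addr0 subr0 mulrC.
Qed.

Lemma derive_translate (f : V -> R) (x u c : V) :
  'D_u (fun y => f (y + c)) x = 'D_u f (x + c).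
Proof.
rewrite /derive.
have -> // : (fun h : R => h^-1 *: (((fun y => f (y + c)) \o shift x) (h *: u) - f (x + c)))
   = (fun h : R => h^-1 *: ((f \o shift (x + c)) (h *: u) - f (x + c))).
by apply/funext => z /=; rewrite addrA.
Qed.

(** The second difference of [f] along h u and h v is symmetric in u and v, and after division by
    h^2 it is close to either mixed derivative. *)
Lemma derive_comm (O : set V) (f : V -> R) (p u v : V) : open O -> O p ->
  smooth O f -> 'D_u ('D_v f) p = 'D_v ('D_u f) p.
Proof.
move=> oO Op sf.
(* The mean value theorem, applied along u' to y |-> f(y + h v') - f(y) and then along v' to the
   derivative of f in the direction u', turns the quotient into the mixed derivative at an
   intermediate point. Continuity does the rest. *)
have main (e : R) (u' v' : V) : 0 < e ->
  exists2 d : R, 0 < d & forall h, 0 < h < d ->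
   `| (f (p + h *: u' + h *: v') - f (p + h *: u') - (f (p + h *: v') - f p)) / (h * h)
      - 'D_v' ('D_u' f) p | < e.
  move=> e0.
  have c : {for p, continuous ('D_v' ('D_u' f))}.
    by have := smooth_derive v' (smooth_derive u' sf); move=> /(_ 0%N); apply.
  have c2 : {for (0, 0), continuous (fun st : R * R => p + st.1 *: u' + st.2 *: v')}.
    move=> /=; apply: cvgD; last by apply: cvgZr_tmp; exact: cvg_snd.
    by apply: cvgD; [exact: cvg_cst|apply: cvgZr_tmp; exact: cvg_fst].
  have N : \forall st \near ((0 : R), (0 : R)), O (p + st.1 *: u' + st.2 *: v') /\
     `|'D_v' ('D_u' f) (p + st.1 *: u' + st.2 *: v') - 'D_v' ('D_u' f) p| < e.
    have NN : \forall y \near p, O y /\ `|'D_v' ('D_u' f) y - 'D_v' ('D_u' f) p| < e.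
      apply: filterI; first exact: open_nbhs_nbhs.
      move/cvgrPdist_lt : c => /(_ e e0); apply: filterS => y Hy.
      by rewrite (distrC ('D_v' ('D_u' f) y)); exact: Hy.
    have c3 : p + st.1 *: u' + st.2 *: v' @[st --> ((0 : R), (0 : R))] --> p.
      have E0 : p + (0 : R, 0 : R).1 *: u' + (0 : R, 0 : R).2 *: v' = p.
        by rewrite !scale0r !addr0.
      by rewrite -[X in _ --> X]E0; exact: c2.
    exact: (c3 _ NN).
  have [[/= A B] [nA nB] AB] := N.
  have [a /= a0 aA] := nA; have [b /= b0 bB] := nB.
  exists (Num.min a b); first by rewrite lt_min a0.
  move=> h /andP[h0]; rewrite lt_min => /andP[ha hb].
  have OO s t : 0 <= s <= h -> 0 <= t <= h -> O (p + s *: u' + t *: v') /\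
     `|'D_v' ('D_u' f) (p + s *: u' + t *: v') - 'D_v' ('D_u' f) p| < e.
    move=> /andP[s0 sh] /andP[t0 th].
    apply: (AB (s, t)); split => /=.
      by apply: aA; rewrite /= sub0r normrN ger0_norm //; exact: le_lt_trans ha.
    by apply: bB; rewrite /= sub0r normrN ger0_norm //; exact: le_lt_trans hb.
  have hh : 0 <= h <= h by rewrite (ltW h0) lexx.
  have z0 : 0 <= (0 : R) <= h by rewrite lexx (ltW h0).
  have dg (s : R) : 0 <= s <= h ->
      differentiable (fun y => f (y + h *: v') - f y) (p + s *: u').
    move=> sh; apply: differentiableB.
      apply: (@differentiable_comp _ _ _ _ (fun y => y + h *: v') f).
        by apply: differentiableD => //; exact: differentiable_cst.
      by apply: smooth_differentiable sf _; have [] := OO s h sh hh.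
    apply: smooth_differentiable sf _; have [] := OO s 0 sh z0.
    by rewrite scale0r addr0.
  have [s sh E] := line_MVT h0 dg.
  have sh' : 0 <= s <= h by case/andP: sh => /ltW -> /ltW ->.
  have E1 : 'D_u' (fun y => f (y + h *: v') - f y) (p + s *: u') =
     'D_u' f (p + s *: u' + h *: v') - 'D_u' f (p + s *: u').
    have O1 : O (p + s *: u' + h *: v') by have [] := OO s h sh' hh.
    have O2 : O (p + s *: u').
      by have [] := OO s 0 sh' z0; rewrite scale0r addr0.
    have d1 : derivable (fun y => f (y + h *: v')) (p + s *: u') u'.
      apply/diff_derivable/(@differentiable_comp _ _ _ _ (fun y => y + h *: v') f).
        by apply: differentiableD => //; exact: differentiable_cst.
      exact: smooth_differentiable sf O1.
    have d2 : derivable f (p + s *: u') u' by exact: smooth_derivable sf O2.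
    by rewrite (deriveB d1 d2) derive_translate.
  have dg2 (t : R) : 0 <= t <= h -> differentiable ('D_u' f) (p + s *: u' + t *: v').
    move=> th; apply: smooth_differentiable (smooth_derive u' sf) _.
    by have [] := OO s t sh' th.
  have [t th E2] := line_MVT h0 dg2.
  have th' : 0 <= t <= h by case/andP: th => /ltW -> /ltW ->.
  rewrite E E1 E2 mulrA mulrAC divff ?mul1r; last by rewrite mulf_neq0 // gt_eqF.
  by have [] := OO s t sh' th'.
apply/eqP; rewrite eq_le; apply/andP.
(* By symmetry one inequality is enough. For h below both radii the same quotient is within e / 2 of
   each mixed derivative. *)
have close (u' v' : V) : 'D_u' ('D_v' f) p <= 'D_v' ('D_u' f) p.
  apply/ler_addgt0Pl => e e0.
  have e2 : 0 < e / 2 by rewrite divr_gt0.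
  have [d1 d10 D1] := main (e / 2) u' v' e2.
  have [d2 d20 D2] := main (e / 2) v' u' e2.
  pose h := Num.min d1 d2 / 2.
  have m0 : 0 < Num.min d1 d2 by rewrite lt_min d10.
  have h0 : 0 < h by rewrite divr_gt0.
  have hm : h < Num.min d1 d2 by rewrite /h ltr_pdivrMr // ltr_pMr // ltr1n.
  have /andP[h1 h2] : (h < d1) && (h < d2) by rewrite -lt_min.
  have := D1 h; rewrite h0 h1 => /(_ isT).
  have := D2 h; rewrite h0 h2 => /(_ isT).
  have -> : f (p + h *: v' + h *: u') - f (p + h *: v') - (f (p + h *: u') - f p) =
     f (p + h *: u' + h *: v') - f (p + h *: u') - (f (p + h *: v') - f p).
    by rewrite (addrAC p); ring.
  move: (_ / (h * h)) ('D_u' ('D_v' f) p) ('D_v' ('D_u' f) p) => X A B.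
  rewrite !ltr_norml => /andP[a b] /andP[c g].
  have {}a : - (e / 2) + A < X by rewrite -ltrBrDr.
  have {}g : X < e / 2 + B by rewrite -ltrBlDr.
  have := lt_trans a g; rewrite -ltrBrDl => /ltW /le_trans; apply.
  by rewrite opprK addrAC -splitr addrC.
by split; exact: close.
Qed.

End Schwarz.

(** * Vector-valued maps and vector fields acting as derivations *)

Definition vcomp (R : realType) (V : Type) (N : nat) (F : V -> 'rV[R]_N)
  (a : 'I_N) : V -> R := fun q => F q ord0 a.

(** Locking keeps conversion from reaching the limit behind the directional derivative. *)
HB.lock Definition Lie (R : realType) (M : nat) (X : 'rV[R]_M -> 'rV[R]_M)
  (f : 'rV[R]_M -> R) : 'rV[R]_M -> R := fun q => 'D_(X q) f q.

Section VectorSmoothness.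
Variables (R : realType) (M : nat).
Notation E := 'rV[R]_M.
Variables (O : set E).
Hypothesis oO : open O.

Lemma smooth_coord (i : 'I_M) : smooth O (fun q : E => q ord0 i).
Proof.
have @f : {linear 'rV[R]_M -> R}.
  by exists (fun N : 'rV[R]_M => N ord0 i); do 2![eexists]; do ?[constructor];
     rewrite ?mxE// => ? *; rewrite ?mxE//; move=> ?; rewrite !mxE.
by apply: (@smooth_linear _ _ O oO f); exact: coord_continuous.
Qed.

Lemma derive_coords (f : E -> R) (x v : E) : differentiable f x ->
  'D_v f x = \sum_i v ord0 i * 'D_(delta_mx ord0 i) f x.
Proof.
move=> df; rewrite {1}(row_sum_delta v) deriveE // linear_sum.
by apply: eq_bigr => i _; rewrite linearZ deriveE.
Qed.

Lemma derive_coord (x v : E) i : 'D_v (fun q : E => q ord0 i) x = v ord0 i.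
Proof.
have @f : {linear 'rV[R]_M -> R}.
  by exists (fun N : 'rV[R]_M => N ord0 i); do 2![eexists]; do ?[constructor];
     rewrite ?mxE// => ? *; rewrite ?mxE//; move=> ?; rewrite !mxE.
have cf : continuous f by exact: coord_continuous.
have df : differentiable f x by exact: linear_differentiable.
by rewrite -[LHS]/('D_v f x) deriveE // diff_lin.
Qed.

Section Components.
Variable (N : nat).
Implicit Type F : E -> 'rV[R]_N.

Lemma vcomp_differentiable F q a : differentiable F q ->
  differentiable (vcomp F a) q.
Proof.
move=> dF; apply: (@differentiable_comp _ _ _ _ F (fun w : 'rV[R]_N => w ord0 a)) => //.
exact: differentiable_coord.
Qed.

Lemma vcomp_derive F q v a : derivable F q v ->
  ('D_v F q) ord0 a = 'D_v (vcomp F a) q.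
Proof. by move=> dF; rewrite derive_mx // mxE. Qed.

Lemma differentiable_vcomp F q : (forall a, differentiable (vcomp F a) q) ->
  differentiable F q.
Proof.
move=> dF.
have -> : F = \sum_a (fun q => vcomp F a q *: delta_mx ord0 a).
  apply/funext => z; rewrite fct_sumE [LHS]row_sum_delta.
  by apply: eq_bigr.
apply: differentiable_sum => a; exact: differentiableZl.
Qed.

Lemma Ck_on_vcomp s F a : Ck_on O s F -> Cks O s (vcomp F a).
Proof.
elim: s F => [|s IH] F /=.
  move=> cF x Ox; apply: (@continuous_comp _ _ _ F (fun w : 'rV[R]_N => w ord0 a)).
    exact: cF.
  exact: coord_continuous.
move=> [dF DF]; split; first by move=> x Ox; apply/vcomp_differentiable/dF.
move=> v; apply: (Cks_ext oO _ (IH _ (DF v))) => x Ox.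
by rewrite -vcomp_derive //; exact/diff_derivable/dF.
Qed.

Lemma smooth_on_vcomp F a : smooth_on O F -> smooth O (vcomp F a).
Proof. by move=> sF s; exact: Ck_on_vcomp. Qed.

(** One order is given away: at order 0 the continuity of [F] is deduced from the differentiability
    of its components. For smooth maps this costs nothing. *)
Lemma vcomp_Ck_on s F : (forall a, Cks O s.+1 (vcomp F a)) -> Ck_on O s F.
Proof.
elim: s F => [|s IH] F sF.
  move=> x Ox; apply/differentiable_continuous/differentiable_vcomp => a.
  by have [+ _] := sF a; apply.
have dF x : O x -> differentiable F x.
  by move=> Ox; apply: differentiable_vcomp => a; have [+ _] := sF a; apply.
split=> // v; apply: IH => a; have [_ /(_ v) sv] := sF a.
have {}sv : Cks O s.+1 ('D_v (vcomp F a)) by exact: sv.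
apply: (Cks_ext oO _ sv) => x Ox; rewrite -vcomp_derive //.
exact/diff_derivable/dF.
Qed.

Lemma vcomp_smooth_on F : (forall a, smooth O (vcomp F a)) -> smooth_on O F.
Proof. by move=> sF s; apply: vcomp_Ck_on => a; exact: sF. Qed.

Lemma smooth_on_differentiable F q : smooth_on O F -> O q -> differentiable F q.
Proof. by move=> sF Oq; have [+ _] := sF 1; apply. Qed.

Lemma smooth_on_derive F v : smooth_on O F -> smooth_on O ('D_v F).
Proof. by move=> sF s; have [_] := sF s.+1; apply. Qed.

End Components.

Section Lie.
Implicit Types (X Y Z U : E -> E) (f g : E -> R).

Lemma LieE X f q : Lie X f q = 'D_(X q) f q.
Proof. by rewrite Lie.unlock. Qed.

Definition smooth_field X := forall i, smooth O (vcomp X i).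

Lemma Lie_smooth X f : smooth_field X -> smooth O f -> smooth O (Lie X f).
Proof.
move=> sX sf.
apply: (smooth_ext oO (f := fun q => \sum_i X q ord0 i * 'D_(delta_mx ord0 i) f q)).
  by move=> q Oq; rewrite LieE [RHS]derive_coords //; exact: smooth_differentiable sf Oq.
by apply: smooth_sum => // i; apply: smoothM; [|exact: sX|exact: smooth_derive].
Qed.

Lemma Lie_ext X f g q : (forall x, O x -> f x = g x) -> O q ->
  Lie X f q = Lie X g q.
Proof. by move=> fg Oq; by rewrite !LieE; exact: derive_ext fg Oq. Qed.

Lemma LieD X f g q : smooth O f -> smooth O g -> O q ->
  Lie X (fun x => f x + g x) q = Lie X f q + Lie X g q.
Proof.
by move=> sf sg Oq; rewrite !LieE [LHS]deriveD //; exact: smooth_derivable Oq.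
Qed.

Lemma LieM X f g q : smooth O f -> smooth O g -> O q ->
  Lie X (fun x => f x * g x) q = Lie X f q * g q + f q * Lie X g q.
Proof.
move=> sf sg Oq; rewrite !LieE [LHS]deriveM; try exact: smooth_derivable Oq.
by rewrite addrC /GRing.scale /= mulrC.
Qed.

Lemma Lie_sum X (I : Type) (r : seq I) (F : I -> E -> R) q :
  (forall i, smooth O (F i)) -> O q ->
  Lie X (fun x => \sum_(i <- r) F i x) q = \sum_(i <- r) Lie X (F i) q.
Proof.
move=> sF Oq; elim: r => [|i r IH].
  rewrite big_nil LieE.
  have -> : (fun x : E => \sum_(i <- [::]) F i x) = cst 0.
    by apply/funext => x; rewrite big_nil.
  exact: derive_cst.
rewrite big_cons -IH -LieD //; last exact: smooth_sum.
by congr (Lie X _ q); apply/funext => x; rewrite big_cons.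
Qed.

(** X(Yf) splits into the derivative of f along D_X Y and the Hessian of f on (X, Y). The Hessian is
    symmetric, so only the first term can prevent X and Y from commuting. *)
Lemma Lie_Lie X Y f q : smooth_field X -> smooth_field Y -> smooth O f -> O q ->
  Lie X (Lie Y f) q =
  'D_(\row_i Lie X (vcomp Y i) q) f q + 'D_(X q) ('D_(Y q) f) q.
Proof.
move=> sX sY sf Oq.
have LieEx Z x : O x -> Lie Z f x = \sum_i vcomp Z i x * 'D_(delta_mx ord0 i) f x.
  by move=> Ox; rewrite LieE derive_coords //; exact: smooth_differentiable sf Ox.
have df := smooth_differentiable sf Oq.
rewrite (Lie_ext X (LieEx Y) Oq) Lie_sum //; last first.
  by move=> i; apply: smoothM; [|exact: sY|exact: smooth_derive].
have -> : 'D_(X q) ('D_(Y q) f) q =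
    \sum_i vcomp Y i q * 'D_(X q) ('D_(delta_mx ord0 i) f) q.
  have sYf i : smooth O (fun x => vcomp Y i q * 'D_(delta_mx ord0 i) f x).
    by apply: smoothM => //; [exact: smooth_cst|exact: smooth_derive].
  transitivity (Lie (fun=> X q) (fun x => \sum_i vcomp Y i q * 'D_(delta_mx ord0 i) f x) q).
    rewrite LieE; apply: (derive_ext oO _ _ Oq) => x Ox.
    by rewrite derive_coords //; exact: smooth_differentiable sf Ox.
  rewrite Lie_sum //; apply: eq_bigr => i _.
  rewrite (LieM _ (smooth_cst oO _) (smooth_derive _ sf) Oq) !LieE derive_cst.
  by rewrite mul0r add0r.
rewrite (derive_coords _ df) -big_split; apply: eq_bigr => i _ /=.
rewrite mxE (LieM X (sY i) (smooth_derive _ sf) Oq).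
by rewrite [Lie X ('D_ _ f) q]LieE.
Qed.

Lemma Lie_comm X Y f q : smooth_field X -> smooth_field Y ->
  (forall i x, O x -> Lie X (vcomp Y i) x = Lie Y (vcomp X i) x) ->
  smooth O f -> O q -> Lie X (Lie Y f) q = Lie Y (Lie X f) q.
Proof.
move=> sX sY XY sf Oq; rewrite (Lie_Lie sX sY sf Oq) (Lie_Lie sY sX sf Oq).
rewrite (derive_comm (X q) (Y q) oO Oq sf); congr ('D_ _ f q + _).
by apply/rowP => i; rewrite !mxE XY.
Qed.

End Lie.

(* [ring] tries to unify its atoms by conversion, which unfolds limits. *)
Local Ltac generalize_Lie :=
  repeat match goal with |- context [Lie ?X ?f ?q] =>
    generalize (Lie X f q); intro end.

(** * The formulas of Koszul and Gauss for commuting fields *)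

Section Gauss.
Variables (N : nat) (F : E -> 'rV[R]_N).
Hypothesis sF : forall a, smooth O (vcomp F a).

Definition gram (X Y : E -> E) : E -> R :=
  fun q => \sum_a Lie X (vcomp F a) q * Lie Y (vcomp F a) q.

Definition Lie_commute (X Y : E -> E) :=
  forall f q, smooth O f -> O q -> Lie X (Lie Y f) q = Lie Y (Lie X f) q.

Lemma Lie_gram X Y Z q : smooth_field X -> smooth_field Y -> smooth_field Z ->
  O q -> Lie Z (gram X Y) q =
  \sum_a (Lie Z (Lie X (vcomp F a)) q * Lie Y (vcomp F a) q
          + Lie X (vcomp F a) q * Lie Z (Lie Y (vcomp F a)) q).
Proof.
move=> sX sY sZ Oq; rewrite /gram Lie_sum //; last first.
  by move=> a; apply: smoothM => //; exact: Lie_smooth.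
by apply: eq_bigr => a _; rewrite LieM //; exact: Lie_smooth.
Qed.

(** For commuting fields the vectors X(YF) are symmetric in X and Y, so after expansion by Leibniz'
    rule all terms but the wanted one cancel in pairs. *)
Lemma koszul X Y Z q : smooth_field X -> smooth_field Y -> smooth_field Z ->
  Lie_commute X Y -> Lie_commute X Z -> Lie_commute Y Z -> O q ->
  2 * \sum_a Lie X (Lie Y (vcomp F a)) q * Lie Z (vcomp F a) q =
  Lie X (gram Y Z) q + Lie Y (gram X Z) q - Lie Z (gram X Y) q.
Proof.
move=> sX sY sZ cXY cXZ cYZ Oq; rewrite !Lie_gram // mulr_sumr.
rewrite -big_split -sumrB; apply: eq_bigr => a _ /=.
rewrite (cXY _ _ (sF a) Oq) (cXZ _ _ (sF a) Oq) (cYZ _ _ (sF a) Oq).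
by generalize_Lie; ring.
Qed.

Lemma Lie2_gram X Y Z U q : smooth_field X -> smooth_field Y ->
  smooth_field Z -> smooth_field U -> O q -> Lie U (Lie Z (gram X Y)) q =
  \sum_a (Lie U (Lie Z (Lie X (vcomp F a))) q * Lie Y (vcomp F a) q
          + Lie Z (Lie X (vcomp F a)) q * Lie U (Lie Y (vcomp F a)) q
          + Lie U (Lie X (vcomp F a)) q * Lie Z (Lie Y (vcomp F a)) q
          + Lie X (vcomp F a) q * Lie U (Lie Z (Lie Y (vcomp F a))) q).
Proof.
move=> sX sY sZ sU Oq.
rewrite (Lie_ext U (fun x Ox => Lie_gram sX sY sZ Ox) Oq).
have s1 W a : smooth_field W -> smooth O (Lie W (vcomp F a)).
  by move=> sW; exact: Lie_smooth.
have s2 W W' a : smooth_field W -> smooth_field W' -> smooth O (Lie W (Lie W' (vcomp F a))).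
  by move=> sW sW'; apply: Lie_smooth => //; exact: s1.
rewrite Lie_sum //; last first.
  by move=> a; apply: smoothD => //; apply: smoothM; rewrite //; auto.
apply: eq_bigr => a _; rewrite LieD //; last first.
- by apply: smoothM; auto.
- by apply: smoothM; auto.
rewrite -[RHS]addrA; congr (_ + _).
  exact: (LieM U (s2 _ _ a sZ sX) (s1 _ a sY) Oq).
exact: (LieM U (s1 _ a sX) (s2 _ _ a sZ sY) Oq).
Qed.

(** In this alternating sum the third derivatives of [F] cancel and products of two second
    derivatives remain. These are not yet projected to the normal space; their tangential parts are
    removed in [nH_gauss]. *)
Lemma gauss X Y Z U q : smooth_field X -> smooth_field Y ->
  smooth_field Z -> smooth_field U ->
  Lie_commute X Y -> Lie_commute X Z -> Lie_commute X U ->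
  Lie_commute Y Z -> Lie_commute Y U -> Lie_commute Z U -> O q ->
  2 * (\sum_a Lie X (Lie Z (vcomp F a)) q * Lie Y (Lie U (vcomp F a)) q
       - \sum_a Lie X (Lie U (vcomp F a)) q * Lie Y (Lie Z (vcomp F a)) q) =
  Lie X (Lie U (gram Y Z)) q - Lie X (Lie Z (gram Y U)) q
  - Lie Y (Lie U (gram X Z)) q + Lie Y (Lie Z (gram X U)) q.
Proof.
move=> sX sY sZ sU cXY cXZ cXU cYZ cYU cZU Oq.
have sub4 (A t1 t2 t3 t4 s1 s2 s3 s4 : R) : t1 = s1 -> t2 = s2 -> t3 = s3 ->
  t4 = s4 -> A = s1 - s2 - s3 + s4 -> A = t1 - t2 - t3 + t4.
  by move=> -> -> -> ->.
apply: (sub4 _ _ _ _ _ _ _ _ _ (Lie2_gram sY sZ sU sX Oq)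
  (Lie2_gram sY sU sZ sX Oq) (Lie2_gram sX sZ sU sY Oq)
  (Lie2_gram sX sU sZ sY Oq)).
rewrite -!sumrB -big_split mulr_sumr /=.
apply: eq_bigr => a _.
have sa := sF a.
have in2 W (A B : E -> E) : Lie_commute A B ->
    Lie W (Lie A (Lie B (vcomp F a))) q = Lie W (Lie B (Lie A (vcomp F a))) q.
  by move=> cAB; apply: Lie_ext => // x Ox; exact: cAB.
have s1 W : smooth_field W -> smooth O (Lie W (vcomp F a)).
  by move=> sW; exact: Lie_smooth.
rewrite (cXY _ _ sa Oq) (cZU _ _ sa Oq).
rewrite -(cYU _ _ sa Oq) -(cXZ _ _ sa Oq) -(cXU _ _ sa Oq) -(cYZ _ _ sa Oq).
rewrite -(in2 X _ _ cYU) -(in2 X _ _ cYZ) -(in2 Y _ _ cXU) -(in2 Y _ _ cXZ).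
rewrite (in2 X _ _ cZU) (in2 Y _ _ cZU).
rewrite (cXY _ _ (s1 _ sU) Oq) (cXY _ _ (s1 _ sZ) Oq).
by generalize_Lie; ring.
Qed.

End Gauss.
End VectorSmoothness.

(** * The ambient space and the retraction *)

Section Dot.
Variables (R : realType) (N : nat).
Implicit Types u v w : 'rV[R]_N.

Lemma dotE u v : dot u v = (u *m v^T) ord0 ord0.
Proof. by rewrite mxE; apply: eq_bigr => i _; rewrite mxE. Qed.

Lemma dotC u v : dot u v = dot v u.
Proof. by apply: eq_bigr => i _; rewrite mulrC. Qed.

Lemma dotDl u v w : dot (u + v) w = dot u w + dot v w.
Proof. by rewrite !dotE mulmxDl mxE. Qed.

Lemma dotDr u v w : dot u (v + w) = dot u v + dot u w.
Proof. by rewrite dotC dotDl !(dotC u). Qed.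

Lemma dotZl c u v : dot (c *: u) v = c * dot u v.
Proof. by rewrite !dotE -scalemxAl mxE. Qed.

Lemma dotZr c u v : dot u (c *: v) = c * dot u v.
Proof. by rewrite dotC dotZl dotC. Qed.

Lemma dotNl u v : dot (- u) v = - dot u v.
Proof. by rewrite -scaleN1r dotZl mulN1r. Qed.

Lemma dotNr u v : dot u (- v) = - dot u v.
Proof. by rewrite dotC dotNl dotC. Qed.

Lemma dotBl u v w : dot (u - v) w = dot u w - dot v w.
Proof. by rewrite dotDl dotNl. Qed.

Lemma dotBr u v w : dot u (v - w) = dot u v - dot u w.
Proof. by rewrite dotDr dotNr. Qed.

Lemma dot0l u : dot 0 u = 0.
Proof. by rewrite dotE mul0mx mxE. Qed.

Lemma dot0r u : dot u 0 = 0.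
Proof. by rewrite dotC dot0l. Qed.

Lemma dot_suml (I : Type) (r : seq I) (F : I -> 'rV[R]_N) v :
  dot (\sum_(i <- r) F i) v = \sum_(i <- r) dot (F i) v.
Proof.
elim: r => [|i r IH]; first by rewrite !big_nil dot0l.
by rewrite !big_cons dotDl IH.
Qed.

Lemma dot_ge0 u : 0 <= dot u u.
Proof. by apply: sumr_ge0 => i _; rewrite -expr2 sqr_ge0. Qed.

Lemma dot_eq0 u : (dot u u == 0) = (u == 0).
Proof.
apply/idP/eqP => [|->]; last by rewrite dot0l.
rewrite psumr_eq0 => [/allP u0|i _]; last by rewrite -expr2 sqr_ge0.
apply/rowP => i; rewrite mxE; apply/eqP.
by have := u0 i (mem_index_enum i); rewrite mulf_eq0 orbb.
Qed.

Lemma dot_gt0 u : (0 < dot u u) = (u != 0).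
Proof. by rewrite lt_def dot_ge0 andbT dot_eq0. Qed.

Lemma sqr_enorm u : enorm u ^+ 2 = dot u u.
Proof. by rewrite sqr_sqrtr // dot_ge0. Qed.

Lemma enorm_gt0 u : (0 < enorm u) = (u != 0).
Proof. by rewrite sqrtr_gt0 dot_gt0. Qed.

Lemma enorm_ge0 u : 0 <= enorm u.
Proof. exact: sqrtr_ge0. Qed.

Lemma enormZ c u : 0 <= c -> enorm (c *: u) = c * enorm u.
Proof.
move=> c0; rewrite /enorm dotZl dotZr mulrA -expr2 sqrtrM ?sqr_ge0 //.
by rewrite sqrtr_sqr ger0_norm.
Qed.

Lemma dot_delta i u : dot (delta_mx ord0 i) u = u ord0 i.
Proof. by rewrite dotE -rowE !mxE. Qed.

End Dot.

Section NormalProjection.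
Variables (R : realType) (N M : nat) (J : 'M[R]_(M, N)).

(** A vector of the row space that is orthogonal to all rows is orthogonal to itself. *)
Lemma kermx_cap0 : (kermx J^T :&: <<J>> = 0)%MS.
Proof.
apply/eqP; rewrite -submx0; apply/row_subP => i.
set w := row i _.
have : (w <= kermx J^T :&: <<J>>)%MS by exact: row_sub.
rewrite sub_capmx genmxE => /andP[/sub_kermxP wJ /submxP[c wc]].
suff -> : w = 0 by exact: sub0mx.
by apply/eqP; rewrite -dot_eq0 dotE {2}wc trmx_mul mulmxA wJ mul0mx mxE.
Qed.

Lemma normal_projE w1 (w2 : 'rV[R]_N) : w1 *m J^T = 0 -> (w2 <= J)%MS ->
  (w1 + w2) *m proj_mx (kermx J^T) <<J>>%MS = w1.
Proof.
move=> w1J w2J; rewrite mulmxDl proj_mx_id ?proj_mx_0 ?addr0 //.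
- exact: kermx_cap0.
- by rewrite genmxE.
- exact: kermx_cap0.
- exact/sub_kermxP.
Qed.

End NormalProjection.

HB.lock Definition mkE (R : realType) (n k : nat) (d : 'I_k -> nat)
  (a : 'rV[R]_2) (b : 'rV[R]_n.-1) (c : forall j, 'rV[R]_(d j).+1) :
  'rV[R]_(2 + n.-1 + \sum_(j < k) (d j).+1) :=
  row_mx (row_mx a b) (\mxrow_(j < k) c j).

Section Product.
Variables (R : realType) (n k : nat) (d : 'I_k -> nat).
Notation E := 'rV[R]_(2 + n.-1 + \sum_(j < k) (d j).+1).
Implicit Types (p q u v w : E).

Implicit Types (a : 'rV[R]_2) (b : 'rV[R]_n.-1) (e : forall j, 'rV[R]_(d j).+1).

Lemma L0_mkE a b e : L0_part (mkE a b e) = a.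
Proof. by rewrite mkE.unlock /L0_part !row_mxKl. Qed.
Lemma fiber_mkE a b e : fiber_part (mkE a b e) = b.
Proof. by rewrite mkE.unlock /fiber_part row_mxKl row_mxKr. Qed.
Lemma sphere_mkE a b e j : sphere_part (mkE a b e) j = e j.
Proof. by rewrite mkE.unlock /sphere_part row_mxKr mxrowK. Qed.

Lemma partsP u v : L0_part u = L0_part v -> fiber_part u = fiber_part v ->
  (forall j, sphere_part u j = sphere_part v j) -> u = v.
Proof.
move=> e1 e2 /mxrowP e3.
by rewrite -[u]hsubmxK -[v]hsubmxK e3 -[lsubmx u]hsubmxK -[lsubmx v]hsubmxK
  -/(L0_part u) -/(fiber_part u) e1 e2.
Qed.

Lemma L0_partD u v : L0_part (u + v) = L0_part u + L0_part v.
Proof. by rewrite /L0_part !linearD. Qed.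
Lemma L0_partZ c u : L0_part (c *: u) = c *: L0_part u.
Proof. by rewrite /L0_part !linearZ. Qed.
Lemma fiber_partD u v : fiber_part (u + v) = fiber_part u + fiber_part v.
Proof. by rewrite /fiber_part !linearD. Qed.
Lemma fiber_partZ c u : fiber_part (c *: u) = c *: fiber_part u.
Proof. by rewrite /fiber_part !linearZ. Qed.
Lemma sphere_partD u v j : sphere_part (u + v) j = sphere_part u j + sphere_part v j.
Proof. by apply/rowP => i; rewrite !mxE. Qed.
Lemma sphere_partZ c u j : sphere_part (c *: u) j = c *: sphere_part u j.
Proof. by apply/rowP => i; rewrite !mxE. Qed.

Lemma L0_partN u : L0_part (- u) = - L0_part u.
Proof. by rewrite -scaleN1r L0_partZ scaleN1r. Qed.
Lemma fiber_partN u : fiber_part (- u) = - fiber_part u.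
Proof. by rewrite -scaleN1r fiber_partZ scaleN1r. Qed.
Lemma sphere_partN u j : sphere_part (- u) j = - sphere_part u j.
Proof. by rewrite -scaleN1r sphere_partZ scaleN1r. Qed.

Definition partE := (L0_mkE, fiber_mkE, sphere_mkE, L0_partD, L0_partZ,
  fiber_partD, fiber_partZ, sphere_partD, sphere_partZ, L0_partN, fiber_partN, sphere_partN).

Lemma L0_coord (i : 'I_2) : exists l, forall u, L0_part u ord0 i = u ord0 l.
Proof. by eexists => u; rewrite !mxE; reflexivity. Qed.
Lemma fiber_coord (i : 'I_n.-1) : exists l, forall u, fiber_part u ord0 i = u ord0 l.
Proof. by eexists => u; rewrite !mxE; reflexivity. Qed.
Lemma sphere_coord j (i : 'I_(d j).+1) :
  exists l, forall u, sphere_part u j ord0 i = u ord0 l.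
Proof. by eexists => u; rewrite !mxE; reflexivity. Qed.

Lemma mkE_parts u : mkE (L0_part u) (fiber_part u) (sphere_part u) = u.
Proof. by apply: partsP => [||j]; rewrite partE. Qed.

Lemma dot_parts u v : dot u v = dot (L0_part u) (L0_part v)
  + dot (fiber_part u) (fiber_part v)
  + \sum_j dot (sphere_part u j) (sphere_part v j).
Proof.
rewrite -[u in LHS]mkE_parts -[v in LHS]mkE_parts dotE mkE.unlock.
rewrite !tr_row_mx !mul_row_col tr_mxrow mul_mxrow_mxcol 2!mxE summxE.
by rewrite -!dotE; congr (_ + _); apply: eq_bigr => j _; rewrite dotE.
Qed.

End Product.

Lemma is_derive_chain (R : realType) (V : normedModType R) (g : V -> R)
    (h : R -> R) (p v : V) (dg : R) :
  differentiable g p -> 'D_v g p = dg -> derivable h (g p) 1 ->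
  is_derive p v (fun q => h (g q)) (derive1 h (g p) * dg).
Proof.
move=> dgp <- /derivable1_diffP dh.
have dc : differentiable (h \o g) p by exact: differentiable_comp.
split; first exact/diff_derivable.
rewrite [LHS](deriveE _ dc) diff_comp //= (deriveE _ dgp).
have /derivable1_diffP /deriv1E -> := dh.
by rewrite /GRing.scale /= mulrC.
Qed.

Section PointwiseDerivatives.
Variables (R : realType) (V : normedModType R).
Implicit Types (f g : V -> R) (x v : V) (df dg : R).

Lemma is_derive_fctD f g x v df dg : is_derive x v f df -> is_derive x v g dg ->
  is_derive x v (fun y => f y + g y) (df + dg).
Proof. exact: is_deriveD. Qed.

Lemma is_derive_fctM f g x v df dg : is_derive x v f df -> is_derive x v g dg ->
  is_derive x v (fun y => f y * g y) (df * g x + f x * dg).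
Proof.
move=> hf hg; have := is_deriveM hf hg.
by rewrite addrC /GRing.scale /= (mulrC (g x)).
Qed.

Lemma is_derive_fctV f x v df : f x != 0 -> is_derive x v f df ->
  is_derive x v (fun y => (f y)^-1) (- df / f x ^+ 2).
Proof.
move=> f0 [hf hdf]; split; first exact: derivableV.
by rewrite deriveV // hdf /GRing.scale /= mulNr mulNr mulrC.
Qed.

Lemma is_derive_fct_cst (c : R) x v : is_derive x v (fun=> c) 0.
Proof. exact: is_derive_cst. Qed.

Lemma is_derive_fctN f x v df : is_derive x v f df ->
  is_derive x v (fun y => - f y) (- df).
Proof. exact: is_deriveN. Qed.

Lemma is_derive_fct_sum (I : Type) (s : seq I) (f : I -> V -> R) x v (df : I -> R) :
  (forall i, is_derive x v (f i) (df i)) ->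
  is_derive x v (fun y => \sum_(i <- s) f i y) (\sum_(i <- s) df i).
Proof.
move=> hf; elim: s => [|i s IH].
  rewrite big_nil.
  have -> : (fun y => \sum_(i <- [::]) f i y) = (fun=> 0).
    by apply/funext => y; rewrite big_nil.
  exact: is_derive_fct_cst.
rewrite big_cons.
have -> : (fun y => \sum_(j <- i :: s) f j y) = (fun y => f i y + \sum_(j <- s) f j y).
  by apply/funext => y; rewrite big_cons.
exact: is_derive_fctD.
Qed.

End PointwiseDerivatives.

(** * Maps that select ambient coordinates, such as [L0_part], [fiber_part] and [sphere_part] *)

Section PartMaps.
Variables (R : realType) (M N : nat) (pi : 'rV[R]_M -> 'rV[R]_N).
Notation E := 'rV[R]_M.
Hypothesis hpi : forall i, exists l, forall u, pi u ord0 i = u ord0 l.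
Implicit Types (p v c : E).

Lemma part_coord_smooth i : smooth [set: E] (fun q => pi q ord0 i).
Proof.
have [l hl] := hpi i; apply: (smooth_ext openT (f := fun q : E => q ord0 l)).
  by move=> q _; rewrite hl.
exact: smooth_coord openT l.
Qed.

Lemma part_coord_derive p v i :
  is_derive p v (fun q => pi q ord0 i) (pi v ord0 i).
Proof.
have [l hl] := hpi i; split.
  by apply: smooth_derivable (part_coord_smooth i) _.
by have -> : (fun q => pi q ord0 i) = (fun q : E => q ord0 l);
  [apply/funext => q; rewrite hl|rewrite derive_coord hl].
Qed.

Lemma dot_part_smooth (c : 'rV[R]_N) : smooth [set: E] (fun q => dot (pi q) c).
Proof.
apply: smooth_sum; first exact: openT.
move=> i; apply: smoothM (part_coord_smooth i) (smooth_cst _ _); exact: openT.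
Qed.

Lemma dot_part_sq_smooth : smooth [set: E] (fun q => dot (pi q) (pi q)).
Proof.
apply: smooth_sum; first exact: openT.
move=> i; apply: smoothM (part_coord_smooth i) (part_coord_smooth i).
exact: openT.
Qed.

Lemma is_derive_dot_part p v c :
  is_derive p v (fun q => dot (pi q) (pi c)) (dot (pi v) (pi c)).
Proof.
have := is_derive_fct_sum (index_enum 'I_N) (fun i =>
  is_derive_fctM (part_coord_derive p v i) (is_derive_fct_cst (pi c ord0 i) p v)).
by under eq_bigr do rewrite mulr0 addr0.
Qed.

Lemma is_derive_dot_part_sq p v :
  is_derive p v (fun q => dot (pi q) (pi q)) (2 * dot (pi p) (pi v)).
Proof.
have := is_derive_fct_sum (index_enum 'I_N) (fun i =>
  is_derive_fctM (part_coord_derive p v i) (part_coord_derive p v i)).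
congr is_derive; rewrite mulr_sumr; apply: eq_bigr => i _.
by rewrite mulr2n mulrDl mul1r (mulrC (pi v ord0 i)).
Qed.

Lemma enorm_part_differentiable p : pi p != 0 ->
  differentiable (fun q => enorm (pi q)) p.
Proof.
move=> p0; apply: (@differentiable_comp _ _ _ _ (fun q => dot (pi q) (pi q)) Num.sqrt).
  by apply: smooth_differentiable dot_part_sq_smooth _.
apply/derivable1_diffP; have hp : 0 < dot (pi p) (pi p) by rewrite dot_gt0.
by have [] := is_derive1_sqrt hp.
Qed.

(** The value is read off from the derivative of the squared norm; the square root enters only
    through its differentiability. *)
Lemma is_derive_enorm_part p v : pi p != 0 ->
  is_derive p v (fun q => enorm (pi q)) (dot (pi p) (pi v) / enorm (pi p)).
Proof.
move=> p0; have dn := enorm_part_differentiable p0.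
have den := diff_derivable (v := v) dn.
split => //; have n0 : enorm (pi p) != 0 by rewrite gt_eqF // enorm_gt0.
have [_] := is_derive_dot_part_sq p v.
have -> : (fun q => dot (pi q) (pi q)) = (fun q => enorm (pi q) * enorm (pi q)).
  by apply/funext => q; rewrite -expr2 sqr_enorm.
have [_ ->] := is_derive_fctM (derivableP den) (derivableP den).
rewrite mulrC -mulr2n -[LHS]mulr_natl => H.
apply: (mulIf n0); rewrite divfK //.
have two : (2 : R) != 0 by rewrite pnatr_eq0.
by apply: (mulfI two); rewrite -H; congr (_ * _); exact: mulrC.
Qed.

End PartMaps.

(** * The retraction and its invariance under dilations of the components *)

Section Retraction.
Variables (R : realType) (n k : nat) (d : 'I_k -> nat) (r : 'I_k -> R).
Hypothesis hr : forall j, 0 < r j.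
Notation E := 'rV[R]_(2 + n.-1 + \sum_(j < k) (d j).+1).
Implicit Types (p q u v w : E).

Lemma coord_cases (i : 'I_(2 + n.-1 + \sum_(j < k) (d j).+1)) :
  [\/ exists l, forall u : E, u ord0 i = L0_part u ord0 l,
      exists l, forall u : E, u ord0 i = fiber_part u ord0 l |
      exists j l, forall u : E, u ord0 i = sphere_part u j ord0 l].
Proof.
case: (split_ordP i) => [i' ->|i' ->].
  case: (split_ordP i') => [l ->|l ->].
    by apply: Or31; exists l => u; rewrite !mxE.
  by apply: Or32; exists l => u; rewrite !mxE.
apply: Or33; exists (tagnat.sig1 i'), (tagnat.sig2 i') => u; rewrite !mxE.
by rewrite tagnat.sig2K.
Qed.

(** Independent dilations of the fiber and sphere components. Positive ones do not change [retr],
    and [retr p] is itself such a dilate of [p], with factors depending on [p]. *)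
Definition scal (a : R) (b : 'I_k -> R) u : E :=
  mkE (L0_part u) (a *: fiber_part u) (fun j => b j *: sphere_part u j).

Lemma retrE p : retr r p =
  scal (enorm (fiber_part p))^-1 (fun j => r j / enorm (sphere_part p j)) p.
Proof. by rewrite /scal mkE.unlock. Qed.

Lemma scal_linear a b c u v :
  scal a b (c *: u + v) = c *: scal a b u + scal a b v.
Proof.
by apply: partsP => [||j]; rewrite !partE // scalerDr !scalerA mulrC.
Qed.

Lemma retr_scal a b p : 0 < a -> (forall j, 0 < b j) ->
  retr r (scal a b p) = retr r p.
Proof.
move=> a0 b0; apply: partsP => [||j]; rewrite !retrE !partE // !enormZ ?ltW //.
  by rewrite scalerA invfM mulrAC mulVf ?mul1r // gt_eqF.
rewrite scalerA invfM [_^-1 * _]mulrC mulrA mulfVK //.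
by rewrite gt_eqF.
Qed.

Definition nonzero_parts p := fiber_part p != 0 /\ forall j, sphere_part p j != 0.

Lemma W_nonzero p : W_set r p -> nonzero_parts p.
Proof.
case=> f1 sr; split=> [|j]; rewrite -enorm_gt0 ?f1 ?ltr01 // sr //.
Qed.

Lemma W_set_retr p : nonzero_parts p -> W_set r (retr r p).
Proof.
move=> [f0 s0]; split=> [|j]; rewrite retrE !partE enormZ.
- by rewrite mulVf // gt_eqF // enorm_gt0.
- by rewrite invr_ge0 enorm_ge0.
- by rewrite divfK // gt_eqF // enorm_gt0.
- by rewrite divr_ge0 ?enorm_ge0 // ltW.
Qed.

Lemma W_set_retrP p : W_set r (retr r p) -> nonzero_parts p.
Proof.
move=> /W_nonzero[]; rewrite retrE !partE => f0 s0; split=> [|j].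
  by apply: contraNneq f0 => ->; rewrite scaler0.
by have := s0 j; rewrite !partE; apply: contraNneq => ->; rewrite scaler0.
Qed.

Lemma retr_id p : W_set r p -> retr r p = p.
Proof.
move=> [f1 sr]; apply: partsP => [||j]; rewrite retrE !partE //.
  by rewrite f1 invr1 scale1r.
by rewrite sr divff ?scale1r // gt_eqF.
Qed.

Lemma L0_differentiable p l : differentiable (fun q : E => L0_part q ord0 l) p.
Proof. by apply: smooth_differentiable (part_coord_smooth (@L0_coord R n k d) l) _. Qed.

Lemma retr_differentiable p : nonzero_parts p -> differentiable (retr r) p.
Proof.
move=> [f0 s0]; apply: differentiable_vcomp => i; rewrite /vcomp.
have aux N' (pi : E -> 'rV[R]_N') (l : 'I_N') (c : R) :
    (forall i, exists l, forall u, pi u ord0 i = u ord0 l) -> pi p != 0 ->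
    differentiable (fun q => c / enorm (pi q) * pi q ord0 l) p.
  move=> hpi p0; apply: differentiableM; last first.
    by apply: smooth_differentiable (part_coord_smooth hpi l) _.
  apply: differentiableM; first exact: differentiable_cst.
  apply: differentiableV; first exact: enorm_part_differentiable.
  by rewrite gt_eqF // enorm_gt0.
case: (coord_cases i) => [[l hl]|[l hl]|[j [l hl]]].
- have -> : (fun q => retr r q ord0 i) = (fun q : E => L0_part q ord0 l).
    by apply/funext => q; rewrite hl retrE !partE.
  exact: L0_differentiable.
- have -> : (fun q => retr r q ord0 i) =
      (fun q : E => 1 / enorm (fiber_part q) * fiber_part q ord0 l).
    by apply/funext => q; rewrite hl retrE !partE mxE mul1r.
  by apply: aux => //; exact: fiber_coord.
- have -> : (fun q => retr r q ord0 i) =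
      (fun q : E => r j / enorm (sphere_part q j) * sphere_part q j ord0 l).
    by apply/funext => q; rewrite hl retrE !partE mxE.
  by apply: (aux _ (fun q => sphere_part q j)) => //; exact: sphere_coord.
Qed.

(** Along a tangent vector the norms of the components are stationary, so the normalizing factors,
    equal to 1 on W, contribute nothing. *)
Lemma retr_derive p u : W_set r p -> W_tangent p u -> 'D_u (retr r) p = u.
Proof.
move=> Wp [tf ts]; have [f0 s0] := W_nonzero Wp; have [f1 sr] := Wp.
have dr := diff_derivable (v := u) (retr_differentiable (W_nonzero Wp)).
have aux N' (pi : E -> 'rV[R]_N') (l : 'I_N') (c : R) :
    (forall i, exists l, forall u, pi u ord0 i = u ord0 l) -> pi p != 0 ->
    enorm (pi p) = c -> dot (pi p) (pi u) = 0 ->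
    'D_u (fun q => c / enorm (pi q) * pi q ord0 l) p = pi u ord0 l.
  move=> hpi p0 ec du.
  have e0 : enorm (pi p) != 0 by rewrite gt_eqF // enorm_gt0.
  have h1 := @is_derive_fctV _ _ (fun q => enorm (pi q)) p u _ e0
    (is_derive_enorm_part hpi u p0).
  have h2 := is_derive_fctM (is_derive_fct_cst c p u) h1.
  have [_ ->] := is_derive_fctM h2 (part_coord_derive hpi p u l).
  by rewrite du !(mul0r, oppr0, mulr0, add0r) -ec divff // mul1r.
apply/rowP => i; rewrite vcomp_derive // /vcomp.
case: (coord_cases i) => [[l hl]|[l hl]|[j [l hl]]].
- have -> : (fun q => retr r q ord0 i) = (fun q : E => L0_part q ord0 l).
    by apply/funext => q; rewrite hl retrE !partE.
  by have [_ ->] := part_coord_derive (@L0_coord R n k d) p u l; rewrite hl.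
- have -> : (fun q => retr r q ord0 i) =
      (fun q : E => 1 / enorm (fiber_part q) * fiber_part q ord0 l).
    by apply/funext => q; rewrite hl retrE !partE mxE mul1r.
  by rewrite aux ?hl //; exact: fiber_coord.
- have -> : (fun q => retr r q ord0 i) =
      (fun q : E => r j / enorm (sphere_part q j) * sphere_part q j ord0 l).
    by apply/funext => q; rewrite hl retrE !partE mxE.
  by rewrite (aux _ (fun q => sphere_part q j)) ?hl //; exact: sphere_coord.
Qed.

Lemma near_nonzero p : nonzero_parts p -> \near p, nonzero_parts p.
Proof.
move=> [f0 s0].
have aux N' (pi : E -> 'rV[R]_N') :
    (forall i, exists l, forall u, pi u ord0 i = u ord0 l) -> pi p != 0 ->
    \near p, pi p != 0.
  move=> hpi p0.
  have c : {for p, continuous (fun q => dot (pi q) (pi q))}.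
    by apply: (dot_part_sq_smooth hpi 0%N).
  have : \near p, 0 < dot (pi p) (pi p).
    by apply: (cvgr_gt _ c); rewrite dot_gt0.
  by apply: filterS => q; rewrite dot_gt0.
have h1 := aux _ _ (@fiber_coord R n k d) f0.
have h2 : \near p, forall j, sphere_part p j != 0.
  apply: (@filter_forall E 'I_k (fun j q => sphere_part q j != 0) (nbhs p) (nbhs_filter p)) => j.
  exact: (aux _ (fun q => sphere_part q j) (@sphere_coord R n k d j) (s0 j)).
by apply: filterS2 h1 h2 => q.
Qed.

Lemma near_L0_nonzero p : L0_part p != 0 -> \near p, L0_part p != 0.
Proof.
move=> p0.
have c : {for p, continuous (fun q : E => dot (L0_part q) (L0_part q))}.
  by apply: (dot_part_sq_smooth (@L0_coord R n k d) 0%N).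
have : \near p, 0 < dot (L0_part p) (L0_part p).
  by apply: (cvgr_gt _ c); rewrite dot_gt0.
by apply: filterS => q; rewrite dot_gt0.
Qed.

Lemma open_retr_preimage (U : set E) : W_open r U -> open (retr r @^-1` U).
Proof.
case=> Q [oQ ->]; rewrite openE => q [/= Qq Wq].
have nq := W_set_retrP Wq.
have c : {for q, continuous (retr r)}.
  exact/differentiable_continuous/retr_differentiable.
have : \near q, Q (retr r q) by apply: c; exact: open_nbhs_nbhs.
move=> h; have h2 := near_nonzero nq; rewrite /interior /=.
by apply: filterS2 h h2 => x Qx nx; split=> //; exact: W_set_retr.
Qed.

Section RetractedMaps.
Variables (T : normedModType R) (g : E -> T).

(** A derivative of [g \o retr r] can be moved from [p] to any dilate of [p]. With constants equal
    to the factors that send [p] to [retr r p], this carries computations from the open set to W. *)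
Lemma derive_scal a b p v : 0 < a -> (forall j, 0 < b j) ->
  'D_v (g \o retr r) p = 'D_(scal a b v) (g \o retr r) (scal a b p).
Proof.
move=> a0 b0; rewrite /derive; congr (lim _).
have -> // : (fun h : R => h^-1 *: (((g \o retr r) \o shift p) (h *: v) - (g \o retr r) p))
  = (fun h : R => h^-1 *: (((g \o retr r) \o shift (scal a b p)) (h *: scal a b v)
      - (g \o retr r) (scal a b p))).
by apply/funext => h /=; rewrite -scal_linear !retr_scal.
Qed.

(** The Euler field of one component, the fiber for [None] and the j-th sphere component for
    [Some j]; [retr] is constant along it. *)
Definition radial (o : option 'I_k) p : E :=
  mkE 0 ((o == None)%:R *: fiber_part p) (fun j => (o == Some j)%:R *: sphere_part p j).

Lemma derive_radial o p : 'D_(radial o p) (g \o retr r) p = 0.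
Proof.
rewrite /derive; apply: lim_near_cst => //; near=> h.
(* For |h| < 1 the displaced point is a dilate of [p] with positive factors 1 or 1 + h. *)
have h1 : `|h| < 1 by near: h; exact: dnbhs0_lt.
have pos (b : bool) : 0 < 1 + h * b%:R :> R.
  case: b; rewrite ?mulr1 ?mulr0 ?addr0 // -ltrBlDl sub0r.
  by move: h1; rewrite ltr_norml => /andP[].
have -> : ((g \o retr r) \o shift p) (h *: radial o p) =
    (g \o retr r) (scal (1 + h * (o == None)%:R) (fun j => 1 + h * (o == Some j)%:R) p).
  rewrite /=; congr (g (retr r _)); apply: partsP => [||j]; rewrite !partE.
  - by rewrite scaler0 add0r.
  - by rewrite scalerDl scale1r addrC scalerA.
  - by rewrite scalerDl scale1r addrC scalerA.
by rewrite /= retr_scal // subrr scaler0.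
Unshelve. all: by end_near. Qed.

End RetractedMaps.

Lemma derive_retr_tangent (T : normedModType R) (g : E -> T) p u : W_set r p -> W_tangent p u ->
  differentiable g p -> 'D_u (g \o retr r) p = 'D_u g p.
Proof.
move=> Wp tu dg; have dr := retr_differentiable (W_nonzero Wp).
have rp := retr_id Wp.
have dg' : differentiable g (retr r p) by rewrite rp.
have dc := differentiable_comp dr dg'.
transitivity ('d (g \o retr r) p u); first exact: deriveE.
transitivity ('d g (retr r p) ('d (retr r) p u)).
  exact: (congr1 (fun h : E -> T => h u) (diff_comp dr dg')).
by rewrite -(deriveE _ dr) -(deriveE _ dg') (retr_derive Wp tu) rp.
Qed.

End Retraction.

(** * The profile function *)

Section Profile.
Variables (R : realType) (n : nat) (phi : R -> R).
Hypotheses (hn : (4 <= n)%N) (hphi : ST_profile n phi).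
Local Notation p1 := (derive1 phi).
Local Notation p2 := (derive1 (derive1 phi)).
Local Notation p3 := (derive1 (derive1 (derive1 phi))).

Lemma profile_is_derive (i : nat) (t : R) :
  is_derive t 1 (derive1n i phi) (derive1n i.+1 phi t).
Proof.
rewrite derive1nS derive1E; split => //; exact: (ST_smooth hphi).
Qed.

Lemma profile_gt0 (t : R) : 0 < t -> 0 < phi t.
Proof.
move=> t0; have m0 : 0 < phi 0.
  by rewrite (ST_at0 hphi) /ST_mass divr_gt0 // ltr0n subn_gt0.
apply: lt_trans m0 _.
apply: (@gtr0_derive1_lt_cc R phi 0 t).
- by move=> x _; have [] := profile_is_derive 0 x.
- by move=> x; rewrite in_itv /= => /andP[x0 _]; exact: (ST_increasing hphi).
- apply: derivable_within_continuous => x _.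
  by have [] := profile_is_derive 0 x.
- by rewrite in_itv /= lexx ltW.
- by rewrite in_itv /= lexx ltW.
- exact: t0.
Qed.

Lemma profile_d1_lt1 (t : R) : 0 < t -> 0 < 1 - p1 t ^+ 2.
Proof.
move=> t0; rewrite (ST_ode hphi (ltW t0)) opprB addrC subrK exprn_gt0 //.
by rewrite divr_gt0 ?profile_gt0 // /ST_mass divr_gt0 // ltr0n subn_gt0.
Qed.

(** The first-order equation is differentiated and divided by phi', which is positive for t > 0. The
    same equation then eliminates the mass. *)
Lemma profile_d2 (t : R) : 0 < t ->
  p2 t = (n - 3)%:R * (1 - p1 t ^+ 2) / (2 * phi t).
Proof.
move=> t0; have f0 := profile_gt0 t0; have d0 := ST_increasing hphi t0.
have o0 : open [set s : R | 0 < s] by exact: open_gt.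
have D1 := profile_is_derive 0 t; have D2 := profile_is_derive 1 t.
have e2 : 2 * p1 t * p2 t = (n - 3)%:R * (ST_mass R n / phi t) ^+ (n - 3) * p1 t / phi t.
  have [_ L] := is_derive_fctM D2 D2.
  have H : 'D_1 (fun s => derive1n 1 phi s * derive1n 1 phi s) t =
      'D_1 (fun s => 1 + - ((fun x => ST_mass R n * (derive1n 0 phi x)^-1) ^+ (n - 3)) s) t.
    apply: near_eq_derive; apply: (eq_on_near o0 _ t0) => s /= s0.
    by rewrite -expr2 exprfctE [LHS](ST_ode hphi (ltW s0)).
  have f0' : derive1n 0 phi t != 0 by rewrite /= gt_eqF.
  have DV := is_derive_fctM (is_derive_fct_cst (ST_mass R n) t 1) (is_derive_fctV f0' D1).
  have DX := is_deriveX (n - 3) DV.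
  have [_ E] := is_derive_fctD (is_derive_fct_cst 1 t 1) (is_derive_fctN DX).
  have := etrans (esym L) (etrans H E).
  rewrite /= /GRing.scale /= mul0r !add0r.
  have -> : (n - 3 = (n - 3).-1.+1)%N by rewrite prednK // subn_gt0.
  rewrite exprS /= => HH.
  transitivity (p2 t * p1 t + p1 t * p2 t); first by ring.
  rewrite HH [in RHS]exprS; move: (_ ^+ (n - 3).-1) => X; field.
  by rewrite gt_eqF.
have p0 : p1 t != 0 by rewrite gt_eqF.
apply: (mulfI p0); rewrite (ST_ode hphi (ltW t0)).
have two : (2 : R) != 0 by rewrite pnatr_eq0.
apply: (mulfI two); rewrite mulrA e2 opprB addrC subrK.
by field; rewrite gt_eqF.
Qed.

(** Derivative of [profile_d2]: the factor n - 2 collects n - 3 from the numerator 1 - phi'^2 and 1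
    from the denominator phi. *)
Lemma profile_d3 (t : R) : 0 < t -> p3 t = - (n - 2)%:R * p1 t * p2 t / phi t.
Proof.
move=> t0; have f0 := profile_gt0 t0.
have o0 : open [set s : R | 0 < s] by exact: open_gt.
have D1 := profile_is_derive 0 t; have D2 := profile_is_derive 1 t.
have f0' : derive1n 0 phi t != 0 by rewrite /= gt_eqF.
have DN := is_derive_fctD (is_derive_fct_cst 1 t 1) (is_derive_fctN (is_derive_fctM D2 D2)).
have DM := is_derive_fctM (is_derive_fctM (is_derive_fct_cst ((n - 3)%:R / 2) t 1) DN)
   (is_derive_fctV f0' D1).
have -> : p3 t = 'D_1 (fun s => (n - 3)%:R / 2 * (1 + - (derive1n 1 phi s * derive1n 1 phi s))
   * (derive1n 0 phi s)^-1) t.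
  rewrite [LHS]derive1E; apply: near_eq_derive; apply: (eq_on_near o0 _ t0) => s s0.
  rewrite [LHS](profile_d2 s0) /=; field.
  by rewrite gt_eqF // profile_gt0.
have [_ ->] := DM.
rewrite /= (profile_d2 t0).
have -> : (n - 2)%:R = (n - 3)%:R + 1 :> R.
  by rewrite -[X in _ + X]/(1%:R) -natrD addn1 -subSn // (leq_trans _ hn).
by field; rewrite gt_eqF.
Qed.

End Profile.

(* The pullback of the unit round metric by y |-> y / |y|. *)
Definition round_metric (R : realType) (N : nat) (y c c' : 'rV[R]_N) : R :=
  dot c c' / dot y y - dot y c * dot y c' / dot y y ^+ 2.

Lemma dot_tangential (R : realType) (N : nat) (y c c' : 'rV[R]_N) :
  y != 0 ->
  dot (c - (dot y c / dot y y) *: y) (c' - (dot y c' / dot y y) *: y) =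
  dot y y * round_metric y c c'.
Proof.
rewrite -dot_eq0 => y0; rewrite /round_metric !dotBl !dotBr !dotZl !dotZr.
by rewrite (dotC c y); field; rewrite ?y0.
Qed.

Lemma round_metricZ (R : realType) (N : nat) (a : R) (y c c' : 'rV[R]_N) :
  a != 0 -> y != 0 ->
  round_metric (a *: y) (a *: c) (a *: c') = round_metric y c c'.
Proof.
rewrite -(dot_eq0 y) => a0 y0; rewrite /round_metric !dotZl !dotZr.
by field; rewrite ?a0 ?y0.
Qed.

(** * The Euclidean metric pulled back to an open subset of the ambient space *)

Section Immersion.
Variables (R : realType) (n k : nat) (d : 'I_k -> nat) (r : 'I_k -> R).
Variable (phi : R -> R).
Hypothesis hr : forall j, 0 < r j.
Notation E := 'rV[R]_(2 + n.-1 + \sum_(j < k) (d j).+1).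
Variables (N : nat) (U : set E) (Phi : E -> 'rV[R]_N).
Hypothesis hI : local_isometric_immersion r phi U Phi.
Implicit Types (p q u v w : E).

Local Notation F := (Phi \o retr r).
Local Notation Om := (retr r @^-1` U).

Lemma dom_open : open Om.
Proof. by case: hI => oU _ _ _; exact: open_retr_preimage. Qed.

Lemma dom_nonzero q : Om q -> nonzero_parts q.
Proof. by case: hI => -[Q [_ ->]] _ _ _ [_ /= /(W_set_retrP hr)]. Qed.

Lemma dom_W p : U p -> W_set r p.
Proof. by case: hI => -[Q [_ ->]] _ _ _ []. Qed.

Lemma dom_retr p : U p -> Om p.
Proof. by move=> Up; rewrite /= retr_id //; exact: dom_W. Qed.

Lemma F_smooth : smooth_on Om F.
Proof. by case: hI. Qed.

Lemma F_comp_smooth a : smooth Om (vcomp F a).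
Proof. exact: (smooth_on_vcomp dom_open a F_smooth). Qed.

Lemma F_differentiable q : Om q -> differentiable F q.
Proof. exact: smooth_on_differentiable F_smooth. Qed.

(** At a point of W this is the differential of [retr]. Dividing by the squared norms gives a
    formula that makes sense wherever the components are nonzero, hence on an open set. *)
Definition tangential w u : E := mkE (L0_part u)
  (fiber_part u - (dot (fiber_part w) (fiber_part u) / dot (fiber_part w) (fiber_part w)) *:
    fiber_part w)
  (fun j => sphere_part u j - (dot (sphere_part w j) (sphere_part u j)
      / dot (sphere_part w j) (sphere_part w j)) *: sphere_part w j).

Lemma tangential_tangent w u : nonzero_parts w -> W_tangent w (tangential w u).
Proof.
move=> [f0 s0]; split=> [|j]; rewrite !partE dotBr dotZr divfK ?subrr //.
  by rewrite dot_eq0.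
by rewrite dot_eq0.
Qed.

Lemma tangential_id w u : W_tangent w u -> tangential w u = u.
Proof.
move=> [tf ts]; apply: partsP => [||j]; rewrite !partE // ?tf ?ts mul0r scale0r.
  by rewrite subr0.
by rewrite subr0.
Qed.

Definition radial_component q u : E :=
  (dot (fiber_part q) (fiber_part u) / dot (fiber_part q) (fiber_part q)) *: radial None q
  + \sum_j (dot (sphere_part q j) (sphere_part u j)
      / dot (sphere_part q j) (sphere_part q j)) *: radial (Some j) q.

Lemma tangentialE q u : tangential q u = u - radial_component q u.
Proof.
set e := radial_component q u.
have L0s : L0_part e = 0.
  rewrite /e /radial_component partE !partE scaler0 add0r.
  elim/big_rec: _ => [|j x _ IH]; first by apply/rowP => i; rewrite !mxE.
  by rewrite !partE IH scaler0 addr0.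
have fs : fiber_part e = (dot (fiber_part q) (fiber_part u)
    / dot (fiber_part q) (fiber_part q)) *: fiber_part q.
  rewrite /e /radial_component !partE eqxx scale1r -[RHS]addr0; congr (_ + _).
  elim/big_rec: _ => [|j x _ IH]; first by apply/rowP => i; rewrite !mxE.
  by rewrite !partE IH scale0r scaler0 addr0.
have ss j : sphere_part e j = (dot (sphere_part q j) (sphere_part u j)
    / dot (sphere_part q j) (sphere_part q j)) *: sphere_part q j.
  rewrite /e /radial_component !partE scale0r scaler0 add0r (bigD1 j) //= !partE eqxx scale1r.
  rewrite -[RHS]addr0; congr (_ + _).
  elim/big_rec: _ => [|j' x jj' IH]; first by apply/rowP => i; rewrite !mxE.
  rewrite !partE IH addr0; have -> : (Some j' == Some j) = false.
    by apply: contraNF jj' => /eqP[->].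
  by rewrite scale0r scaler0.
clearbody e; apply: partsP => [||j]; rewrite !partE.
- by rewrite L0s subr0.
- by rewrite fs.
- by rewrite ss.
Qed.

Lemma derive_tangential q u : Om q -> 'D_u F q = 'D_(tangential q u) F q.
Proof.
move=> Oq; have dF := F_differentiable Oq.
rewrite tangentialE /radial_component.
rewrite !(deriveE _ dF) linearB /= -[LHS]subr0; congr (_ - _).
have rad o : 'd F q (radial o q) = 0 by rewrite -deriveE // derive_radial.
rewrite linearD linearZ /= rad scaler0 add0r linear_sum big1 // => j _.
by rewrite linearZ /= rad scaler0.
Qed.

(** The isometry condition speaks of points of W only. Derivatives at [q] are therefore carried to
    [retr r q] by [derive_scal] and made tangent there; the dilation factors then combine into
    [round_metric]. *)
Lemma metric_pullback q u v : Om q -> dot ('D_u F q) ('D_v F q) =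
  L0_metric phi (L0_part q) (L0_part u) (L0_part v)
  + phi (enorm (L0_part q)) ^+ 2 * round_metric (fiber_part q) (fiber_part u) (fiber_part v)
  + \sum_j r j ^+ 2 * round_metric (sphere_part q j) (sphere_part u j) (sphere_part v j).
Proof.
move=> Oq; have nq := dom_nonzero Oq; have [f0 s0] := nq.
set a := (enorm (fiber_part q))^-1; pose b j := r j / enorm (sphere_part q j).
have a0 : 0 < a by rewrite invr_gt0 enorm_gt0.
have b0 j : 0 < b j by rewrite divr_gt0 // enorm_gt0.
(* From here on the factors are opaque positive constants, of which only the fact that they bring
   [q] into [U] is kept. *)
have Uw : U (scal a b q) by have : U (retr r q) by []; rewrite retrE.
clearbody a b; have Ow : Om (scal a b q) by exact: dom_retr.
have Ww := dom_W Uw; have nw := W_nonzero hr Ww; have [f1 sr] := Ww.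
have [fw sw] := nw.
have Dq x : 'D_x F q = 'D_(tangential (scal a b q) (scal a b x)) F (scal a b q).
  rewrite -(derive_tangential (scal a b x) Ow).
  have := derive_scal r Phi q x a0 b0.
  exact.
have [_ _ _ iso] := hI.
have E1 := iso _ _ _ Uw (tangential_tangent (scal a b u) nw) (tangential_tangent (scal a b v) nw).
apply: (etrans (congr2 (@dot R N) (Dq u) (Dq v))).
apply: (etrans E1).
have t1 x : L0_part (tangential (scal a b q) (scal a b x)) = L0_part x.
  by rewrite (L0_mkE (L0_part (scal a b x))) (L0_mkE (L0_part x)).
have sL : L0_part (scal a b q) = L0_part q by rewrite (L0_mkE (L0_part q)).
have sF x : fiber_part (scal a b x) = a *: fiber_part x.
  by rewrite (fiber_mkE (L0_part x)).
have sS x j : sphere_part (scal a b x) j = b j *: sphere_part x j.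
  by rewrite (sphere_mkE (L0_part x)).
have tF x : fiber_part (tangential (scal a b q) x) = fiber_part x -
    (dot (fiber_part (scal a b q)) (fiber_part x) /
     dot (fiber_part (scal a b q)) (fiber_part (scal a b q))) *: fiber_part (scal a b q).
  exact: (fiber_mkE (L0_part x)).
have tS x j : sphere_part (tangential (scal a b q) x) j = sphere_part x j -
    (dot (sphere_part (scal a b q) j) (sphere_part x j) /
     dot (sphere_part (scal a b q) j) (sphere_part (scal a b q) j)) *: sphere_part (scal a b q) j.
  exact: (sphere_mkE (L0_part x)).
have a1 : a ^+ 2 * dot (fiber_part q) (fiber_part q) = 1.
  by move: (sqr_enorm (fiber_part (scal a b q))); rewrite f1 expr1n sF dotZl dotZr mulrA -expr2.
have b1 j : b j ^+ 2 * dot (sphere_part q j) (sphere_part q j) = r j ^+ 2.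
  by move: (sqr_enorm (sphere_part (scal a b q) j)); rewrite sr sS dotZl dotZr mulrA -expr2.
have t2 : dot (fiber_part (tangential (scal a b q) (scal a b u)))
    (fiber_part (tangential (scal a b q) (scal a b v))) =
    round_metric (fiber_part q) (fiber_part u) (fiber_part v).
  rewrite (tF (scal a b u)) (tF (scal a b v)) (dot_tangential _ _ fw) !sF.
  by rewrite (round_metricZ _ _ (lt0r_neq0 a0) f0) dotZl dotZr mulrA -expr2 a1 mul1r.
have t3 j : dot (sphere_part (tangential (scal a b q) (scal a b u)) j)
    (sphere_part (tangential (scal a b q) (scal a b v)) j) =
    r j ^+ 2 * round_metric (sphere_part q j) (sphere_part u j) (sphere_part v j).
  rewrite (tS (scal a b u)) (tS (scal a b v)) (dot_tangential _ _ (sw j)) !sS.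
  by rewrite (round_metricZ _ _ (lt0r_neq0 (b0 j)) (s0 j)) dotZl dotZr mulrA -expr2 b1.
rewrite /W_metric (t1 u) (t1 v) sL t2; congr (_ + _).
by apply: eq_bigr => j _; exact: t3.
Qed.

End Immersion.

Lemma dot2E (R : realType) (u v : 'rV[R]_2) :
  dot u v = u ord0 0 * v ord0 0 + u ord0 1 * v ord0 1.
Proof.
rewrite /dot 2!big_ord_recl big_ord0 addr0; congr (_ * _ + _ * _); congr (_ _ _);
  exact: val_inj.
Qed.

Lemma is_derive_eq_val (R : realType) (V : normedModType R) (f : V -> R) (x v : V)
  (a b : R) : is_derive x v f a -> a = b -> is_derive x v f b.
Proof. by move=> h <-. Qed.

Section RoundMetricDerivatives.
Variables (R : realType) (M N : nat) (pi : 'rV[R]_M -> 'rV[R]_N).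
Hypothesis hpi : forall i, exists l, forall u, pi u ord0 i = u ord0 l.
Implicit Types (p v w c : 'rV[R]_M) (y : 'rV[R]_N).

(** The derivative of [round_metric] in [y] along [w]. Every term contains a product of [y] with
    another vector, so it vanishes when these are orthogonal to [y]. *)
Definition round_metric_d (y w c c' : 'rV[R]_N) : R :=
  - 2 * dot y w * dot c c' / dot y y ^+ 2
  - (dot w c * dot y c' + dot y c * dot w c') / dot y y ^+ 2
  + 4 * dot y w * dot y c * dot y c' / dot y y ^+ 3.

(** The derivative of [round_metric_d] along [v], simplified under the assumption that all four
    vectors are orthogonal to [y]. *)
Definition round_metric_d2 (y v w c c' : 'rV[R]_N) : R :=
  (- 2 * dot v w * dot c c' - (dot w c * dot v c' + dot v c * dot w c'))
  / dot y y ^+ 2.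

Lemma is_derive_round_metric p v c c' : pi p != 0 ->
  is_derive p v (fun q => round_metric (pi q) (pi c) (pi c'))
    (round_metric_d (pi p) (pi v) (pi c) (pi c')).
Proof.
rewrite -dot_eq0 => y0.
have hN := is_derive_dot_part_sq hpi p v.
have hV := @is_derive_fctV _ _ (fun q => dot (pi q) (pi q)) p v _ y0 hN.
have hc := is_derive_dot_part hpi p v c.
have hc' := is_derive_dot_part hpi p v c'.
have T1 := is_derive_fctM (is_derive_fct_cst (dot (pi c) (pi c')) p v) hV.
have T2 := is_derive_fctM (is_derive_fctM hc hc') (is_derive_fctM hV hV).
have T := is_derive_fctD T1 (is_derive_fctN T2).
have -> : (fun q => round_metric (pi q) (pi c) (pi c')) = (fun q =>
  dot (pi c) (pi c') * (dot (pi q) (pi q))^-1 +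
  - (dot (pi q) (pi c) * dot (pi q) (pi c') *
    ((dot (pi q) (pi q))^-1 * (dot (pi q) (pi q))^-1))).
  by apply/funext => q; rewrite /round_metric expr2 invfM.
apply: is_derive_eq_val T _; rewrite /round_metric_d; move: y0.
move: (dot (pi p) (pi p)) (dot (pi p) (pi v)) (dot (pi c) (pi c')) (dot (pi v) (pi c))
 (dot (pi p) (pi c')) (dot (pi p) (pi c)) (dot (pi v) (pi c')) => a b e f g h i a0.
by field.
Qed.

Lemma is_derive_round_metric_d p v w c c' : pi p != 0 ->
  dot (pi p) (pi v) = 0 -> dot (pi p) (pi w) = 0 -> dot (pi p) (pi c) = 0 ->
  dot (pi p) (pi c') = 0 ->
  is_derive p v (fun q => round_metric_d (pi q) (pi w) (pi c) (pi c'))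
    (round_metric_d2 (pi p) (pi v) (pi w) (pi c) (pi c')).
Proof.
rewrite -dot_eq0 => y0 v0 w0 c0 c0'.
have hN := is_derive_dot_part_sq hpi p v.
have hV := @is_derive_fctV _ _ (fun q => dot (pi q) (pi q)) p v _ y0 hN.
have hc := is_derive_dot_part hpi p v c.
have hc' := is_derive_dot_part hpi p v c'.
have hw := is_derive_dot_part hpi p v w.
have K x := is_derive_fct_cst x p v.
have V2 := is_derive_fctM hV hV.
have T1 := is_derive_fctM (is_derive_fctM (K (- 2 * dot (pi c) (pi c'))) hw) V2.
have T2 := is_derive_fctM (is_derive_fctD (is_derive_fctM (K (dot (pi w) (pi c))) hc')
  (is_derive_fctM hc (K (dot (pi w) (pi c'))))) V2.
have T3 := is_derive_fctM (is_derive_fctM (is_derive_fctM (is_derive_fctM (K 4) hw) hc) hc')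
  (is_derive_fctM V2 hV).
have T := is_derive_fctD (is_derive_fctD T1 (is_derive_fctN T2)) T3.
move: T; set g := (X in is_derive _ _ X _) => T.
have -> : (fun q => round_metric_d (pi q) (pi w) (pi c) (pi c')) = g.
  apply/funext => q; rewrite /g /round_metric_d -!exprVn.
  by move: (dot (pi q) (pi q))^-1 => b; ring.
apply: is_derive_eq_val T _.
rewrite /round_metric_d2 v0 w0 c0 c0'; move: y0.
move: (dot (pi p) (pi p)) (dot (pi c) (pi c')) (dot (pi v) (pi c))
 (dot (pi v) (pi c')) (dot (pi v) (pi w)) (dot (pi w) (pi c)) (dot (pi w) (pi c')) => a e f g' h
   i j a0.
by field.
Qed.

End RoundMetricDerivatives.

(** * Commuting fields and the curvature of W *)

Definition quarter_turn (R : realType) (x : 'rV[R]_2) : 'rV[R]_2 :=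
  \row_i (if i == 0 then - x ord0 1 else x ord0 0).

Section Fields.
Variables (R : realType) (n k : nat) (d : 'I_k -> nat) (r : 'I_k -> R).
Variable (phi : R -> R).
Hypothesis hphi : ST_profile n phi.
Notation E := 'rV[R]_(2 + n.-1 + \sum_(j < k) (d j).+1).
Implicit Types (p q u v w : E).
Local Notation p1 := (derive1 phi).
Local Notation p2 := (derive1 (derive1 phi)).

(* (a, b, c) stands for the vector field a x d/dx + b (rotation) on L_0 plus
   the constant field c on the other factors; any two of them commute. *)
Definition coef := (R * R * E)%type.
Implicit Types X Y Z V : coef.

Definition fld X (q : E) : E :=
  mkE (X.1.1 *: L0_part q + X.1.2 *: quarter_turn (L0_part q)) (fiber_part X.2) (sphere_part X.2).

Lemma dot_quarter_turn (x : 'rV[R]_2) : dot x (quarter_turn x) = 0.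
Proof. by rewrite dot2E !mxE /=; ring. Qed.

Lemma L0_fld X q : L0_part (fld X q) = X.1.1 *: L0_part q + X.1.2 *: quarter_turn (L0_part q).
Proof. by rewrite L0_mkE. Qed.
Lemma fiber_fld X q : fiber_part (fld X q) = fiber_part X.2.
Proof. by rewrite fiber_mkE. Qed.
Lemma sphere_fld X q j : sphere_part (fld X q) j = sphere_part X.2 j.
Proof. by rewrite sphere_mkE. Qed.

(** In polar coordinates dilation is t d/dt and rotation is d/dtheta; they are orthogonal, with
    squared lengths t^2 and phi'(t)^2. *)
Lemma L0_metric_fld X Y q : L0_part q != 0 ->
  L0_metric phi (L0_part q) (L0_part (fld X q)) (L0_part (fld Y q)) =
  X.1.1 * Y.1.1 * enorm (L0_part q) ^+ 2 +
  X.1.2 * Y.1.2 * p1 (enorm (L0_part q)) ^+ 2.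
Proof.
move=> x0; rewrite /L0_metric (negbTE x0) !L0_fld; set x := L0_part q in x0 *.
have t0 : enorm x != 0 by rewrite gt_eqF // enorm_gt0.
have D Z : dot x (Z.1.1 *: x + Z.1.2 *: quarter_turn x) = Z.1.1 * enorm x ^+ 2.
  by rewrite dotDr !dotZr dot_quarter_turn mulr0 addr0 sqr_enorm.
have T Z : x ord0 0 * (Z.1.1 *: x + Z.1.2 *: quarter_turn x) ord0 1
   - x ord0 1 * (Z.1.1 *: x + Z.1.2 *: quarter_turn x) ord0 0 = Z.1.2 * enorm x ^+ 2.
  by rewrite sqr_enorm dot2E !mxE /=; ring.
rewrite !D !T; move: (p1 _) => P; field.
by rewrite t0.
Qed.

Lemma fld_vcomp_smooth (O : set E) X : open O -> smooth_field O (fld X).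
Proof.
move=> oO i; case: (coord_cases R i) => [[l hl]|[l hl]|[j [l hl]]].
- have L m : smooth O (fun q : E => L0_part q ord0 m).
    have [l' hl'] := @L0_coord R n k d m.
    apply: (smooth_ext oO (f := fun q : E => q ord0 l')); first by move=> q _; rewrite hl'.
    exact: smooth_coord.
  apply: (smooth_ext oO (f := fun q : E => X.1.1 * L0_part q ord0 l
     + X.1.2 * (if l == 0 then - L0_part q ord0 1 else L0_part q ord0 0))).
    by move=> q _; rewrite /vcomp hl L0_fld !mxE.
  have cc c : smooth O (fun=> c) by exact: smooth_cst.
  apply: (smoothD oO); apply: (smoothM oO) => //.
  by case: (l == 0); [apply: (smoothN oO)|]; exact: L.
- apply: (smooth_ext oO (f := fun=> fiber_part X.2 ord0 l)).
    by move=> q _; rewrite /vcomp hl fiber_fld.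
  exact: smooth_cst.
- apply: (smooth_ext oO (f := fun=> sphere_part X.2 j ord0 l)).
    by move=> q _; rewrite /vcomp hl sphere_fld.
  exact: smooth_cst.
Qed.

(** On L_0 the fields are linear, with matrices spanned by the identity and the quarter turn; on the
    other components they are constant. *)
Lemma fld_commute (O : set E) X Y : open O -> Lie_commute O (fld X) (fld Y).
Proof.
move=> oO f q sf Oq; apply: (Lie_comm oO) => //; try exact: fld_vcomp_smooth.
move=> i x _; rewrite !LieE; case: (coord_cases R i) => [[l hl]|[l hl]|[j [l hl]]].
- have D Z Z' : 'D_(fld Z x) (vcomp (fld Z') i) x =
     Z'.1.1 * L0_part (fld Z x) ord0 l
     + Z'.1.2 * (if l == 0 then - L0_part (fld Z x) ord0 1 else L0_part (fld Z x) ord0 0).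
    have -> : vcomp (fld Z') i = (fun q : E => Z'.1.1 * L0_part q ord0 l
     + Z'.1.2 * (if l == 0 then - L0_part q ord0 1 else L0_part q ord0 0)).
      by apply/funext => y; rewrite /vcomp hl L0_fld !mxE.
    have C m := part_coord_derive (@L0_coord R n k d) x (fld Z x) m.
    have K c := is_derive_fct_cst c x (fld Z x).
    case: (l == 0).
      have [_ ->] := is_derive_fctD (is_derive_fctM (K Z'.1.1) (C l))
        (is_derive_fctM (K Z'.1.2) (is_derive_fctN (C 1))).
      by ring.
    have [_ ->] := is_derive_fctD (is_derive_fctM (K Z'.1.1) (C l))
        (is_derive_fctM (K Z'.1.2) (C 0)).
    by ring.
  rewrite !D !L0_fld !mxE /=; case: (boolP (l == 0)) => [/eqP ->|_]; ring.
- have D Z Z' : 'D_(fld Z x) (vcomp (fld Z') i) x = 0.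
    have -> : vcomp (fld Z') i = cst (fiber_part Z'.2 ord0 l).
      by apply/funext => y; rewrite /vcomp hl fiber_fld.
    exact: derive_cst.
  by rewrite !D.
- have D Z Z' : 'D_(fld Z x) (vcomp (fld Z') i) x = 0.
    have -> : vcomp (fld Z') i = cst (sphere_part Z'.2 j ord0 l).
      by apply/funext => y; rewrite /vcomp hl sphere_fld.
    exact: derive_cst.
  by rewrite !D.
Qed.

Lemma is_derive_radius X q (h : R -> R) dh : L0_part q != 0 ->
  is_derive (enorm (L0_part q)) 1 h dh ->
  is_derive q (fld X q) (fun q => h (enorm (L0_part q)))
    (X.1.1 * (enorm (L0_part q) * dh)).
Proof.
move=> x0 [hd hv].
have dg := enorm_part_differentiable (@L0_coord R n k d) x0.
have [_ De] := is_derive_enorm_part (@L0_coord R n k d) (fld X q) x0.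
apply: is_derive_eq_val (is_derive_chain dg De hd) _.
rewrite derive1E hv L0_fld dotDr !dotZr dot_quarter_turn mulr0 addr0 -sqr_enorm.
have t0 : enorm (L0_part q) != 0 by rewrite gt_eqF // enorm_gt0.
by field.
Qed.

(** The Gram matrix of the fields under F, wherever x is nonzero ([gram_G0]). [G1] and [G2] are its
    first and second derivatives, the latter at the base point only. *)
Definition G0 Y Z q : R :=
  Y.1.1 * Z.1.1 * enorm (L0_part q) ^+ 2 +
  Y.1.2 * Z.1.2 * p1 (enorm (L0_part q)) ^+ 2 +
  phi (enorm (L0_part q)) ^+ 2 *
    round_metric (fiber_part q) (fiber_part Y.2) (fiber_part Z.2) +
  \sum_j r j ^+ 2 *
    round_metric (sphere_part q j) (sphere_part Y.2 j) (sphere_part Z.2 j).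

Definition G1 X Y Z q : R := let t := enorm (L0_part q) in
  X.1.1 * (Y.1.1 * Z.1.1 * (2 * t * t) + Y.1.2 * Z.1.2 * (2 * t * p1 t * p2 t)
    + 2 * t * phi t * p1 t *
      round_metric (fiber_part q) (fiber_part Y.2) (fiber_part Z.2))
  + phi t ^+ 2 *
    round_metric_d (fiber_part q) (fiber_part X.2) (fiber_part Y.2) (fiber_part Z.2)
  + \sum_j r j ^+ 2 * round_metric_d (sphere_part q j)
      (sphere_part X.2 j) (sphere_part Y.2 j) (sphere_part Z.2 j).

Lemma is_derive_G0 X Y Z q : L0_part q != 0 -> nonzero_parts q ->
  is_derive q (fld X q) (G0 Y Z) (G1 X Y Z q).
Proof.
move=> x0 [f0 s0]; pose t := enorm (L0_part q).
have K c := is_derive_fct_cst c q (fld X q).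
have D0 := profile_is_derive hphi 0 t; have D1 := profile_is_derive hphi 1 t.
have Did : is_derive t 1 (fun s : R => s) 1 by exact: is_derive_id.
have A1 := is_derive_radius X x0 (is_derive_fctM Did Did).
have A2 := is_derive_radius X x0 (is_derive_fctM D1 D1).
have A3 := is_derive_radius X x0 (is_derive_fctM D0 D0).
have B1 := is_derive_round_metric (@fiber_coord R n k d) (fld X q) Y.2 Z.2 f0.
have B2 j := @is_derive_round_metric _ _ _ (fun q => sphere_part q j)
  (@sphere_coord R n k d j) q (fld X q) Y.2 Z.2 (s0 j).
have T := is_derive_fctD (is_derive_fctD (is_derive_fctD
   (is_derive_fctM (K (Y.1.1 * Z.1.1)) A1) (is_derive_fctM (K (Y.1.2 * Z.1.2)) A2))
   (is_derive_fctM A3 B1))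
   (is_derive_fct_sum (index_enum 'I_k) (fun j => is_derive_fctM (K (r j ^+ 2)) (B2 j))).
move: T; set g := (X in is_derive _ _ X _); set e := (X in is_derive _ _ _ X) => T.
have -> : G0 Y Z = g by apply/funext => y; rewrite /g /G0 !expr2.
apply: is_derive_eq_val T _; rewrite /e /G1 /= !fiber_fld -/t.
congr (_ + _); first by ring.
by apply: eq_bigr => j _; rewrite sphere_fld; ring.
Qed.

End Fields.

Lemma smooth_sub (R : realType) (V : normedModType R) (O O' : set V) (f : V -> R) :
  (forall x, O' x -> O x) -> smooth O f -> smooth O' f.
Proof.
move=> sub sf s; have {sf} := sf s.
elim: s f => [|s IH] f /=; first by move=> cf x /sub; exact: cf.
by case=> df Df; split=> [x /sub|v]; [exact: df|exact: IH].
Qed.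

Section Curvature.
Variables (R : realType) (n k : nat) (d : 'I_k -> nat) (r : 'I_k -> R).
Variable (phi : R -> R).
Hypothesis hn : (4 <= n)%N.
Hypothesis hr : forall j, 0 < r j.
Hypothesis hphi : ST_profile n phi.
Notation E := 'rV[R]_(2 + n.-1 + \sum_(j < k) (d j).+1).
Variable p : E.
Hypothesis Wp : W_set r p.
Hypothesis xp : L0_part p != 0.
Local Notation t := (enorm (L0_part p)).
Local Notation p0 := (phi t).
Local Notation p1 := (derive1 phi t).
Local Notation p2 := (derive1 (derive1 phi) t).
Local Notation p3 := (derive1 (derive1 (derive1 phi)) t).
Local Notation coef := (@coef R n k d).
Local Notation fld := (@fld R n k d).
Implicit Types X Y Z V : coef.

(** Tangency is imposed at [p] only. At other points the constant components acquire radial parts,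
    which the degenerate form [round_metric] ignores. *)
Definition tcoef X := dot (fiber_part p) (fiber_part X.2) = 0 /\
  forall j, dot (sphere_part p j) (sphere_part X.2 j) = 0.

Definition fdot X Y := dot (fiber_part X.2) (fiber_part Y.2).
Definition sdot X Y j := dot (sphere_part X.2 j) (sphere_part Y.2 j).

Lemma fdotC X Y : fdot X Y = fdot Y X. Proof. exact: dotC. Qed.
Lemma sdotC X Y j : sdot X Y j = sdot Y X j. Proof. exact: dotC. Qed.

Lemma radius_gt0 : 0 < t. Proof. by rewrite enorm_gt0. Qed.

Lemma fiber_unit : dot (fiber_part p) (fiber_part p) = 1.
Proof. by have [f1 _] := Wp; rewrite -sqr_enorm f1 expr1n. Qed.

Lemma sphere_radius j : dot (sphere_part p j) (sphere_part p j) = r j ^+ 2.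
Proof. by have [_ sr] := Wp; rewrite -sqr_enorm sr. Qed.

Lemma G0_tangent Y Z : tcoef Y -> tcoef Z -> G0 r phi Y Z p =
  Y.1.1 * Z.1.1 * t ^+ 2 + Y.1.2 * Z.1.2 * p1 ^+ 2 + p0 ^+ 2 * fdot Y Z
  + \sum_j sdot Y Z j.
Proof.
move=> [fY sY] [fZ sZ]; rewrite /G0 /round_metric fiber_unit fY !mul0r subr0 divr1.
congr (_ + _); apply: eq_bigr => j _; rewrite sY !mul0r subr0 sphere_radius.
by rewrite mulrCA divff ?mulr1 // expf_neq0 // gt_eqF.
Qed.

(** On the affine tangent plane y |-> y / |y| is the central projection, whose metric is stationary
    at the point of contact. Only the dependence on t survives. *)
Lemma G1_tangent X Y Z : tcoef X -> tcoef Y -> tcoef Z -> G1 r phi X Y Z p =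
  X.1.1 * (Y.1.1 * Z.1.1 * (2 * t * t) + Y.1.2 * Z.1.2 * (2 * t * p1 * p2)
  + 2 * t * p0 * p1 * fdot Y Z).
Proof.
move=> [fX sX] [fY sY] [fZ sZ]; rewrite /G1 /round_metric /round_metric_d fiber_unit.
have -> : \sum_j r j ^+ 2 * round_metric_d (sphere_part p j)
    (sphere_part X.2 j) (sphere_part Y.2 j) (sphere_part Z.2 j) = 0.
  apply: big1 => j _; rewrite /round_metric_d sX sY sZ.
  by rewrite !(mulr0, mul0r, addr0, subr0).
rewrite fX fY fZ /fdot !expr1n !divr1.
by ring.
Qed.

Definition G2_spheres V X Y Z : R :=
  \sum_j (- 2 * sdot V X j * sdot Y Z j
     - (sdot X Y j * sdot V Z j + sdot V Y j * sdot X Z j)) / r j ^+ 2.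

Definition G2 V X Y Z : R :=
  V.1.1 * X.1.1 * (Y.1.1 * Z.1.1 * (4 * t * t)
    + Y.1.2 * Z.1.2 * (t * (2 * p1 * p2 + 2 * t * (p2 * p2 + p1 * p3)))
    + t * (2 * p0 * p1 + 2 * t * (p1 * p1 + p0 * p2)) * fdot Y Z)
  + p0 ^+ 2 * (- 2 * fdot V X * fdot Y Z - (fdot X Y * fdot V Z + fdot V Y * fdot X Z))
  + G2_spheres V X Y Z.

Lemma is_derive_G1 V X Y Z : tcoef V -> tcoef X -> tcoef Y -> tcoef Z ->
  is_derive p (fld V p) (G1 r phi X Y Z) (G2 V X Y Z).
Proof.
move=> [fV sV] [fX sX] [fY sY] [fZ sZ]; have [f0 s0] := W_nonzero hr Wp.
have K c := is_derive_fct_cst c p (fld V p).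
have Kt c := is_derive_fct_cst c t 1.
have D0 := profile_is_derive hphi 0 t; have D1 := profile_is_derive hphi 1 t.
have D2 := profile_is_derive hphi 2 t.
have Did : is_derive t 1 (fun s : R => s) 1 by exact: is_derive_id.
have D2s := is_derive_fctM (Kt 2) Did.
have A1 := is_derive_radius V xp (is_derive_fctM D2s Did).
have A2 := is_derive_radius V xp (is_derive_fctM (is_derive_fctM D2s D1) D2).
have A3 := is_derive_radius V xp (is_derive_fctM (is_derive_fctM D2s D0) D1).
have A4 := is_derive_radius V xp (is_derive_fctM D0 D0).
have fV' : dot (fiber_part p) (fiber_part (fld V p)) = 0 by rewrite fiber_fld.
have sV' j : dot (sphere_part p j) (sphere_part (fld V p) j) = 0 by rewrite sphere_fld.
have B1 := is_derive_round_metric (@fiber_coord R n k d) (fld V p) Y.2 Z.2 f0.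
have B2 := is_derive_round_metric_d (@fiber_coord R n k d) f0 fV' fX fY fZ.
have B3 j := @is_derive_round_metric_d _ _ _ (fun q => sphere_part q j)
  (@sphere_coord R n k d j) p (fld V p) X.2 Y.2 Z.2 (s0 j) (sV' j) (sX j) (sY j) (sZ j).
have T := is_derive_fctD (is_derive_fctD
  (is_derive_fctM (K X.1.1) (is_derive_fctD (is_derive_fctD
     (is_derive_fctM (K (Y.1.1 * Z.1.1)) A1) (is_derive_fctM (K (Y.1.2 * Z.1.2)) A2))
     (is_derive_fctM A3 B1)))
  (is_derive_fctM A4 B2))
  (is_derive_fct_sum (index_enum 'I_k) (fun j => is_derive_fctM (K (r j ^+ 2)) (B3 j))).
move: T; set g := (X in is_derive _ _ X _); set e := (X in is_derive _ _ _ X) => T.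
have -> : G1 r phi X Y Z = g by apply/funext => y; rewrite /g /G1 /= !expr2.
apply: is_derive_eq_val T _; rewrite /e /G2 /=.
congr (_ + _).
  rewrite /round_metric /round_metric_d /round_metric_d2 fiber_unit !fiber_fld.
  rewrite fV fX fY fZ /fdot expr1n !divr1.
  move: t p3 p2 p1 p0 (dot (fiber_part V.2) (fiber_part X.2)) => T P3 P2 P1 P0 vx.
  move: (dot (fiber_part Y.2) (fiber_part Z.2)) (dot (fiber_part X.2) (fiber_part Y.2))
    (dot (fiber_part V.2) (fiber_part Z.2)) (dot (fiber_part V.2) (fiber_part Y.2))
    (dot (fiber_part X.2) (fiber_part Z.2)) => yz xy vz vy xz.
  by ring.
apply: eq_bigr => j _; rewrite mul0r add0r /round_metric_d2 sphere_radius sphere_fld.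
rewrite /sdot; field.
by rewrite gt_eqF.
Qed.

(** The Christoffel symbols of W: the coefficients of the field whose value at [p] is the covariant
    derivative of Y along X, found by solving Koszul's formula. *)
Definition gam X Y : coef := (
  X.1.1 * Y.1.1 - p1 * p2 / t * (X.1.2 * Y.1.2) - p0 * p1 / t * fdot X Y,
  t * p2 / p1 * (X.1.1 * Y.1.2 + Y.1.1 * X.1.2),
  mkE 0 (t * p1 / p0 *: (X.1.1 *: fiber_part Y.2 + Y.1.1 *: fiber_part X.2)) (fun=> 0)).

Lemma gam_tcoef X Y : tcoef X -> tcoef Y -> tcoef (gam X Y).
Proof.
move=> [fX sX] [fY sY]; split=> [|j]; rewrite /= ?fiber_mkE ?sphere_mkE ?dot0r //.
by rewrite dotZr dotDr !dotZr fX fY !mulr0 addr0 mulr0.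
Qed.

Lemma p0_gt0 : 0 < p0. Proof. exact: (profile_gt0 hn hphi radius_gt0). Qed.
Lemma p1_gt0 : 0 < p1. Proof. exact: (ST_increasing hphi radius_gt0). Qed.

Lemma fdot_gam X Y Z : fdot (gam X Y) Z =
  t * p1 / p0 * (X.1.1 * fdot Y Z + Y.1.1 * fdot X Z).
Proof. by rewrite /fdot /= fiber_mkE dotZl dotDl !dotZl. Qed.

Lemma sdot_gam X Y Z j : sdot (gam X Y) Z j = 0.
Proof. by rewrite /sdot /= sphere_mkE dot0l. Qed.

Lemma sum_sdot_gam X Y Z : \sum_j sdot (gam X Y) Z j = 0.
Proof. by apply: big1 => j _; exact: sdot_gam. Qed.

Lemma gam_koszul X Y Z : tcoef X -> tcoef Y -> tcoef Z ->
  2 * G0 r phi (gam X Y) Z p =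
  G1 r phi X Y Z p + G1 r phi Y X Z p - G1 r phi Z X Y p.
Proof.
move=> tX tY tZ; rewrite G0_tangent ?G1_tangent //; last exact: gam_tcoef.
rewrite sum_sdot_gam.
rewrite fdot_gam /= (fdotC X Y).
have := radius_gt0; have := p0_gt0; have := p1_gt0.
move: t p0 p1 p2 => T P0 P1 P2 h1 h2 h3.
by field; rewrite !gt_eqF.
Qed.

(** By [profile_d2] this is phi'' / phi. The sectional curvature of N_0 is n - 2 times it on L_0,
    its opposite on planes spanned by a vector of L_0 and one of the fiber, and (1 - phi'^2) / phi^2
    on the fiber. *)
Definition mass_term : R := (n - 3)%:R * (1 - p1 ^+ 2) / (2 * p0 ^+ 2).

Definition curv_spheres X Y Z V : R :=
  \sum_j (sdot X Z j * sdot Y V j - sdot X V j * sdot Y Z j) / r j ^+ 2.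

(* The curvature tensor of W, with R(X,Y,X,Y) > 0 on the spheres. *)
Definition curv X Y Z V : R :=
  (n - 2)%:R * mass_term * (t ^+ 2 * p1 ^+ 2) *
    ((X.1.1 * Y.1.2 - X.1.2 * Y.1.1) * (Z.1.1 * V.1.2 - Z.1.2 * V.1.1))
  - mass_term * p0 ^+ 2 *
   ((t ^+ 2 * (X.1.1 * Z.1.1) + p1 ^+ 2 * (X.1.2 * Z.1.2)) * fdot Y V
    + (t ^+ 2 * (Y.1.1 * V.1.1) + p1 ^+ 2 * (Y.1.2 * V.1.2)) * fdot X Z
    - (t ^+ 2 * (X.1.1 * V.1.1) + p1 ^+ 2 * (X.1.2 * V.1.2)) * fdot Y Z
    - (t ^+ 2 * (Y.1.1 * Z.1.1) + p1 ^+ 2 * (Y.1.2 * Z.1.2)) * fdot X V)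
  + (1 - p1 ^+ 2) * p0 ^+ 2 * (fdot X Z * fdot Y V - fdot X V * fdot Y Z)
  + curv_spheres X Y Z V.

Lemma G2_spheresE X Y Z V : G2_spheres X V Y Z =
  2 * curv_spheres X Y Z V + G2_spheres X Z Y V + G2_spheres Y V X Z
  - G2_spheres Y Z X V.
Proof.
rewrite /G2_spheres /curv_spheres mulr_sumr -!big_split -sumrB.
apply: eq_bigr => j _ /=.
rewrite (sdotC Z Y) (sdotC V Y) (sdotC V X) (sdotC Z X) (sdotC Y X) (sdotC V Z).
move: (r j ^+ 2)^-1 (sdot X Y j) (sdot X Z j) (sdot X V j) (sdot Y Z j)
  (sdot Y V j) (sdot Z V j) => i xy xz xv yz yv zv; ring.
Qed.

(** The second derivatives of the Gram matrix are corrected by the products of tangential parts.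
    Once phi'' and phi''' are eliminated, the identity is rational in t, phi, phi' and the
    coefficients. *)
Lemma curvE X Y Z V : tcoef X -> tcoef Y -> tcoef Z -> tcoef V ->
  G2 X V Y Z - G2 X Z Y V - G2 Y V X Z + G2 Y Z X V
  - 2 * G0 r phi (gam X Z) (gam Y V) p + 2 * G0 r phi (gam X V) (gam Y Z) p
  = 2 * curv X Y Z V.
Proof.
move=> tX tY tZ tV; rewrite !G0_tangent; try exact: gam_tcoef.
rewrite !sum_sdot_gam.
rewrite !addr0 !fdot_gam !(fdotC _ (gam _ _)) !fdot_gam /G2 /curv.
rewrite G2_spheresE.
rewrite (fdotC Z Y) (fdotC V Y) (fdotC V X) (fdotC Z X) (fdotC Y X) (fdotC V Z).
have m2 : (n - 2)%:R = (n - 3)%:R + 1 :> R.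
  by rewrite -[X in _ + X]/(1%:R) -natrD addn1 -subSn // (leq_trans _ hn).
rewrite /mass_term /gam /= (profile_d3 hn hphi radius_gt0) (profile_d2 hn hphi radius_gt0) m2.
have := radius_gt0; have := p0_gt0; have := p1_gt0.
rewrite /=; move: (G2_spheres X Z Y V) (G2_spheres Y V X Z) (G2_spheres Y Z X V)
  (curv_spheres X Y Z V) => s2 s3 s4 s.
move: t p0 p1 ((n - 3)%:R) => T P0 P1 m h1 h2 h3.
move: (fdot X Y) (fdot X Z) (fdot X V) (fdot Y Z) (fdot Y V) (fdot Z V).
move: X.1.1 X.1.2 Y.1.1 Y.1.2 Z.1.1 Z.1.2 V.1.1 V.1.2.
move=> xa xb ya yb za zb va vb xy xz xv yz yv zv.
by field; rewrite !gt_eqF.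
Qed.

End Curvature.

(** * The second fundamental form expressed by commuting fields *)

Section SecondFundamentalForm.
Variables (R : realType) (n k : nat) (d : 'I_k -> nat) (r : 'I_k -> R).
Variable (phi : R -> R).
Hypothesis hn : (4 <= n)%N.
Hypothesis hr : forall j, 0 < r j.
Hypothesis hphi : ST_profile n phi.
Notation E := 'rV[R]_(2 + n.-1 + \sum_(j < k) (d j).+1).
Variables (N : nat) (U : set E) (Phi : E -> 'rV[R]_N).
Hypothesis hI : local_isometric_immersion r phi U Phi.
Variable p : E.
Hypothesis Up : U p.
Hypothesis xp : L0_part p != 0.
Local Notation F := (Phi \o retr r).
Local Notation Om := (retr r @^-1` U).
Local Notation coef := (@coef R n k d).
Local Notation fld := (@fld R n k d).
Local Notation tcoef := (@tcoef R n k d p).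
Local Notation gam := (@gam R n k d phi p).
Implicit Types X Y Z V : coef.

Let Wp : W_set r p := dom_W hI Up.
Let Omp : Om p := dom_retr hr hI Up.

Definition off_axis : set E := Om `&` [set q | L0_part q != 0].

Lemma off_axis_open : open off_axis.
Proof.
apply: openI; first exact: (dom_open hr hI).
by rewrite openE => q /= xq; exact: near_L0_nonzero.
Qed.

Lemma off_axis_p : off_axis p. Proof. by split. Qed.

Lemma F_off_axis a : smooth off_axis (vcomp F a).
Proof. by apply: smooth_sub (F_comp_smooth hr hI a) => x []. Qed.

Let oO := off_axis_open.
Let sF := F_off_axis.
Let Op := off_axis_p.

Lemma Lie_comp Z q a : Om q -> Lie (fld Z) (vcomp F a) q = ('D_(fld Z q) F q) ord0 a.
Proof.
move=> Oq; rewrite LieE vcomp_derive //.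
exact/diff_derivable/(F_differentiable hI).
Qed.

Lemma gram_G0 Y Z q : off_axis q -> gram F (fld Y) (fld Z) q = G0 r phi Y Z q.
Proof.
move=> [Oq xq].
transitivity (dot ('D_(fld Y q) F q) ('D_(fld Z q) F q)).
  by apply: eq_bigr => a _; rewrite !Lie_comp.
rewrite (metric_pullback hr hI) // L0_metric_fld // !fiber_fld /G0; congr (_ + _).
by apply: eq_bigr => j _; rewrite !sphere_fld.
Qed.

Lemma Lie_gram_G1 X Y Z q : off_axis q ->
  Lie (fld X) (gram F (fld Y) (fld Z)) q = G1 r phi X Y Z q.
Proof.
move=> Oq; rewrite (Lie_ext oO _ (@gram_G0 Y Z) Oq) LieE.
have [Omq xq] := Oq.
by have [_ ->] := is_derive_G0 r hphi X Y Z xq (dom_nonzero hr hI Omq).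
Qed.

Lemma Lie_gram_G2 V X Y Z : tcoef V -> tcoef X -> tcoef Y -> tcoef Z ->
  Lie (fld V) (Lie (fld X) (gram F (fld Y) (fld Z))) p = G2 r phi p V X Y Z.
Proof.
move=> tV tX tY tZ; rewrite (Lie_ext oO _ (@Lie_gram_G1 X Y Z) Op) LieE.
by have [_ ->] := is_derive_G1 hr hphi Wp xp tV tX tY tZ.
Qed.

Definition Hvec X Y : 'rV[R]_N := \row_a Lie (fld X) (Lie (fld Y) (vcomp F a)) p.
Definition dF Z : 'rV[R]_N := 'D_(fld Z p) F p.

Let sfld X : smooth_field off_axis (fld X) := fld_vcomp_smooth X oO.
Let cfld X Y : Lie_commute off_axis (fld X) (fld Y) := fld_commute X Y oO.

Lemma dot_dF X Y : dot (dF X) (dF Y) = G0 r phi X Y p.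
Proof.
rewrite -(gram_G0 _ _ Op); apply: eq_bigr => a _.
by rewrite !(Lie_comp _ _ Omp).
Qed.

Lemma Hvec_dF X Y Z : 2 * dot (Hvec X Y) (dF Z) =
  G1 r phi X Y Z p + G1 r phi Y X Z p - G1 r phi Z X Y p.
Proof.
rewrite -!(Lie_gram_G1 _ _ _ Op).
rewrite -(koszul oO sF (sfld X) (sfld Y) (sfld Z) (@cfld _ _) (@cfld _ _) (@cfld _ _) Op).
congr (_ * _); apply: eq_bigr => a _.
by rewrite mxE (Lie_comp _ _ Omp).
Qed.

Lemma Hvec_gauss X Y Z V : tcoef X -> tcoef Y -> tcoef Z -> tcoef V ->
  2 * (dot (Hvec X Z) (Hvec Y V) - dot (Hvec X V) (Hvec Y Z)) =
  G2 r phi p X V Y Z - G2 r phi p X Z Y V - G2 r phi p Y V X Z + G2 r phi p Y Z X V.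
Proof.
move=> tX tY tZ tV.
have := gauss oO sF (sfld X) (sfld Y) (sfld Z) (sfld V) (@cfld _ _) (@cfld _ _)
  (@cfld _ _) (@cfld _ _) (@cfld _ _) (@cfld _ _) Op.
rewrite !Lie_gram_G2 // => <-; congr (_ * (_ - _)); apply: eq_bigr => a _;
  by rewrite !mxE.
Qed.

Lemma HvecC X Y : Hvec X Y = Hvec Y X.
Proof. by apply/rowP => a; rewrite !mxE (cfld X Y (sF a) Op). Qed.

Lemma gamC X Y : gam X Y = gam Y X.
Proof.
rewrite /gam (fdotC X Y) (mulrC X.1.1) (mulrC X.1.2 Y.1.2).
rewrite [Y.1.1 * X.1.2 + _]addrC; congr (_, _, mkE _ (_ *: _) _).
by rewrite addrC.
Qed.

(** For tangent coefficients [gam_koszul] says that the subtracted vector is the tangential part of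
    [Hvec X Y]; what is left is its normal part. *)
Definition nH X Y : 'rV[R]_N := Hvec X Y - dF (gam X Y).

Lemma nHC X Y : nH X Y = nH Y X.
Proof. by rewrite /nH HvecC gamC. Qed.

Lemma two_inj (a b : R) : 2 * a = 2 * b -> a = b.
Proof. by apply: mulfI; rewrite pnatr_eq0. Qed.

Lemma Hvec_dF_gam X Y Z : tcoef X -> tcoef Y -> tcoef Z ->
  dot (Hvec X Y) (dF Z) = G0 r phi (gam X Y) Z p.
Proof.
move=> tX tY tZ; apply: two_inj.
by rewrite Hvec_dF (gam_koszul hn hr hphi Wp xp tX tY tZ).
Qed.

Lemma nH_normal X Y Z : tcoef X -> tcoef Y -> tcoef Z -> dot (nH X Y) (dF Z) = 0.
Proof. by move=> tX tY tZ; rewrite dotBl Hvec_dF_gam // dot_dF subrr. Qed.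

Lemma nH_gauss X Y Z V : tcoef X -> tcoef Y -> tcoef Z -> tcoef V ->
  dot (nH X Z) (nH Y V) - dot (nH X V) (nH Y Z) = curv r phi p X Y Z V.
Proof.
move=> tX tY tZ tV; apply: two_inj.
have tg A B : tcoef A -> tcoef B -> tcoef (gam A B) by exact: gam_tcoef.
(* Normal and tangential parts being orthogonal, the product of normal parts is that of the full
   second derivatives minus that of the tangential parts. *)
have D A B C G : tcoef A -> tcoef B -> tcoef C -> tcoef G ->
    dot (nH A B) (nH C G) = dot (Hvec A B) (Hvec C G) - G0 r phi (gam A B) (gam C G) p.
  move=> tA tB tC tG; rewrite {2}/nH dotBr nH_normal ?subr0 //; last exact: tg.
  rewrite /nH dotBl; congr (_ - _).
  by rewrite dotC (Hvec_dF_gam tC tG (tg _ _ tA tB)) -dot_dF dotC dot_dF.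
have alg (a b h1 h2 g1 g2 G K : R) : a = h1 - g1 -> b = h2 - g2 ->
    2 * (h1 - h2) = G -> G - 2 * g1 + 2 * g2 = 2 * K -> 2 * (a - b) = 2 * K.
  by move=> -> -> <- <-; ring.
exact: (alg _ _ _ _ _ _ _ _ (D X Z Y V tX tZ tY tV) (D X V Y Z tX tV tY tZ)
  (Hvec_gauss tX tY tZ tV) (curvE hn hr hphi Wp xp tX tY tZ tV)).
Qed.

(* The coefficients of the field of the family that takes the value u at p. *)
Definition coef_of (u : E) : coef :=
  (dot (L0_part p) (L0_part u) / dot (L0_part p) (L0_part p),
   dot (quarter_turn (L0_part p)) (L0_part u) / dot (L0_part p) (L0_part p), u).

Lemma fld_coef_of u : fld (coef_of u) p = u.
Proof.
apply: partsP => [||j]; rewrite ?fiber_fld ?sphere_fld // L0_fld /=.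
have x0 : dot (L0_part p) (L0_part p) != 0 by rewrite dot_eq0.
have S : dot (L0_part p) (L0_part p) *: L0_part u =
   dot (L0_part p) (L0_part u) *: L0_part p +
   dot (quarter_turn (L0_part p)) (L0_part u) *: quarter_turn (L0_part p).
  apply/rowP => i; rewrite !mxE !dot2E !mxE /=.
  case: (boolP (i == 0)) => [/eqP ->|i0]; first by ring.
  have -> : i = 1 by apply/val_inj; case: i i0 => -[|[|]].
  by ring.
rewrite -[RHS](scalerK x0) S scalerDr !scalerA.
by congr (_ *: _ + _ *: _); rewrite mulrC.
Qed.

Lemma coef_of_tcoef u : W_tangent p u -> tcoef (coef_of u).
Proof. by case=> fu su; split. Qed.

Lemma tangent_derive u : W_tangent p u -> 'D_u F p = dF (coef_of u).
Proof. by move=> tu; rewrite /dF fld_coef_of. Qed.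

(** The rows of the Jacobian are derivatives along coordinate vectors, and these may be replaced by
    their tangential parts. *)
Lemma normal_jacobian (w : 'rV[R]_N) : (forall X, tcoef X -> dot w (dF X) = 0) ->
  w *m (jacobian F p)^T = 0.
Proof.
move=> hw; apply/rowP => i; rewrite mxE [RHS]mxE.
have dFp := F_differentiable hI Omp.
transitivity (dot w ('D_(delta_mx ord0 i) F p)).
  apply: eq_bigr => a _; rewrite deriveEjacobian // -rowE !mxE.
  by [].
rewrite (derive_tangential hI _ Omp) tangent_derive ?hw //.
  exact/coef_of_tcoef/tangential_tangent/(dom_nonzero hr hI Omp).
exact/tangential_tangent/(dom_nonzero hr hI Omp).
Qed.

Lemma derive_jacobian_sub u : ('D_u F p <= jacobian F p)%MS.
Proof.
rewrite deriveEjacobian ?submxMl //; exact: (F_differentiable hI Omp).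
Qed.

(** [Hvec] differentiates along varying fields, the second fundamental form along fixed directions.
    The difference is a first derivative of F, hence lost in the normal projection. *)
Lemma derive2_Hvec X Y : 'D_(fld X p) ('D_(fld Y p) F) p =
  Hvec X Y - 'D_(\row_i Lie (fld X) (vcomp (fld Y) i) p) F p.
Proof.
have sF1 := smooth_on_derive (fld Y p) (F_smooth hI).
apply/rowP => a; rewrite mxE [X in _ = _ + X]mxE mxE.
rewrite (Lie_Lie oO (sfld X) (sfld Y) (sF a) Op).
have dFq q : Om q -> derivable F q (fld Y p).
  by move=> Oq; exact/diff_derivable/(F_differentiable hI).
rewrite !vcomp_derive; last first.
- exact/diff_derivable/(smooth_on_differentiable sF1 Omp).
- exact/diff_derivable/(F_differentiable hI Omp).
rewrite addrAC subrr add0r.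
apply: (derive_ext (dom_open hr hI) _ _ Omp) => q Oq.
by rewrite -vcomp_derive //; exact: dFq.
Qed.

Lemma second_fundamental_formE u v : W_tangent p u -> W_tangent p v ->
  second_fundamental_form r Phi p u v = nH (coef_of u) (coef_of v).
Proof.
move=> tu tv; rewrite /second_fundamental_form.
have -> : W_diff r (fun q => W_diff r Phi q v) p u = 'D_u ('D_v F) p.
  apply: (derive_retr_tangent hr Wp tu).
  exact: (smooth_on_differentiable (smooth_on_derive v (F_smooth hI)) Omp).
have -> : 'D_u ('D_v F) p =
    nH (coef_of u) (coef_of v) + (dF (gam (coef_of u) (coef_of v))
     - 'D_(\row_i Lie (fld (coef_of u)) (vcomp (fld (coef_of v)) i) p) F p).
  rewrite -{1}(fld_coef_of u) -{1}(fld_coef_of v) derive2_Hvec /nH.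
  by rewrite addrA subrK.
rewrite /normal_part normal_projE //.
  apply: normal_jacobian => X tX; apply: nH_normal => //; exact: coef_of_tcoef.
by apply: addmx_sub; rewrite ?eqmx_opp; exact: derive_jacobian_sub.
Qed.

End SecondFundamentalForm.

(** Two linear equations in more than two unknowns. *)
Lemma exists_orthogonal2 (R : realType) (N : nat) (y z : 'rV[R]_N) : (2 < N)%N ->
  exists v, [/\ v != 0, dot y v = 0 & dot z v = 0].
Proof.
move=> hN; pose A : 'M[R]_(1 + 1, N) := col_mx y z.
have /rowV0Pn[v vA v0] : kermx A^T != 0.
  rewrite kermx_eq0 /row_free; apply: contraTneq (rank_leq_col A^T) => ->.
  by rewrite -ltnNge.
exists v; move/sub_kermxP: vA; rewrite /A tr_col_mx mul_mx_row => /eqP.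
rewrite row_mx_eq0 => /andP[/eqP vy /eqP vz].
by split=> //; rewrite dotC dotE ?vy ?vz mxE.
Qed.

Lemma dot_quarter_turn2 (R : realType) (x : 'rV[R]_2) :
  dot (quarter_turn x) (quarter_turn x) = dot x x.
Proof. by rewrite !dot2E !mxE /=; ring. Qed.

(* If the curvature of N_0 came from a single second fundamental form s, scaled
   so that s_aa = 1, then s would be diagonal in the frame, and the sectional
   curvatures of the planes ab and tb would force that of t theta to be
   (n - 3)/2 instead of n - 2 times -c, c being that of the plane ta. *)
Lemma rank_one_contradiction (R : realType) (m nu t2 P F w al be : R)
    (tt thth bb tth ta tb tha thb ab : R) :
  0 < m -> 0 < nu -> 0 < t2 -> 0 < P -> 0 < F -> 0 < w -> 0 < al -> 0 < be ->
  let C := m * w / 2 in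
  nu * (bb - ab ^+ 2) = w * F * (al * be) ->
  nu * (ta * bb - tb * ab) = 0 ->
  nu * (tha * bb - thb * ab) = 0 ->
  nu * (tt - ta ^+ 2) = - C * t2 * al ->
  nu * (thth - tha ^+ 2) = - C * P * al ->
  nu * (tth - ta * tha) = 0 ->
  nu * (tb - ta * ab) = 0 ->
  nu * (thb - tha * ab) = 0 ->
  nu * (ab * tt - tb * ta) = 0 ->
  nu * (tt * thth - tth ^+ 2) = (m + 1) * (C / F) * (t2 * P) ->
  nu * (tt * bb - tb ^+ 2) = - C * t2 * be ->
  False.
Proof.
move=> m0 nu0 t0 P0 F0 w0 a0 b0 C.
have z x : nu * x = 0 -> x = 0.
  by move/eqP; rewrite mulf_eq0 gt_eqF //= => /eqP.
have C0 : 0 < C by rewrite divr_gt0 ?mulr_gt0.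
move=> e0 /z e1 /z e2 e3 e4 /z e5 /z e6 /z e7 /z e8 e9 e10.
have tbE : tb = ta * ab by move/eqP: e6; rewrite subr_eq0 => /eqP.
have thbE : thb = tha * ab by move/eqP: e7; rewrite subr_eq0 => /eqP.
have bb0 : bb - ab ^+ 2 != 0.
  apply/eqP => h; move: e0; rewrite h mulr0 => /esym/eqP.
  by rewrite gt_eqF // !mulr_gt0.
have ta0 : ta = 0.
  have /eqP : ta * (bb - ab ^+ 2) = 0 by rewrite -e1 tbE; ring.
  by rewrite mulf_eq0 (negbTE bb0) orbF => /eqP.
have tha0 : tha = 0.
  have /eqP : tha * (bb - ab ^+ 2) = 0 by rewrite -e2 thbE; ring.
  by rewrite mulf_eq0 (negbTE bb0) orbF => /eqP.
have tb0 : tb = 0 by rewrite tbE ta0 mul0r.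
have tth0 : tth = 0 by move: e5; rewrite ta0 mul0r subr0.
have sq0 : (0 : R) ^+ 2 = 0 by rewrite expr0n.
rewrite ?(ta0, tb0, tth0, tha0, sq0, subr0) in e3 e4 e8 e9 e10.
have tt0 : tt != 0.
  apply/eqP => h; move: e3; rewrite h mulr0 !mulNr => /esym/eqP.
  by rewrite oppr_eq0 gt_eqF // !mulr_gt0.
have ab0 : ab = 0.
  move/eqP: e8; rewrite mul0r subr0 mulf_eq0 (negbTE tt0) orbF => /eqP //.
rewrite ?(ab0, sq0, subr0) in e0 e3 e4 e9 e10.
have bbE : al * bb = be.
  apply: (@mulfI _ (- C * t2)); first by rewrite mulNr oppr_eq0 gt_eqF // mulr_gt0.
  by rewrite mulrA -e3 -e10; ring.
have nuE : nu = w * F * al ^+ 2.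
  apply: (@mulIf _ be); first by rewrite gt_eqF.
  by rewrite -{1}bbE mulrCA e0; ring.
have CC : (C * al) ^+ 2 * (t2 * P) = nu * ((m + 1) * (C / F) * (t2 * P)).
  have -> : (C * al) ^+ 2 * (t2 * P) = (- C * t2 * al) * (- C * P * al) by ring.
  by rewrite -e3 -e4 -e9; ring.
have : C = (m + 1) * w.
  have tP : t2 * P != 0 by rewrite gt_eqF // mulr_gt0.
  have Ca : C * al ^+ 2 != 0 by rewrite gt_eqF // mulr_gt0 // exprn_gt0.
  apply: (mulfI Ca); apply: (mulIf tP).
  have -> : C * al ^+ 2 * C * (t2 * P) = (C * al) ^+ 2 * (t2 * P) by ring.
  rewrite CC nuE; field.
  by rewrite gt_eqF.
rewrite /C => h.
have := mulr_gt0 m0 w0; lra.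
Qed.

Lemma round_metric_ge0 (R : realType) (N : nat) (y c : 'rV[R]_N) : y != 0 ->
  0 <= round_metric y c c.
Proof.
move=> y0; have y1 : 0 < dot y y by rewrite dot_gt0.
by rewrite -(pmulr_rge0 _ y1) -dot_tangential // dot_ge0.
Qed.

Lemma round_metric_eq0 (R : realType) (N : nat) (y c : 'rV[R]_N) : y != 0 ->
  round_metric y c c = 0 -> c - (dot y c / dot y y) *: y = 0.
Proof.
by move=> y0 e; apply/eqP; rewrite -dot_eq0 dot_tangential // e mulr0.
Qed.

(** * Adapted second fundamental forms *)

Section Injectivity.
Variables (R : realType) (n k : nat) (d : 'I_k -> nat) (r : 'I_k -> R).
Variable (phi : R -> R).
Hypothesis hn : (4 <= n)%N.
Hypothesis hr : forall j, 0 < r j.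
Hypothesis hphi : ST_profile n phi.
Notation E := 'rV[R]_(2 + n.-1 + \sum_(j < k) (d j).+1).
Variables (N : nat) (U : set E) (Phi : E -> 'rV[R]_N).
Hypothesis hI : local_isometric_immersion r phi U Phi.
Local Notation F := (Phi \o retr r).
Local Notation Om := (retr r @^-1` U).
Implicit Types (q u : E).

Lemma L0_metric_ge0 (x a : 'rV[R]_2) : 0 <= L0_metric phi x a a.
Proof.
have sq0 (z : R) : 0 <= z * z by rewrite -expr2 sqr_ge0.
rewrite /L0_metric; case: eqP => _ /=; first exact: dot_ge0.
by rewrite addr_ge0 ?sq0 // mulr_ge0 ?sqr_ge0 ?sq0.
Qed.

Lemma L0_metric_eq0 (x a : 'rV[R]_2) : L0_metric phi x a a = 0 -> a = 0.
Proof.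
have sq0 (z : R) : 0 <= z * z by rewrite -expr2 sqr_ge0.
rewrite /L0_metric; case: eqP => [_ /eqP|/eqP x0] /=; first by rewrite dot_eq0 => /eqP.
set A := dot x a / enorm x; set B := (_ / enorm x ^+ 2).
have t0 : 0 < enorm x by rewrite enorm_gt0.
have P0 : 0 < derive1 phi (enorm x) ^+ 2 by rewrite exprn_gt0 // (ST_increasing hphi).
move/eqP; rewrite paddr_eq0 ?sq0 //; last by rewrite mulr_ge0 ?sqr_ge0 ?sq0.
rewrite mulf_eq0 orbb => /andP[/eqP A0]; rewrite mulf_eq0 (gt_eqF P0) /= mulf_eq0 orbb => /eqP B0.
have e1 : x ord0 0 * a ord0 0 + x ord0 1 * a ord0 1 = 0.
  rewrite -dot2E; apply/eqP; move/eqP: A0; rewrite mulf_eq0 invr_eq0 (gt_eqF t0) orbF.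
  by [].
have e2 : x ord0 0 * a ord0 1 - x ord0 1 * a ord0 0 = 0.
  apply/eqP; move/eqP: B0; rewrite mulf_eq0 invr_eq0 expf_eq0 /= (gt_eqF t0) orbF.
  by [].
have X0 : dot x x != 0 by rewrite dot_eq0.
apply/eqP; rewrite -dot_eq0; apply/eqP/(mulfI X0); rewrite mulr0.
(* Lagrange's identity in the plane: |x|^2 |a|^2 is the sum of the squares of the radial and the
   angular term. *)
transitivity ((x ord0 0 * a ord0 0 + x ord0 1 * a ord0 1) ^+ 2 +
  (x ord0 0 * a ord0 1 - x ord0 1 * a ord0 0) ^+ 2); first by rewrite !dot2E; ring.
by rewrite e1 e2 expr0n addr0.
Qed.

Lemma profile_neq0 (s : R) : 0 <= s -> phi s != 0.
Proof.
rewrite le_eqVlt => /orP[/eqP <-|s0]; last by rewrite gt_eqF // (profile_gt0 hn hphi).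
by rewrite (ST_at0 hphi) gt_eqF // divr_gt0 // ltr0n subn_gt0.
Qed.

(** The pulled-back metric is a sum of nonnegative terms, and each vanishes only if the
    corresponding component of [u] is zero on L_0 or radial elsewhere. *)
Lemma immersion_ker q u : Om q -> 'D_u F q = 0 -> tangential q u = 0.
Proof.
move=> Oq Du; have [f0 s0] := dom_nonzero hr hI Oq.
have P0 : 0 < phi (enorm (L0_part q)) ^+ 2.
  by rewrite lt_def sqr_ge0 andbT expf_neq0 // profile_neq0 // enorm_ge0.
have S0 : 0 <= \sum_j r j ^+ 2 *
    round_metric (sphere_part q j) (sphere_part u j) (sphere_part u j).
  by apply: sumr_ge0 => j _; rewrite mulr_ge0 ?sqr_ge0 ?round_metric_ge0.
have := metric_pullback hr hI u u Oq; rewrite Du dot0l => /esym/eqP.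
rewrite paddr_eq0 //; last first.
  by rewrite addr_ge0 ?L0_metric_ge0 // mulr_ge0 ?sqr_ge0 ?round_metric_ge0.
rewrite paddr_eq0 ?L0_metric_ge0 //; last by rewrite mulr_ge0 ?sqr_ge0 ?round_metric_ge0.
move=> /andP[/andP[/eqP/L0_metric_eq0 L0 ]]; rewrite mulf_eq0 (gt_eqF P0) /=.
move=> /eqP fz; rewrite psumr_eq0 => [/allP sz|j _]; last first.
  by rewrite mulr_ge0 ?sqr_ge0 ?round_metric_ge0.
have p0 : L0_part (0 : E) = 0 by apply/rowP => i; rewrite !mxE.
have pf : fiber_part (0 : E) = 0 by apply/rowP => i; rewrite !mxE.
have ps j : sphere_part (0 : E) j = 0 by apply/rowP => i; rewrite !mxE.
apply: partsP => [||j]; rewrite !partE ?p0 ?pf ?ps.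
- exact: L0.
- exact: round_metric_eq0.
- apply: round_metric_eq0 => //; have := sz j (mem_index_enum j).
  by rewrite mulf_eq0 expf_eq0 /= (gt_eqF (hr j)) => /eqP.
Qed.

(** [unlift ord0] identifies the k + 1 row indices with [option 'I_k], so that the rows are all the
    radial vectors. *)
Definition radial_mx q : 'M[R]_(k.+1, 2 + n.-1 + \sum_(j < k) (d j).+1) :=
  \matrix_(i, l) radial (unlift ord0 i) q ord0 l.

Lemma row_radial_mx q i : row i (radial_mx q) = radial (unlift ord0 i) q.
Proof. by apply/rowP => l; rewrite !mxE. Qed.

Lemma radial_sub o q : (radial o q <= radial_mx q)%MS.
Proof.
have [i <-] : exists i, unlift ord0 i = o.
  by case: o => [j|]; [exists (lift ord0 j); rewrite liftK|exists ord0; rewrite unlift_none].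
by rewrite -row_radial_mx row_sub.
Qed.

Lemma radial_component_sub q u : (radial_component q u <= radial_mx q)%MS.
Proof.
rewrite /radial_component addmx_sub ?scalemx_sub ?radial_sub //.
by apply: summx_sub => j _; rewrite scalemx_sub // radial_sub.
Qed.

(** The kernel of dF lies in the span of the k + 1 radial vectors, and the ambient dimension is n +
    sum_j d_j + k + 1. *)
Lemma rank_jacobian q : Om q -> (n + \sum_(j < k) d j <= \rank (jacobian F q))%N.
Proof.
move=> Oq; have dF := F_differentiable hI Oq.
have : (kermx (jacobian F q) <= radial_mx q)%MS.
  apply/row_subP => i; set u := row i _.
  have : u *m jacobian F q = 0 by apply/sub_kermxP; exact: row_sub.
  rewrite -deriveEjacobian // => /(immersion_ker Oq).
  by rewrite tangentialE => /eqP; rewrite subr_eq0 => /eqP ->; exact: radial_component_sub.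
move=> /mxrankS; rewrite mxrank_ker => h.
have := leq_trans h (rank_leq_row _).
rewrite leq_subLR.
move: (\rank _) => rk.
have -> : (\sum_(j < k) (d j).+1 = \sum_(j < k) d j + k)%N.
  by under eq_bigr do rewrite -addn1; rewrite big_split sum1_card card_ord.
lia.
Qed.

End Injectivity.

Section GaussEquation.
Variables (R : realType) (n k : nat) (d : 'I_k -> nat) (r : 'I_k -> R).
Variable (phi : R -> R).
Hypothesis hn : (4 <= n)%N.
Hypothesis hr : forall j, 0 < r j.
Hypothesis hphi : ST_profile n phi.
Notation E := 'rV[R]_(2 + n.-1 + \sum_(j < k) (d j).+1).
Variables (N : nat) (U : set E) (Phi : E -> 'rV[R]_N).
Hypothesis hI : local_isometric_immersion r phi U Phi.
Variable p : E.
Hypothesis Up : U p.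
Hypothesis xp : L0_part p != 0.
Local Notation F := (Phi \o retr r).
Local Notation al := (second_fundamental_form r Phi p).
Local Notation co := (coef_of p).
Implicit Types (u v w z : E).

Lemma gauss_equation u v w z : W_tangent p u -> W_tangent p v ->
  W_tangent p w -> W_tangent p z ->
  dot (al u w) (al v z) - dot (al u z) (al v w) =
  curv r phi p (co u) (co v) (co w) (co z).
Proof.
move=> tu tv tw tz.
have e a b ta tb := @second_fundamental_formE _ _ _ _ _ _ hn hr hphi _ _ _ hI _ Up xp a b ta tb.
have dd (a b a' b' : 'rV[R]_N) : a = a' -> b = b' -> dot a b = dot a' b' by move=> -> ->.
apply: (etrans _ (nH_gauss hn hr hphi hI Up xp (coef_of_tcoef tu) (coef_of_tcoef tv)
  (coef_of_tcoef tw) (coef_of_tcoef tz))).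
apply: (congr2 (fun a b : R => a - b)).
  exact: (dd _ _ _ _ (e u w tu tw) (e v z tv tz)).
exact: (dd _ _ _ _ (e u z tu tz) (e v w tv tw)).
Qed.

Lemma second_fundamental_formC u v : W_tangent p u -> W_tangent p v -> al u v = al v u.
Proof.
move=> tu tv; apply: etrans (second_fundamental_formE hn hr hphi hI Up xp tu tv) _.
apply: etrans (nHC hr hI Up xp (co u) (co v)) _.
exact: esym (second_fundamental_formE hn hr hphi hI Up xp tv tu).
Qed.

Lemma second_fundamental_form_normal u v : W_tangent p u -> W_tangent p v ->
  al u v *m (jacobian F p)^T = 0.
Proof.
move=> tu tv; rewrite (second_fundamental_formE hn hr hphi hI Up xp tu tv).
apply: (normal_jacobian hr hI Up xp) => X tX.
exact: (nH_normal hn hr hphi hI Up xp (coef_of_tcoef tu) (coef_of_tcoef tv) tX).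
Qed.

End GaussEquation.

(** * Counting normal directions of an adapted form at one point *)

Section AdaptedCodimension.
Variables (R : realType) (n k : nat) (d : 'I_k -> nat) (r : 'I_k -> R).
Variable (phi : R -> R).
Hypothesis hn : (4 <= n)%N.
Hypothesis hd : forall j, (2 <= d j)%N.
Hypothesis hr : forall j, 0 < r j.
Hypothesis hphi : ST_profile n phi.
Notation E := 'rV[R]_(2 + n.-1 + \sum_(j < k) (d j).+1).
Variable p : E.
Hypothesis xp : L0_part p != 0.
Local Notation co := (coef_of p).
Local Notation x := (L0_part p).
Local Notation y := (fiber_part p).
Local Notation t := (enorm x).
Implicit Types (u v w z : E).

Definition N0_vec (a b : R) (c : 'rV[R]_n.-1) : E :=
  mkE (a *: x + b *: quarter_turn x) c (fun=> 0).

Definition sphere_single (c : forall j, 'rV[R]_(d j).+1) (j : 'I_k) : E :=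
  mkE 0 0 (fun j' => (j' == j)%:R *: c j').

Lemma co_N0_vec a b c : (co (N0_vec a b c)).1 = (a, b).
Proof.
have x0 : dot x x != 0 by rewrite dot_eq0.
rewrite /coef_of /= L0_mkE !dotDr !dotZr dot_quarter_turn dot_quarter_turn2.
by rewrite (dotC (quarter_turn _)) dot_quarter_turn !mulr0 addr0 add0r !mulfK.
Qed.

Lemma co_sphere_single c j : (co (sphere_single c j)).1 = (0, 0).
Proof. by rewrite /coef_of /= L0_mkE !dot0r !mul0r. Qed.

Lemma N0_vec_tangent a b c : dot y c = 0 -> W_tangent p (N0_vec a b c).
Proof. by move=> yc; split=> [|j]; rewrite !partE ?dot0r. Qed.

Lemma sphere_single_tangent c j : (forall j, dot (sphere_part p j) (c j) = 0) ->
  W_tangent p (sphere_single c j).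
Proof. by move=> hc; split=> [|j']; rewrite !partE ?dot0r // dotZr hc mulr0. Qed.

Lemma N0_vec_factor a b c : dot y c = 0 -> factor_tangent None p (N0_vec a b c).
Proof. by move=> yc; split=> [|j]; [exact: N0_vec_tangent|rewrite partE]. Qed.

Lemma sphere_single_factor c j : (forall j, dot (sphere_part p j) (c j) = 0) ->
  factor_tangent (Some j) p (sphere_single c j).
Proof.
move=> hc; split; rewrite ?partE //; first exact: sphere_single_tangent.
by move=> j' jj'; rewrite partE (negbTE jj') scale0r.
Qed.

Lemma fdot_co u v : fdot (co u) (co v) = dot (fiber_part u) (fiber_part v).
Proof. by []. Qed.

Lemma sdot_co u v j : sdot (co u) (co v) j = dot (sphere_part u j) (sphere_part v j).
Proof. by []. Qed.

Lemma curv_N0_vec a1 b1 c1 a2 b2 c2 a3 b3 c3 a4 b4 c4 :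
  curv r phi p (co (N0_vec a1 b1 c1)) (co (N0_vec a2 b2 c2)) (co (N0_vec a3 b3 c3))
    (co (N0_vec a4 b4 c4)) =
  let m := mass_term phi p in let P := derive1 phi t ^+ 2 in
  (n - 2)%:R * m * (t ^+ 2 * P) * ((a1 * b2 - b1 * a2) * (a3 * b4 - b3 * a4))
  - m * phi t ^+ 2 *
   ((t ^+ 2 * (a1 * a3) + P * (b1 * b3)) * dot c2 c4
    + (t ^+ 2 * (a2 * a4) + P * (b2 * b4)) * dot c1 c3
    - (t ^+ 2 * (a1 * a4) + P * (b1 * b4)) * dot c2 c3
    - (t ^+ 2 * (a2 * a3) + P * (b2 * b3)) * dot c1 c4)
  + (1 - P) * phi t ^+ 2 * (dot c1 c3 * dot c2 c4 - dot c1 c4 * dot c2 c3).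
Proof.
rewrite /curv !co_N0_vec !fdot_co !fiber_mkE /=.
have -> : curv_spheres r (co (N0_vec a1 b1 c1)) (co (N0_vec a2 b2 c2)) (co (N0_vec a3 b3 c3))
  (co (N0_vec a4 b4 c4)) = 0.
  apply: big1 => j _; rewrite !sdot_co !sphere_mkE !dot0l !mul0r subrr mul0r //.
by rewrite addr0.
Qed.

(** The rest of the count is linear algebra at [p]: the form enters through Gauss's equation,
    symmetry, normality and adaptedness at that single point. *)
Variables (N : nat) (al : E -> E -> 'rV[R]_N).
Variable J : 'M[R]_(2 + n.-1 + \sum_(j < k) (d j).+1, N).
Hypothesis al_gauss : forall u v w z, W_tangent p u -> W_tangent p v ->
  W_tangent p w -> W_tangent p z ->
  dot (al u w) (al v z) - dot (al u z) (al v w) =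
  curv r phi p (co u) (co v) (co w) (co z).
Hypothesis alC : forall u v, W_tangent p u -> W_tangent p v -> al u v = al v u.
Hypothesis al_normal : forall u v, W_tangent p u -> W_tangent p v ->
  al u v *m J^T = 0.
Hypothesis rankJ : (n + \sum_(j < k) d j <= \rank J)%N.
Hypothesis al_adapted : forall (i j : option 'I_k) u v, i != j ->
  factor_tangent i p u -> factor_tangent j p v -> al u v = 0.

(** Otherwise the form on N_0 is a scalar form times [nu], and Gauss's equations for two vectors of
    L_0 and two of the fiber become the scalar system of [rank_one_contradiction]. *)
Lemma exists_not_multiple c (nu : 'rV[R]_N) : c != 0 -> dot y c = 0 ->
  al (N0_vec 0 0 c) (N0_vec 0 0 c) = nu -> nu != 0 ->
  exists a1 b1 c1 a2 b2 c2, [/\ dot y c1 = 0, dot y c2 = 0 &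
    forall s, al (N0_vec a1 b1 c1) (N0_vec a2 b2 c2) <> s *: nu].
Proof.
move=> c0 yc alc nu0.
apply: contrapT => hnot.
have mult a1 b1 c1 a2 b2 c2 : dot y c1 = 0 -> dot y c2 = 0 ->
    exists s, al (N0_vec a1 b1 c1) (N0_vec a2 b2 c2) = s *: nu.
  move=> y1 y2; apply: contrapT => hs; apply: hnot.
  exists a1, b1, c1, a2, b2, c2; split=> // s es; apply: hs; by exists s.
have n3 : (2 < n.-1)%N by rewrite -ltnS prednK // (leq_trans _ hn).
have [e [e0 ye ce]] := exists_orthogonal2 y c n3.
have z0 : dot y 0 = 0 by rewrite dot0r.
have tg a b f : dot y f = 0 -> W_tangent p (N0_vec a b f) by exact: N0_vec_tangent.
pose T := N0_vec 1 0 0; pose H := N0_vec 0 1 0; pose A := N0_vec 0 0 c; pose B := N0_vec 0 0 e.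
have tT : W_tangent p T by exact: tg.
have tH : W_tangent p H by exact: tg.
have tA : W_tangent p A by exact: tg.
have tB : W_tangent p B by exact: tg.
have [tt ett] := mult 1 0 0 1 0 0 z0 z0.
have [tth etth] := mult 1 0 0 0 1 0 z0 z0.
have [thth ethth] := mult 0 1 0 0 1 0 z0 z0.
have [ta eta] := mult 1 0 0 0 0 c z0 yc.
have [tb etb] := mult 1 0 0 0 0 e z0 ye.
have [tha etha] := mult 0 1 0 0 0 c z0 yc.
have [thb ethb] := mult 0 1 0 0 0 e z0 ye.
have [ab eab] := mult 0 0 c 0 0 e yc ye.
have [bb ebb] := mult 0 0 e 0 0 e ye ye.
rewrite -/T -/H -/A -/B in ett etth ethth eta etb etha ethb eab ebb alc.
(* Choosing [nu] as the value on (c, c) normalizes s_aa to 1. *)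
have eaa : al A A = 1 *: nu by rewrite scale1r.
have G u v w z s1 s2 s3 s4 : W_tangent p u -> W_tangent p v ->
    W_tangent p w -> W_tangent p z -> al u w = s1 *: nu -> al v z = s2 *: nu ->
    al u z = s3 *: nu -> al v w = s4 *: nu ->
    dot nu nu * (s1 * s2 - s3 * s4) = curv r phi p (co u) (co v) (co w) (co z).
  move=> tu tv tw tz e1 e2 e3 e4; rewrite -al_gauss // e1 e2 e3 e4 !dotZl !dotZr.
  by ring.
have m0 : 0 < (n - 3)%:R :> R by rewrite ltr0n subn_gt0.
have t0 : 0 < t by rewrite enorm_gt0.
have f0 := profile_gt0 hn hphi t0.
have P0 := ST_increasing hphi t0.
have w0 := profile_d1_lt1 hn hphi t0.
have m2 : (n - 2)%:R = (n - 3)%:R + 1 :> R.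
  by rewrite -[X in _ + X]/(1%:R) -natrD addn1 -subSn // (leq_trans _ hn).
have cc0 : 0 < dot c c by rewrite dot_gt0.
have ee0 : 0 < dot e e by rewrite dot_gt0.
have nn0 : 0 < dot nu nu by rewrite dot_gt0.
have ec : dot e c = 0 by rewrite dotC.
have sT := alC tT; have sH := alC tH; have sA := alC tA; have sB := alC tB.
have mE : mass_term phi p * phi t ^+ 2 = (n - 3)%:R * (1 - derive1 phi t ^+ 2) / 2.
  by rewrite /mass_term; field; rewrite gt_eqF.
have mE' : mass_term phi p = (n - 3)%:R * (1 - derive1 phi t ^+ 2) / 2 / phi t ^+ 2.
  by rewrite -mE mulfK // expf_neq0 // gt_eqF.
(* T is t d/dt and H is d/dtheta, of squared lengths t^2 and phi'^2; A and B are the fiber vectors c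
   and e, of squared lengths phi^2 |c|^2 and phi^2 |e|^2. The eleven remaining goals are instances
   of Gauss's equation in this frame. *)
apply: (@rank_one_contradiction _ (n - 3)%:R (dot nu nu) (t ^+ 2) (derive1 phi t ^+ 2)
  (phi t ^+ 2) (1 - derive1 phi t ^+ 2) (dot c c) (dot e e) tt thth bb tth ta tb tha thb ab);
  rewrite ?exprn_gt0 //.
- have := G A B A B 1 bb ab ab tA tB tA tB eaa ebb eab; rewrite sB // => /(_ eab).
  rewrite mul1r -expr2 curv_N0_vec /= ?ce ?ec => ->; ring.
- have := G T B A B ta bb tb ab tT tB tA tB eta ebb etb; rewrite sB // => /(_ eab) ->.
  rewrite curv_N0_vec /= ?ce ?ec ?dot0l ?dot0r; ring.
- have := G H B A B tha bb thb ab tH tB tA tB etha ebb ethb; rewrite sB // => /(_ eab) ->.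
  rewrite curv_N0_vec /= ?ce ?ec ?dot0l ?dot0r; ring.
- have := G T A T A tt 1 ta ta tT tA tT tA ett eaa eta; rewrite sA // => /(_ eta).
  rewrite mulr1 -expr2 => ->.
  rewrite curv_N0_vec /= mE ?ce ?ec ?dot0l ?dot0r; ring.
- have := G H A H A thth 1 tha tha tH tA tH tA ethth eaa etha; rewrite sA // => /(_ etha).
  rewrite mulr1 -expr2 => ->.
  rewrite curv_N0_vec /= mE ?ce ?ec ?dot0l ?dot0r; ring.
- have := G T A H A tth 1 ta tha tT tA tH tA etth eaa eta; rewrite sA // => /(_ etha).
  rewrite mulr1 => ->.
  rewrite curv_N0_vec /= mE ?ce ?ec ?dot0l ?dot0r; ring.
- have := G T A B A tb 1 ta ab tT tA tB tA etb eaa eta eab.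
  rewrite mulr1 => ->.
  rewrite curv_N0_vec /= mE ?ce ?ec ?dot0l ?dot0r; ring.
- have := G H A B A thb 1 tha ab tH tA tB tA ethb eaa etha eab.
  rewrite mulr1 => ->.
  rewrite curv_N0_vec /= mE ?ce ?ec ?dot0l ?dot0r; ring.
- have := G B T A T ab tt tb ta tB tT tA tT; rewrite (sB A) // (sB T) // => /(_ eab ett etb eta).
  move=> ->.
  rewrite curv_N0_vec /= mE ?ce ?ec ?dot0l ?dot0r; ring.
- have := G T H T H tt thth tth tth tT tH tT tH ett ethth etth; rewrite sH // => /(_ etth).
  rewrite -expr2 => ->.
  rewrite curv_N0_vec /= m2 mE' ?ce ?ec ?dot0l ?dot0r; ring.
- have := G T B T B tt bb tb tb tT tB tT tB ett ebb etb; rewrite sB // => /(_ etb).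
  rewrite -expr2 => ->.
  rewrite curv_N0_vec /= mE ?ce ?ec ?dot0l ?dot0r; ring.
Qed.

Lemma curv_sphere_single (c e : forall j, 'rV[R]_(d j).+1) j :
  curv r phi p (co (sphere_single c j)) (co (sphere_single e j)) (co (sphere_single c j))
    (co (sphere_single e j)) =
  (dot (c j) (c j) * dot (e j) (e j) - dot (c j) (e j) ^+ 2) / r j ^+ 2.
Proof.
rewrite /curv !co_sphere_single !fdot_co !fiber_mkE !dot0l /=.
rewrite /curv_spheres (bigD1 j) //= big1 => [|j' jj']; last first.
  by rewrite !sdot_co !sphere_mkE (negbTE jj') !scale0r !dot0l !mul0r subrr mul0r.
rewrite !sdot_co !sphere_mkE eqxx !scale1r (dotC (e j)) expr2.
by move: (mass_term _ _) (derive1 _ _) (phi _) => ? ? ?; rewrite addr0; ring.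
Qed.

Lemma curv_N0_vec_sphere_single a1 b1 c1 a2 b2 c2 (e : forall j, 'rV[R]_(d j).+1) j :
  curv r phi p (co (N0_vec a1 b1 c1)) (co (sphere_single e j)) (co (N0_vec a2 b2 c2))
    (co (sphere_single e j)) = 0.
Proof.
rewrite /curv !co_N0_vec !co_sphere_single !fdot_co !fiber_mkE !dot0l !dot0r /=.
rewrite /curv_spheres big1 => [|j' _]; last first.
  by rewrite !sdot_co !sphere_mkE !dot0l !mul0r subrr mul0r.
by move: (mass_term _ _) (derive1 _ _) (phi _) => ? ? ?; ring.
Qed.

Lemma curv_two_spheres (e : forall j, 'rV[R]_(d j).+1) i j : i != j ->
  curv r phi p (co (sphere_single e i)) (co (sphere_single e j)) (co (sphere_single e i))
    (co (sphere_single e j)) = 0.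
Proof.
move=> ij; rewrite /curv !co_sphere_single !fdot_co !fiber_mkE !dot0l /=.
rewrite /curv_spheres big1 => [|j' _]; last first.
  rewrite !sdot_co !sphere_mkE !dotZl !dotZr.
  case: (eqVneq j' i) => [->|_]; last by rewrite !mul0r subrr mul0r.
  by rewrite (negbTE ij) !mul0r !mulr0 subrr mul0r.
by move: (mass_term _ _) (derive1 _ _) (phi _) => ? ? ?; ring.
Qed.

(** If alpha(u, u) were zero, Gauss's equation would make the curvature equal to -|alpha(u,
    v)|^2. *)
Lemma second_fundamental_form_neq0 u v : W_tangent p u -> W_tangent p v ->
  0 < curv r phi p (co u) (co v) (co u) (co v) -> al u u != 0.
Proof.
move=> tu tv; rewrite -al_gauss // (alC tv tu) => h.
apply: contraTneq h => ->; rewrite dot0l sub0r -leNgt oppr_le0; exact: dot_ge0.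
Qed.

Lemma adapted_codimension : (n + \sum_(j < k) d j + (k + 2) <= N)%N.
Proof.
have n3 : (2 < n.-1)%N by rewrite -ltnS prednK // (leq_trans _ hn).
(* Since n - 1 > 2, the fiber sphere has two orthogonal tangent vectors c and e. The first has a
   single constraint, so [y] is passed twice. *)
have [c [c0 yc _]] := exists_orthogonal2 y y n3.
have [e [e0 ye ce]] := exists_orthogonal2 y c n3.
have t0 : 0 < t by rewrite enorm_gt0.
have f0 := profile_gt0 hn hphi t0.
have w0 := profile_d1_lt1 hn hphi t0.
set nu := al (N0_vec 0 0 c) (N0_vec 0 0 c).
have nu0 : nu != 0.
  apply: (second_fundamental_form_neq0 (N0_vec_tangent 0 0 yc) (N0_vec_tangent 0 0 ye)).
  have : 0 < (1 - derive1 phi t ^+ 2) * phi t ^+ 2 * (dot c c * dot e e).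
    by rewrite !mulr_gt0 ?exprn_gt0 ?dot_gt0.
  congr (is_true (0 < _)); rewrite curv_N0_vec /= (dotC e) ce.
  by move: (mass_term _ _) (derive1 _ _) (phi _) => ? ? ?; ring.
have [a1 [b1 [c1 [a2 [b2 [c2 [yc1 yc2 notm]]]]]]] :=
  exists_not_multiple c0 yc (erefl nu) nu0.
set nu1 := al _ _ in notm.
have cs j : exists ce : 'rV[R]_(d j).+1 * 'rV[R]_(d j).+1,
    [/\ ce.1 != 0, ce.2 != 0, dot (sphere_part p j) ce.1 = 0,
       dot (sphere_part p j) ce.2 = 0 & dot ce.1 ce.2 = 0].
  have d3 : (2 < (d j).+1)%N by rewrite ltnS.
  have [f [? ? _]] := exists_orthogonal2 (sphere_part p j) (sphere_part p j) d3.
  have [g [? ? ?]] := exists_orthogonal2 (sphere_part p j) f d3.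
  by exists (f, g).
pose f j := (sval (cid (cs j))).1; pose g j := (sval (cid (cs j))).2.
have fg j : [/\ f j != 0, g j != 0, dot (sphere_part p j) (f j) = 0,
       dot (sphere_part p j) (g j) = 0 & dot (f j) (g j) = 0].
  exact: (svalP (cid (cs j))).
have zf j : dot (sphere_part p j) (f j) = 0 by case: (fg j).
have zg j : dot (sphere_part p j) (g j) = 0 by case: (fg j).
pose om j := al (sphere_single f j) (sphere_single f j).
have om0 j : om j != 0.
  apply: (second_fundamental_form_neq0 (sphere_single_tangent j zf) (sphere_single_tangent j zg)).
  have [f1 g1 _ _ fg0] := fg j.
  by rewrite curv_sphere_single fg0 expr0n subr0 divr_gt0 ?mulr_gt0 ?dot_gt0 ?exprn_gt0.
(* Planes mixing two factors are flat and alpha vanishes on mixed pairs, so Gauss's equation reduces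
   to the product of the values on the two factors. *)
have orth0 j a b s a' b' s' : dot y s = 0 -> dot y s' = 0 ->
    dot (al (N0_vec a b s) (N0_vec a' b' s')) (om j) = 0.
  move=> ys ys'; have := al_gauss (N0_vec_tangent a b ys) (sphere_single_tangent j zf)
    (N0_vec_tangent a' b' ys') (sphere_single_tangent j zf).
  have -> : al (N0_vec a b s) (sphere_single f j) = 0.
    by apply: (al_adapted (i := None) (j := Some j) _ (N0_vec_factor a b ys)
      (sphere_single_factor j zf)).
  by rewrite curv_N0_vec_sphere_single dot0l subr0.
have orth1 i j : i != j -> dot (om i) (om j) = 0.
  move=> ij; have := al_gauss (sphere_single_tangent i zf) (sphere_single_tangent j zf)
    (sphere_single_tangent i zf) (sphere_single_tangent j zf).
  have -> : al (sphere_single f i) (sphere_single f j) = 0.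
    by apply: (al_adapted (i := Some i) (j := Some j) _ (sphere_single_factor i zf)
      (sphere_single_factor j zf)).
  by rewrite curv_two_spheres // dot0l subr0.
pose V : 'M[R]_(1 + 1 + k, N) :=
  col_mx (col_mx nu nu1) (\matrix_(j, a) om j ord0 a).
have rV j : row j (\matrix_(j, a) om j ord0 a) = om j.
  by apply/rowP => a; rewrite !mxE.
(* Products with [om j] isolate the coefficients of the sphere vectors; then [notm] kills the
   coefficient of [nu1], and [nu0] that of [nu]. *)
have fV : row_free V.
  apply: inj_row_free => w; rewrite -[w]hsubmxK -[lsubmx w]hsubmxK.
  set a := lsubmx (lsubmx w); set b := rsubmx (lsubmx w); set h := rsubmx w.
  rewrite /V !mul_row_col [a]mx11_scalar [b]mx11_scalar !mul_scalar_mx.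
  rewrite [h *m _]mulmx_sum_row => E0.
  have h0 : h = 0.
    apply/rowP => j; rewrite [RHS]mxE.
    have := congr1 (fun g => dot g (om j)) E0.
    rewrite dot0l !dotDl !dotZl !orth0 // !mulr0 !add0r dot_suml (bigD1 j) //= big1.
      rewrite addr0 rV dotZl => /eqP; rewrite mulf_eq0 dot_eq0 (negbTE (om0 j)) orbF.
      by move/eqP.
    by move=> i ij; rewrite rV dotZl orth1 // mulr0.
  move: E0; rewrite h0 big1 => [|i _]; last by rewrite mxE scale0r.
  rewrite addr0 => E1.
  have b0 : b ord0 ord0 = 0.
    apply/eqP; apply: contraT => b0; case: (notm (- (b ord0 ord0)^-1 * a ord0 ord0)).
    have := congr1 (fun g => (b ord0 ord0)^-1 *: g) E1.
    rewrite scaler0 scalerDr !scalerA mulVf // scale1r => /eqP.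
    by rewrite addr_eq0 mulNr scaleNr => /eqP ->; rewrite opprK.
  have a0 : a ord0 ord0 = 0.
    move/eqP: E1; rewrite b0 scale0r addr0 scaler_eq0 (negbTE nu0) orbF => /eqP //.
  have s0 : (0 : R)%:M = 0 :> 'M[R]_1 by apply/matrixP => i j; rewrite !mxE mul0rn.
  by rewrite a0 b0 s0 !row_mx0.
(* The k + 2 independent vectors are normal, and the normal space has dimension N minus the rank of
   J. *)
have VJ : (V <= kermx J^T)%MS.
  apply/sub_kermxP; rewrite /V !mul_col_mx.
  rewrite (al_normal (N0_vec_tangent 0 0 yc) (N0_vec_tangent 0 0 yc)).
  rewrite (al_normal (N0_vec_tangent a1 b1 yc1) (N0_vec_tangent a2 b2 yc2)).
  have -> : (\matrix_(j, a) om j ord0 a) *m J^T = 0.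
    apply/row_matrixP => j; rewrite row_mul rV row0.
    exact: (al_normal (sphere_single_tangent j zf) (sphere_single_tangent j zf)).
  by rewrite !col_mx0.
have := mxrankS VJ; rewrite mxrank_ker mxrank_tr => h.
have rVk : \rank V = (1 + 1 + k)%N by exact/eqP.
rewrite rVk in h.
have := rank_leq_col J; move: rankJ h; move: (\rank J) => rk; lia.
Qed.

End AdaptedCodimension.

Lemma mulmx_dot (R : realType) (M N : nat) (v : 'rV[R]_M) (A : 'M[R]_(M, N)) (w : 'rV[R]_N) :
  (v *m A *m w^T) ord0 ord0 = \sum_i v ord0 i * dot (row i A) w.
Proof.
rewrite -mulmxA mxE; apply: eq_bigr => i _; congr (_ * _).
by rewrite mxE; apply: eq_bigr => j _; rewrite !mxE.
Qed.

Lemma trace_part (R : realType) (M N : nat) (pi : 'rV[R]_M -> 'rV[R]_N) :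
  (forall i, exists l, forall v, pi v ord0 i = v ord0 l) ->
  \sum_i dot (pi (delta_mx ord0 i)) (pi (delta_mx ord0 i)) = N%:R.
Proof.
move=> hpi; rewrite exchange_big /= -[N in RHS]card_ord -sumr_const.
apply: eq_bigr => l _; have [m hm] := hpi l.
rewrite (bigD1 m) //= big1 => [|i im].
  by rewrite hm mxE !eqxx mulr1 addr0.
by rewrite hm mxE [_ == i]eq_sym (negbTE im) andbF mulr0.
Qed.

Lemma linear_mulmx (R : realType) (M N : nat) (f : 'rV[R]_M -> 'rV[R]_N) :
  (forall c u v, f (c *: u + v) = c *: f u + f v) ->
  forall v, f v = v *m \matrix_(i, l) f (delta_mx ord0 i) ord0 l.
Proof.
move=> fL v; have f0 : f 0 = 0.
  by have := fL (-1) 0 0; rewrite scaler0 addr0 scaleN1r addNr.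
rewrite mulmx_sum_row {1}(row_sum_delta v).
elim/big_rec2: _ => // i a b _ IH.
rewrite fL IH; congr (_ *: _ + _).
by apply/rowP => l; rewrite !mxE.
Qed.

(** * The Ricci operator *)

Section Frame.
Variables (R : realType) (n k : nat) (d : 'I_k -> nat) (r : 'I_k -> R).
Variable (phi : R -> R).
Hypothesis hn : (4 <= n)%N.
Hypothesis hd : forall j, (2 <= d j)%N.
Hypothesis hr : forall j, 0 < r j.
Hypothesis hphi : ST_profile n phi.
Notation E := 'rV[R]_(2 + n.-1 + \sum_(j < k) (d j).+1).
Variable p : E.
Hypothesis Wp : W_set r p.
Hypothesis xp : L0_part p != 0.
Local Notation co := (coef_of p).
Local Notation x := (L0_part p).
Local Notation y := (fiber_part p).
Local Notation t := (enorm x).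
Local Notation p0 := (phi t).
Local Notation p1 := (derive1 phi t).
Implicit Types (u v w z : E).

(* The rows sharp delta_l form a Parseval frame of T_p W, that is,
   sum_l <u, sharp delta_l> sharp delta_l = u for u in T_p W. *)
Definition sharp v : E :=
  mkE ((L0_part v ord0 0 / t) *: x + (L0_part v ord0 1 / p1) *: quarter_turn x)
    (p0^-1 *: fiber_part (tangential p v))
    (sphere_part (tangential p v)).

(** The adjoint of [sharp] with respect to the metric of W ([gram_sharp]). It embeds T_p W
    isometrically into E, and [sharp] is a left inverse there ([sharp_flat]). *)
Definition flat u : E :=
  mkE (\row_(i < 2) (if i == 0 then (co u).1.1 * t else (co u).1.2 * p1))
    (p0 *: fiber_part u) (sphere_part u).

Definition fiber_form v w := dot (fiber_part (tangential p v)) (fiber_part (tangential p w)).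
Definition sphere_form j v w :=
  dot (sphere_part (tangential p v) j) (sphere_part (tangential p w) j).

Let nzp : nonzero_parts p := W_nonzero hr Wp.

Lemma t_neq0 : t != 0. Proof. by rewrite gt_eqF // enorm_gt0. Qed.
Lemma p0_neq0 : p0 != 0.
Proof. by rewrite gt_eqF // (profile_gt0 hn hphi) // enorm_gt0. Qed.
Lemma p1_neq0 : p1 != 0.
Proof. by rewrite gt_eqF // (ST_increasing hphi) // enorm_gt0. Qed.

Lemma tangential_linear c u v :
  tangential p (c *: u + v) = c *: tangential p u + tangential p v.
Proof.
have L N (a b b' : 'rV[R]_N) (s : R) : s *: b + b' - (dot a (s *: b + b') / dot a a) *: a =
    s *: (b - (dot a b / dot a a) *: a) + (b' - (dot a b' / dot a a) *: a).
  rewrite dotDr dotZr mulrDl scalerDl -mulrA -scalerA scalerBr.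
  by rewrite addrACA -opprD.
by apply: partsP => [||j]; rewrite !partE // L.
Qed.

Lemma L0_sharp v : L0_part (sharp v) =
  (L0_part v ord0 0 / t) *: x + (L0_part v ord0 1 / p1) *: quarter_turn x.
Proof. exact: L0_mkE. Qed.
Lemma fiber_sharp v : fiber_part (sharp v) = p0^-1 *: fiber_part (tangential p v).
Proof. exact: fiber_mkE. Qed.
Lemma sphere_sharp v j : sphere_part (sharp v) j = sphere_part (tangential p v) j.
Proof. exact: sphere_mkE. Qed.
Lemma L0_flat u : L0_part (flat u) =
  \row_(i < 2) (if i == 0 then (co u).1.1 * t else (co u).1.2 * p1).
Proof. exact: L0_mkE. Qed.
Lemma fiber_flat u : fiber_part (flat u) = p0 *: fiber_part u.
Proof. exact: fiber_mkE. Qed.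
Lemma sphere_flat u j : sphere_part (flat u) j = sphere_part u j.
Proof. exact: sphere_mkE. Qed.

Lemma sharp_linear c u v : sharp (c *: u + v) = c *: sharp u + sharp v.
Proof.
apply: partsP => [||j].
- rewrite L0_partD L0_partZ !L0_sharp L0_partD L0_partZ !mxE.
  rewrite scalerDr !scalerA !mulrDl !scalerDl addrACA.
  by congr (_ + _ + (_ + _)); rewrite -!mulrA.
- rewrite fiber_partD fiber_partZ !fiber_sharp tangential_linear.
  by rewrite fiber_partD fiber_partZ scalerDr !scalerA mulrC.
- rewrite sphere_partD sphere_partZ !sphere_sharp tangential_linear.
  by rewrite sphere_partD sphere_partZ.
Qed.

Lemma sharp_tangent v : W_tangent p (sharp v).
Proof.
have [tf ts] := tangential_tangent v nzp.
by split=> [|j]; rewrite ?fiber_sharp ?sphere_sharp ?dotZr ?tf ?mulr0 ?ts.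
Qed.

Lemma flat_tangent u : W_tangent p u -> W_tangent p (flat u).
Proof.
by case=> fu su; split=> [|j]; rewrite ?fiber_flat ?sphere_flat ?dotZr ?fu ?mulr0 ?su.
Qed.

Lemma sharp_flat u : W_tangent p u -> sharp (flat u) = u.
Proof.
move=> tu; have tF := tangential_id (flat_tangent tu).
apply: partsP => [||j].
- rewrite L0_sharp L0_flat !mxE /= !mulfK ?t_neq0 ?p1_neq0 //.
  by rewrite -(L0_fld (co u)) fld_coef_of.
- by rewrite fiber_sharp tF fiber_flat scalerA mulVf ?scale1r // p0_neq0.
- by rewrite sphere_sharp tF sphere_flat.
Qed.

Lemma co_sharp v : (co (sharp v)).1 = (L0_part v ord0 0 / t, L0_part v ord0 1 / p1).
Proof.
have x0 : dot x x != 0 by rewrite dot_eq0.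
rewrite /coef_of /= L0_sharp !dotDr !dotZr dot_quarter_turn dot_quarter_turn2.
by rewrite (dotC (quarter_turn _)) dot_quarter_turn !mulr0 addr0 add0r !mulfK.
Qed.

Lemma fdot_sharp v w : fdot (co (sharp v)) (co (sharp w)) = fiber_form v w / p0 ^+ 2.
Proof.
rewrite /fdot /= !fiber_sharp dotZl dotZr mulrA -expr2 exprVn mulrC //.
Qed.

Lemma sdot_sharp v w j : sdot (co (sharp v)) (co (sharp w)) j = sphere_form j v w.
Proof. by rewrite /sdot /= !sphere_sharp. Qed.

Local Notation e0 v := (L0_part v ord0 0).
Local Notation e1 v := (L0_part v ord0 1).

Lemma curv_sharp v1 v2 v3 v4 :
  curv r phi p (co (sharp v1)) (co (sharp v2)) (co (sharp v3)) (co (sharp v4)) =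
  (n - 2)%:R * mass_term phi p *
    ((e0 v1 * e1 v2 - e1 v1 * e0 v2) * (e0 v3 * e1 v4 - e1 v3 * e0 v4))
  - mass_term phi p *
   ((e0 v1 * e0 v3 + e1 v1 * e1 v3) * fiber_form v2 v4
    + (e0 v2 * e0 v4 + e1 v2 * e1 v4) * fiber_form v1 v3
    - (e0 v1 * e0 v4 + e1 v1 * e1 v4) * fiber_form v2 v3
    - (e0 v2 * e0 v3 + e1 v2 * e1 v3) * fiber_form v1 v4)
  + (1 - p1 ^+ 2) / p0 ^+ 2 *
    (fiber_form v1 v3 * fiber_form v2 v4 - fiber_form v1 v4 * fiber_form v2 v3)
  + \sum_j (sphere_form j v1 v3 * sphere_form j v2 v4
      - sphere_form j v1 v4 * sphere_form j v2 v3) / r j ^+ 2.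
Proof.
rewrite /curv; congr (_ + _); last by apply: eq_bigr => j _; rewrite !sdot_sharp.
rewrite !co_sharp !fdot_sharp /=.
have := t_neq0; have := p0_neq0; have := p1_neq0.
move: (mass_term _ _) (fiber_form v1 v3) (fiber_form v1 v4) (fiber_form v2 v3) (fiber_form v2 v4)
  => m f13 f14 f23 f24.
move: t p0 p1 => T P0 P1 h1 h0 hT; field.
by rewrite h1 h0 hT.
Qed.

Let M := (2 + n.-1 + \sum_(j < k) (d j).+1)%N.
Local Notation dl i := (delta_mx ord0 i : E).

Lemma parseval u v : \sum_i dot u (dl i) * dot v (dl i) = dot u v.
Proof. by apply: eq_bigr => i _; rewrite !(dotC _ (dl i)) !dot_delta. Qed.

Lemma dot_mkE a b (c : forall j, 'rV[R]_(d j).+1) v : dot (mkE a b c) v =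
  dot a (L0_part v) + dot b (fiber_part v) + \sum_j dot (c j) (sphere_part v j).
Proof.
rewrite dot_parts L0_mkE fiber_mkE; congr (_ + _); apply: eq_bigr => j _.
by rewrite sphere_mkE.
Qed.

Lemma fiber_tangential v : fiber_part (tangential p v) =
  fiber_part v - (dot y (fiber_part v) / dot y y) *: y.
Proof. exact: fiber_mkE. Qed.

Lemma sphere_tangential v j : sphere_part (tangential p v) j =
  sphere_part v j - (dot (sphere_part p j) (sphere_part v j)
    / dot (sphere_part p j) (sphere_part p j)) *: sphere_part p j.
Proof. exact: (sphere_mkE (L0_part v)). Qed.

Lemma dot_L0_vec a v : dot (mkE a 0 (fun=> 0)) v = dot a (L0_part v).
Proof. by rewrite dot_mkE dot0l big1 ?addr0 // => j _; rewrite dot0l. Qed.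

Lemma dot_fiber_vec b v : dot (mkE 0 b (fun=> 0)) v = dot b (fiber_part v).
Proof. by rewrite dot_mkE dot0l add0r big1 ?addr0 // => j _; rewrite dot0l. Qed.

Lemma dot_sphere_vec (c : forall j, 'rV[R]_(d j).+1) j v :
  dot (mkE 0 0 (fun j' => (j' == j)%:R *: c j')) v = dot (c j) (sphere_part v j).
Proof.
rewrite dot_mkE !dot0l !add0r (bigD1 j) //= big1 ?addr0 ?eqxx ?scale1r //.
by move=> j' jj'; rewrite (negbTE jj') scale0r dot0l.
Qed.

Lemma e0_dot v : e0 v = dot (mkE (delta_mx ord0 0) 0 (fun=> 0)) v.
Proof. by rewrite dot_L0_vec dot_delta. Qed.

Lemma e1_dot v : e1 v = dot (mkE (delta_mx ord0 1) 0 (fun=> 0)) v.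
Proof. by rewrite dot_L0_vec dot_delta. Qed.

Definition fiber_vec w : E := mkE 0 (fiber_part (tangential p w)) (fun=> 0).
Definition sphere_vec j w : E :=
  mkE 0 0 (fun j' => (j' == j)%:R *: sphere_part (tangential p w) j').

Lemma fiber_form_dot w v : fiber_form w v = dot (fiber_vec w) v.
Proof.
have [tf _] := tangential_tangent w nzp.
rewrite dot_fiber_vec /fiber_form (fiber_tangential v) dotBr dotZr.
by rewrite (dotC _ y) tf mulr0 subr0.
Qed.

Lemma sphere_form_dot j w v : sphere_form j w v = dot (sphere_vec j w) v.
Proof.
have [_ ts] := tangential_tangent w nzp.
rewrite /sphere_vec (dot_sphere_vec (sphere_part (tangential p w))).
rewrite /sphere_form (sphere_tangential v) dotBr dotZr.
by rewrite (dotC _ (sphere_part p j)) ts mulr0 subr0.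
Qed.

Lemma fiber_formC v w : fiber_form v w = fiber_form w v. Proof. exact: dotC. Qed.
Lemma sphere_formC j v w : sphere_form j v w = sphere_form j w v. Proof. exact: dotC. Qed.

Lemma fiber_form_vec v w : dot (fiber_vec v) (fiber_vec w) = fiber_form v w.
Proof. by rewrite dot_fiber_vec /fiber_vec fiber_mkE. Qed.

Lemma sphere_form_vec j v w : dot (sphere_vec j v) (sphere_vec j w) = sphere_form j v w.
Proof.
rewrite {1}/sphere_vec (dot_sphere_vec (sphere_part (tangential p v))).
by rewrite /sphere_vec sphere_mkE eqxx scale1r.
Qed.

Lemma e_fiber_vec (a : 'rV[R]_2) w : dot (mkE a 0 (fun=> 0)) (fiber_vec w) = 0.
Proof. by rewrite dot_L0_vec /fiber_vec L0_mkE dot0r. Qed.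

Lemma e_e_dot (a b : 'rV[R]_2) : dot (mkE a 0 (fun=> 0)) (mkE b 0 (fun=> 0) : E) = dot a b.
Proof. by rewrite dot_L0_vec L0_mkE. Qed.

(** The trace of the orthogonal projection of R^(n-1) onto the hyperplane orthogonal to [y]. *)
Lemma trace_fiber_form : \sum_i fiber_form (dl i) (dl i) = (n - 2)%:R.
Proof.
have yy := fiber_unit Wp.
transitivity (\sum_i (dot (fiber_part (dl i)) (fiber_part (dl i)) -
   dot (mkE 0 y (fun=> 0)) (dl i) * dot (mkE 0 y (fun=> 0)) (dl i))).
  apply: eq_bigr => i _; rewrite !dot_fiber_vec.
  rewrite /fiber_form !fiber_tangential yy !divr1 dotBl !dotBr !dotZl !dotZr yy.
  by rewrite (dotC _ y); ring.
rewrite sumrB (trace_part (@fiber_coord R n k d)) parseval dot_fiber_vec fiber_mkE yy.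
have -> : (n - 2)%:R = (n.-1)%:R - 1%:R :> R.
  rewrite -natrB; first by congr (_%:R); lia.
  by rewrite -ltnS prednK // (leq_trans _ hn).
by [].
Qed.

Lemma trace_sphere_form j : \sum_i sphere_form j (dl i) (dl i) = (d j)%:R.
Proof.
have zz := sphere_radius Wp j; set z := sphere_part p j in zz.
have r0 : r j ^+ 2 != 0 by rewrite expf_neq0 // gt_eqF.
pose zv : E := mkE 0 0 (fun j' => (j' == j)%:R *: sphere_part p j').
have dz v : dot zv v = dot z (sphere_part v j) by exact: (dot_sphere_vec (sphere_part p)).
transitivity (\sum_i (dot (sphere_part (dl i) j) (sphere_part (dl i) j) -
   (r j ^+ 2)^-1 * (dot zv (dl i) * dot zv (dl i)))).
  apply: eq_bigr => i _; rewrite !dz.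
  rewrite /sphere_form !sphere_tangential zz dotBl !dotBr !dotZl !dotZr zz.
  by rewrite (dotC _ z); field; rewrite gt_eqF.
rewrite sumrB (trace_part (@sphere_coord R n k d j)) -mulr_sumr parseval dz.
rewrite /zv sphere_mkE eqxx scale1r zz mulVf //.
by rewrite -natr1 addrK.
Qed.

(** Summation over a Parseval frame gives the Ricci curvature. Each sum is a product of fixed
    vectors, by [parseval], or one of the two traces above. *)
Lemma ricci_trace v w : \sum_i curv r phi p (co (sharp (dl i))) (co (sharp v))
    (co (sharp (dl i))) (co (sharp w)) =
  \sum_j ((d j)%:R - 1) / r j ^+ 2 * sphere_form j v w.
Proof.
pose E0 : E := mkE (delta_mx ord0 0) 0 (fun=> 0).
pose E1 : E := mkE (delta_mx ord0 1) 0 (fun=> 0).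
have d2 (i : 'I_2) : dot (delta_mx ord0 i) (delta_mx ord0 i) = 1 :> R.
  by rewrite dot_delta mxE !eqxx.
have s00 : dot E0 E0 = 1 by rewrite e_e_dot d2.
have s11 : dot E1 E1 = 1 by rewrite e_e_dot d2.
have s01 : dot E0 E1 = 0 by rewrite e_e_dot dot_delta mxE.
have f0 u : dot E0 (fiber_vec u) = 0 by exact: e_fiber_vec.
have f1 u : dot E1 (fiber_vec u) = 0 by exact: e_fiber_vec.
set m := mass_term phi p; set q := (1 - p1 ^+ 2) / p0 ^+ 2.
pose A i := dot E0 (dl i); pose B i := dot E1 (dl i).
pose fv i := dot (fiber_vec v) (dl i); pose fw i := dot (fiber_vec w) (dl i).
pose sv' j i := dot (sphere_vec j v) (dl i); pose sw' j i := dot (sphere_vec j w) (dl i).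
transitivity (\sum_i (
    (n - 2)%:R * m * (e1 v * e1 w) * (A i * A i) - (n - 2)%:R * m * (e1 v * e0 w) * (A i * B i)
    - (n - 2)%:R * m * (e0 v * e1 w) * (A i * B i) + (n - 2)%:R * m * (e0 v * e0 w) * (B i * B i)
    - m * fiber_form v w * (A i * A i) - m * fiber_form v w * (B i * B i)
    - m * (e0 v * e0 w + e1 v * e1 w) * fiber_form (dl i) (dl i)
    + m * e0 w * (A i * fv i) + m * e1 w * (B i * fv i)
    + m * e0 v * (A i * fw i) + m * e1 v * (B i * fw i)
    + q * fiber_form v w * fiber_form (dl i) (dl i) - q * (fw i * fv i)
    + \sum_j (sphere_form j (dl i) (dl i) * sphere_form j v w - sw' j i * sv' j i) / r j ^+ 2)).
  apply: eq_bigr => i _; rewrite curv_sharp -/m -/q.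
  rewrite (fiber_formC (dl i) w) !(fiber_form_dot _ (dl i)) (e0_dot (dl i)) (e1_dot (dl i)).
  rewrite -/(A i) -/(B i) -/(fv i) -/(fw i); congr (_ + _).
    move: (dot (fiber_vec (dl i)) (dl i)) => D; ring.
  by apply: eq_bigr => j _; rewrite (sphere_formC j (dl i) w) !(sphere_form_dot j _ (dl i)).
rewrite !(big_split, sumrB) /= -!mulr_sumr !sumrN -!mulr_sumr.
have -> : \sum_i A i * A i = 1 by rewrite parseval.
have -> : \sum_i B i * B i = 1 by rewrite parseval.
have -> : \sum_i A i * B i = 0 by rewrite parseval.
have -> : \sum_i A i * fv i = 0 by rewrite parseval.
have -> : \sum_i B i * fv i = 0 by rewrite parseval.
have -> : \sum_i A i * fw i = 0 by rewrite parseval.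
have -> : \sum_i B i * fw i = 0 by rewrite parseval.
have -> : \sum_i fw i * fv i = fiber_form v w.
  by rewrite parseval fiber_form_vec fiber_formC.
rewrite trace_fiber_form exchange_big /=.
have -> : \sum_(j < k) \sum_i (sphere_form j (dl i) (dl i) * sphere_form j v w
    - sw' j i * sv' j i) / r j ^+ 2 =
    \sum_j ((d j)%:R - 1) / r j ^+ 2 * sphere_form j v w.
  apply: eq_bigr => j _; rewrite -mulr_suml sumrB -mulr_suml trace_sphere_form.
  have -> : \sum_i sw' j i * sv' j i = sphere_form j v w.
    by rewrite parseval sphere_form_vec sphere_formC.
  by rewrite [RHS]mulrAC; congr (_ / _); rewrite mulrBl mul1r.
(* What is left is the Ricci curvature of N_0: its coefficients are (n - 2) m - (n - 2) m on L_0 and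
   (n - 3) q - 2 m on the fiber, and m = (n - 3) q / 2. *)
rewrite -[RHS]add0r; congr (_ + _).
have m2 : (n - 2)%:R = (n - 3)%:R + 1 :> R.
  by rewrite -[X in _ + X]/(1%:R) -natrD addn1 -subSn // (leq_trans _ hn).
rewrite m2 /q /m /mass_term; have := p0_neq0.
move: (e0 v) (e1 v) (e0 w) (e1 w) (fiber_form v w) ((n - 3)%:R) => v0 v1 w0 w1 f m' h.
by move: p1 p0 h => P1 P0 h; field.
Qed.

(** * Commuting shape operators preserve the factors *)

Section AdaptedOfCommuting.
Variables (N : nat) (al : E -> E -> 'rV[R]_N).
Variable H : 'I_N -> 'M[R]_(2 + n.-1 + \sum_(j < k) (d j).+1).
Hypothesis al_gauss : forall u v w z, W_tangent p u -> W_tangent p v ->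
  W_tangent p w -> W_tangent p z ->
  dot (al u w) (al v z) - dot (al u z) (al v w) =
  curv r phi p (co u) (co v) (co w) (co z).
Hypothesis alC : forall u v, W_tangent p u -> W_tangent p v -> al u v = al v u.
Hypothesis al_bilin : forall u v, W_tangent p u -> W_tangent p v ->
  forall a, al u v ord0 a = (u *m H a *m v^T) ord0 ord0.
Hypothesis al_comm : forall u v, W_tangent p u -> W_tangent p v -> forall a b,
  \sum_i al v (sharp (dl i)) ord0 a * al u (sharp (dl i)) ord0 b =
  \sum_i al u (sharp (dl i)) ord0 a * al v (sharp (dl i)) ord0 b.
Hypothesis rho_inj : forall i j, i != j ->
  ((d i)%:R - 1) / r i ^+ 2 != ((d j)%:R - 1) / r j ^+ 2.

Let Sh : 'M[R]_M := \matrix_(i, l) sharp (dl i) ord0 l.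
(** The index runs over ambient coordinates, not over a normal frame: for the second fundamental
    form this is the shape operator of the normal part of the a-th basis vector, in the redundant
    frame. *)
Let A a : 'M[R]_M := \matrix_(i, l) al (sharp (dl i)) (sharp (dl l)) ord0 a.
Let Ric : 'M[R]_M := \matrix_(i, l)
  \sum_j ((d j)%:R - 1) / r j ^+ 2 * sphere_form j (dl i) (dl l).

Lemma sharp_mulmx v : sharp v = v *m Sh.
Proof.
exact: (linear_mulmx sharp_linear).
Qed.

Lemma sff_matrix_comm a b : A a *m A b = A b *m A a.
Proof.
apply/matrixP => i l; rewrite !mxE.
have ti := sharp_tangent (dl i); have tl := sharp_tangent (dl l).
transitivity (\sum_m al (sharp (dl i)) (sharp (dl m)) ord0 a * al (sharp (dl l)) (sharp (dl m))
  ord0 b).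
  by apply: eq_bigr => m _; rewrite !mxE (alC (sharp_tangent (dl m)) tl).
rewrite (al_comm tl ti); apply: eq_bigr => m _.
by rewrite !mxE mulrC (alC tl (sharp_tangent (dl m))).
Qed.

(** The trace of Gauss's equation over the frame. *)
Lemma ricci_matrix : \sum_a (\tr (A a) *: A a - A a *m A a) = Ric.
Proof.
apply/matrixP => i l; rewrite summxE mxE -ricci_trace.
have ti := sharp_tangent (dl i); have tl := sharp_tangent (dl l).
transitivity (\sum_a \sum_m (al (sharp (dl m)) (sharp (dl m)) ord0 a * al (sharp (dl i))
  (sharp (dl l)) ord0 a
   - al (sharp (dl m)) (sharp (dl l)) ord0 a * al (sharp (dl i)) (sharp (dl m)) ord0 a)).
  apply: eq_bigr => a _; rewrite !mxE sumrB mulr_suml; congr (_ - _).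
    by apply: eq_bigr => m _; rewrite mxE.
  by apply: eq_bigr => m _; rewrite !mxE mulrC.
rewrite exchange_big; apply: eq_bigr => m _ /=.
have tm := sharp_tangent (dl m).
by rewrite -(al_gauss tm ti tm tl) sumrB.
Qed.

Lemma ricci_comm a : Ric *m A a = A a *m Ric.
Proof.
rewrite -ricci_matrix mulmx_suml mulmx_sumr; apply: eq_bigr => b _.
rewrite mulmxBl mulmxBr -scalemxAl -scalemxAr sff_matrix_comm; congr (_ - _).
by rewrite -mulmxA -sff_matrix_comm !mulmxA sff_matrix_comm.
Qed.

Definition rho (o : option 'I_k) : R :=
  if o is Some j then ((d j)%:R - 1) / r j ^+ 2 else 0.

Lemma rho_neq i j : i != j -> rho i != rho j.
Proof.
have pos l : 0 < ((d l)%:R - 1) / r l ^+ 2.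
  by rewrite divr_gt0 ?exprn_gt0 // subr_gt0 ltr1n.
case: i j => [i|] [j|] //= ij.
- exact: rho_inj.
- by rewrite gt_eqF.
- by rewrite lt_eqF.
Qed.

Lemma factor_sphere_part o u j : factor_tangent o p u -> Some j != o ->
  sphere_part u j = 0.
Proof.
case: o => [i|] /=; last by case.
by case=> _ _ _ h ij; apply: h.
Qed.

Lemma factor_W o u : factor_tangent o p u -> W_tangent p u.
Proof. by case: o => [i|] /=; case. Qed.

Lemma factor_L0 j u : factor_tangent (Some j) p u -> L0_part u = 0 /\ fiber_part u = 0.
Proof. by case. Qed.

Lemma L0_sphere_vec j w : L0_part (sphere_vec j w) = 0.
Proof. exact: L0_mkE. Qed.
Lemma fiber_sphere_vec j w : fiber_part (sphere_vec j w) = 0.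
Proof. exact: fiber_mkE. Qed.
Lemma sphere_sphere_vec j w j' : sphere_part (sphere_vec j w) j' =
  (j' == j)%:R *: sphere_part (tangential p w) j'.
Proof. exact: (sphere_mkE (0 : 'rV_2) (0 : 'rV_n.-1)). Qed.

(** [Ric] is the sum of the projections onto the sphere factors weighted by the rho_j: they all kill
    a vector of N_0, and only the j-th one sees a vector of the j-th sphere, which it fixes. *)
Lemma flat_ricci o u : factor_tangent o p u -> flat u *m Ric = rho o *: flat u.
Proof.
move=> fu; have tu := factor_W fu; have tF := tangential_id (flat_tangent tu).
have R1 l : (flat u *m Ric) ord0 l =
    \sum_j ((d j)%:R - 1) / r j ^+ 2 * dot (sphere_vec j (flat u)) (dl l).
  rewrite mxE.
  transitivity (\sum_i \sum_j flat u ord0 i * (((d j)%:R - 1) / r j ^+ 2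
     * sphere_form j (dl l) (dl i))).
    apply: eq_bigr => i _; rewrite mxE mulr_sumr; apply: eq_bigr => j _.
    by rewrite sphere_formC.
  rewrite exchange_big; apply: eq_bigr => j _ /=.
  rewrite -sphere_form_dot sphere_formC sphere_form_dot {1}/dot mulr_sumr.
  by apply: eq_bigr => i _; rewrite sphere_form_dot (dotC _ (dl i)) dot_delta; ring.
have sv0 j : Some j != o -> sphere_vec j (flat u) = 0.
  move=> jo; apply: partsP => [||j'];
    rewrite ?L0_sphere_vec ?fiber_sphere_vec ?sphere_sphere_vec.
  - by apply/rowP => i; rewrite !mxE.
  - by apply/rowP => i; rewrite !mxE.
  - have -> : sphere_part (0 : E) j' = 0 by apply/rowP => i; rewrite !mxE.
    case: eqP => [->|_]; last by rewrite scale0r.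
    by rewrite tF sphere_flat (factor_sphere_part fu jo) scaler0.
case: o fu sv0 => [j|] fu sv0 /=; last first.
  apply/rowP => l; rewrite R1 scale0r [RHS]mxE [LHS]big1 // => j _.
  by rewrite sv0 // dot0l mulr0.
have fv : sphere_vec j (flat u) = flat u.
  have [L0u fu0] := factor_L0 fu.
  apply: partsP => [||j'];
    rewrite ?L0_sphere_vec ?fiber_sphere_vec ?sphere_sphere_vec.
  - rewrite L0_flat /coef_of /= L0u !dot0r !mul0r.
    by apply/rowP => i; rewrite !mxE; case: ifP.
  - by rewrite fiber_flat fu0 scaler0.
  - rewrite tF sphere_flat; case: (eqVneq j' j) => [->|jj']; first by rewrite scale1r.
    by rewrite scale0r (factor_sphere_part (o := Some j) fu).
apply/rowP => l; rewrite R1 (bigD1 j) //= [X in _ + X]big1 => [|i ij]; last first.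
  by rewrite sv0 ?dot0l ?mulr0.
by rewrite addr0 fv dotC dot_delta mxE.
Qed.

Lemma ricci_sym : Ric^T = Ric.
Proof.
apply/matrixP => i l; rewrite !mxE; apply: eq_bigr => j _.
by rewrite sphere_formC.
Qed.

(** Letting [Ric] act on either side of [A a] multiplies the a-th coordinate of alpha(u, v) by rho_i
    or by rho_j; these differ. *)
Lemma adapted_of_commuting i j u v : i != j ->
  factor_tangent i p u -> factor_tangent j p v -> al u v = 0.
Proof.
move=> ij fu fv; have tu := factor_W fu; have tv := factor_W fv.
apply/rowP => a; rewrite [RHS]mxE.
have AE : A a = Sh *m H a *m Sh^T.
  apply/matrixP => l m; rewrite [LHS]mxE.
  rewrite (al_bilin (sharp_tangent (dl l)) (sharp_tangent (dl m))) !sharp_mulmx.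
  rewrite trmx_mul trmx_delta !mulmxA -(mulmxA (dl l)) -(mulmxA (dl l)) -rowE.
  by rewrite -colE !mxE.
have E1 : al u v ord0 a = (flat u *m A a *m (flat v)^T) ord0 ord0.
  rewrite (al_bilin tu tv) -{1}(sharp_flat tu) -{1}(sharp_flat tv) !sharp_mulmx AE.
  by rewrite trmx_mul !mulmxA.
have E2 : rho i * al u v ord0 a = rho j * al u v ord0 a.
  transitivity ((flat u *m Ric *m A a *m (flat v)^T) ord0 ord0).
    by rewrite (flat_ricci fu) -!scalemxAl mxE E1.
  rewrite -(mulmxA (flat u)) ricci_comm mulmxA -(mulmxA _ Ric).
  have -> : Ric *m (flat v)^T = (flat v *m Ric)^T by rewrite trmx_mul ricci_sym.
  by rewrite (flat_ricci fv) linearZ -scalemxAr mxE E1.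
have /eqP : (rho i - rho j) * al u v ord0 a = 0 by rewrite mulrBl E2 subrr.
by rewrite mulf_eq0 subr_eq0 (negbTE (rho_neq ij)) /= => /eqP.
Qed.

End AdaptedOfCommuting.
End Frame.

(** The diagonal entries of K^T K are the squared norms of the columns of K. *)
Lemma trmx_mul_eq0 (R : realType) (m N : nat) (K : 'M[R]_(m, N)) :
  K^T *m K = 0 -> K = 0.
Proof.
move=> KK; apply/matrixP => i a; rewrite [RHS]mxE.
have /eqP := congr1 (fun A : 'M[R]_N => A a a) KK.
rewrite !mxE psumr_eq0 => [/allP h|j _]; last by rewrite mxE -expr2 sqr_ge0.
by have := h i (mem_index_enum i); rewrite /= mxE mulf_eq0 orbb => /eqP.
Qed.

(** * Flat normal bundles *)

Section NormalProjector.
Variables (R : realType) (n k : nat) (d : 'I_k -> nat) (r : 'I_k -> R).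
Variable (phi : R -> R).
Hypothesis hn : (4 <= n)%N.
Hypothesis hr : forall j, 0 < r j.
Hypothesis hphi : ST_profile n phi.
Notation E := 'rV[R]_(2 + n.-1 + \sum_(j < k) (d j).+1).
Variables (N : nat) (U : set E) (Phi : E -> 'rV[R]_N).
Hypothesis hI : local_isometric_immersion r phi U Phi.
Local Notation F := (Phi \o retr r).
Local Notation Om := (retr r @^-1` U).
Local Notation jac := (jacobian F).
Implicit Types (p q u v w : E).

Let oO : open Om := dom_open hr hI.

Definition ext_gram q := jac q *m (jac q)^T + (radial_mx q)^T *m radial_mx q.

(* The matrix of the orthogonal projection onto the normal space. The radial
   rows make the Gram matrix of the redundant frame dF(e_i) invertible without
   changing the result, as dF kills them. *)
Definition normal_mx q : 'M[R]_N := 1%:M - (jac q)^T *m invmx (ext_gram q) *m jac q.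

Lemma jac_radial q i : Om q -> radial (unlift ord0 i) q *m jac q = 0.
Proof.
move=> Oq; rewrite -deriveEjacobian ?derive_radial //.
exact: (F_differentiable hI Oq).
Qed.

Lemma radial_jac q : Om q -> radial_mx q *m jac q = 0.
Proof.
move=> Oq; apply/row_matrixP => i; rewrite row_mul row_radial_mx row0.
exact: jac_radial.
Qed.

(** A vector of the kernel is killed by dF, hence radial, and is orthogonal to all radial vectors,
    hence zero. *)
Lemma ext_gram_unit q : Om q -> ext_gram q \in unitmx.
Proof.
move=> Oq; have [f0 s0] := dom_nonzero hr hI Oq.
rewrite -row_free_unit; apply: inj_row_free => v vG.
have : dot (v *m jac q) (v *m jac q) + dot (v *m (radial_mx q)^T) (v *m (radial_mx q)^T) = 0.
  rewrite !dotE !trmx_mul !trmxK !mulmxA.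
  have := congr1 (fun M => (M *m v^T) ord0 ord0) vG.
  by rewrite /ext_gram mul0mx mulmxDr mulmxDl !mulmxA [LHS]mxE [RHS]mxE.
move/eqP; rewrite paddr_eq0 ?dot_ge0 // !dot_eq0 => /andP[/eqP vJ /eqP vB].
move: vJ; rewrite -deriveEjacobian; last exact: (F_differentiable hI Oq).
move=> /(immersion_ker hn hr hphi hI Oq).
rewrite tangentialE => /eqP; rewrite subr_eq0 => /eqP vE.
have rad o : dot v (radial o q) = 0.
  have /submxP[c ->] := radial_sub o q.
  by rewrite dotE trmx_mul mulmxA vB mul0mx mxE.
apply/eqP; rewrite -dot_eq0 {2}vE /radial_component dotDr dotZr rad mulr0 add0r.
rewrite dotC dot_suml big1 // => j _.
by rewrite dotZl (dotC (radial _ _)) rad mulr0.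
Qed.

Lemma ext_gram_sym q : (ext_gram q)^T = ext_gram q.
Proof. by rewrite /ext_gram linearD /= !trmx_mul !trmxK. Qed.

Lemma normal_mx_sym q : (normal_mx q)^T = normal_mx q.
Proof.
rewrite /normal_mx linearB /= trmx1 !trmx_mul trmxK trmx_inv ext_gram_sym.
by rewrite mulmxA.
Qed.

(** With J the Jacobian, P the projector and B the radial rows, K = J P has B^T as a left factor,
    and J^T B^T = 0 because dF kills radial vectors. So J^T K = 0, whence K^T K = P^T J^T K = 0. *)
Lemma jac_normal_mx q : Om q -> jac q *m normal_mx q = 0.
Proof.
move=> Oq; set K := jac q *m normal_mx q.
have KE : K = (radial_mx q)^T *m (radial_mx q *m (invmx (ext_gram q) *m jac q)).
  rewrite /K /normal_mx mulmxBr mulmx1 !mulmxA.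
  have -> : jac q *m (jac q)^T = ext_gram q - (radial_mx q)^T *m radial_mx q.
    by rewrite /ext_gram addrK.
  by rewrite !mulmxBl mulmxV ?ext_gram_unit // mul1mx opprB addrC subrK.
have JK : (jac q)^T *m K = 0.
  have JB : (jac q)^T *m (radial_mx q)^T = 0 by rewrite -trmx_mul radial_jac // trmx0.
  by rewrite KE (mulmxA (jac q)^T) JB mul0mx.
apply: trmx_mul_eq0.
by rewrite {1}/K trmx_mul -mulmxA JK mulmx0.
Qed.

Lemma normal_mx_idem q : Om q -> normal_mx q *m normal_mx q = normal_mx q.
Proof.
by move=> Oq; rewrite {1}/normal_mx mulmxBl mul1mx -(mulmxA _ (jac q)) jac_normal_mx // mulmx0
  subr0.
Qed.

Lemma derive_normal_mx q v : Om q -> 'D_v F q *m normal_mx q = 0.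
Proof.
move=> Oq; rewrite deriveEjacobian; last exact: (F_differentiable hI Oq).
by rewrite -mulmxA jac_normal_mx // mulmx0.
Qed.

(** Dilations identify the images of dF at [q] and at [retr r q]; the inverse dilation gives the
    second inclusion. *)
Lemma jac_retr_sub q : Om q -> (jac q <= jac (retr r q))%MS /\ (jac (retr r q) <= jac q)%MS.
Proof.
move=> Oq; have [f0 s0] := dom_nonzero hr hI Oq.
set a := (enorm (fiber_part q))^-1; pose b j := r j / enorm (sphere_part q j).
have a0 : 0 < a by rewrite invr_gt0 enorm_gt0.
have b0 j : 0 < b j by rewrite divr_gt0 // enorm_gt0.
have rq : retr r q = scal a b q by exact: retrE.
clearbody a b; rewrite rq.
have Oq' : Om (scal a b q).
  by apply: (dom_retr hr hI); have : U (retr r q) by []; rewrite rq.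
have dq := F_differentiable hI Oq; have dq' := F_differentiable hI Oq'.
have sub v : ('D_v F q <= jac (scal a b q))%MS.
  by rewrite (derive_scal r Phi q v a0 b0) deriveEjacobian // submxMl.
have inv : scal a^-1 (fun j => (b j)^-1) (scal a b q) = q.
  apply: partsP => [||j]; rewrite /scal ?L0_mkE ?fiber_mkE ?sphere_mkE //.
    by rewrite scalerA mulVf ?scale1r // gt_eqF.
  by rewrite scalerA mulVf ?scale1r // gt_eqF.
have a0' : 0 < a^-1 by rewrite invr_gt0.
have b0' j : 0 < (b j)^-1 by rewrite invr_gt0.
have sub' v : ('D_v F (scal a b q) <= jac q)%MS.
  have := derive_scal r Phi (scal a b q) v a0' b0'.
  by rewrite inv => ->; rewrite deriveEjacobian // submxMl.
by split; apply/row_subP => i; rewrite rowE -deriveEjacobian.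
Qed.

(** Replaces the abstract projection by an explicit matrix whose entries are smooth in [q]. *)
Lemma normal_partE q (w : 'rV[R]_N) : Om q -> normal_part r Phi (retr r q) w = w *m normal_mx q.
Proof.
move=> Oq; have [s1 s2] := jac_retr_sub Oq.
have wE : w = w *m normal_mx q + w *m ((jac q)^T *m invmx (ext_gram q) *m jac q).
  by rewrite -mulmxDr subrK mulmx1.
have P1 : w *m normal_mx q *m (jac (retr r q))^T = 0.
  have /submxP[C ->] := s2.
  rewrite trmx_mul mulmxA -(mulmxA w).
  have -> : normal_mx q *m (jac q)^T = 0.
    by rewrite -[normal_mx q]normal_mx_sym -trmx_mul jac_normal_mx // trmx0.
  by rewrite mulmx0 mul0mx.
have P2 : (w *m ((jac q)^T *m invmx (ext_gram q) *m jac q) <= jac (retr r q))%MS.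
  by apply: submx_trans s1; rewrite !mulmxA submxMl.
have := normal_projE P1 P2; rewrite -wE; exact.
Qed.

Lemma dom_smooth (f : E -> R) : smooth [set: E] f -> smooth Om f.
Proof. exact: smooth_sub. Qed.

Lemma radial_mx_smooth i l : smooth Om (fun q => radial_mx q i l).
Proof.
set o := unlift ord0 i.
have E1 q : radial_mx q i l = radial o q ord0 l by rewrite mxE.
apply: (smooth_ext oO (f := fun q => radial o q ord0 l)); first by move=> q _; rewrite E1.
case: (coord_cases R l) => [[m hm]|[m hm]|[j [m hm]]].
- apply: (smooth_ext oO (f := fun=> 0)); last exact: smooth_cst.
  by move=> q _; rewrite hm /radial L0_mkE mxE.
- apply: (smooth_ext oO (f := fun q => (o == None)%:R * fiber_part q ord0 m)).
    by move=> q _; rewrite hm /radial fiber_mkE [RHS]mxE.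
  apply: (smoothM oO); first exact: smooth_cst.
  exact/dom_smooth/part_coord_smooth/fiber_coord.
- apply: (smooth_ext oO (f := fun q => (o == Some j)%:R * sphere_part q j ord0 m)).
    by move=> q _; rewrite hm /radial sphere_mkE [RHS]mxE.
  apply: (smoothM oO); first exact: smooth_cst.
  exact/dom_smooth/(part_coord_smooth (pi := fun q => sphere_part q j))/sphere_coord.
Qed.

Lemma jac_smooth i a : smooth Om (fun q => jac q i a).
Proof.
apply: (smooth_ext oO (f := 'D_(delta_mx ord0 i) (vcomp F a))); last first.
  exact/smooth_derive/(F_comp_smooth hr hI).
move=> q Oq; have dq := F_differentiable hI Oq.
rewrite -vcomp_derive; last exact: diff_derivable.
by rewrite deriveEjacobian // -rowE mxE.
Qed.

Lemma normal_mx_smooth a b : smooth Om (fun q => normal_mx q a b).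
Proof.
have sT m1 m2 (A : E -> 'M[R]_(m1, m2)) : (forall i j, smooth Om (fun q => A q i j)) ->
    forall i j, smooth Om (fun q => (A q)^T i j).
  by move=> sA i j; apply: (smooth_ext oO (f := fun q => A q j i)) => [q _|];
    [rewrite mxE|exact: sA].
have sJ := jac_smooth; have sB := radial_mx_smooth.
have sG i j : smooth Om (fun q => ext_gram q i j).
  apply: (smooth_ext oO (f := fun q => (jac q *m (jac q)^T) i j
     + ((radial_mx q)^T *m radial_mx q) i j)); first by move=> q _; rewrite [RHS]mxE.
  apply: (smoothD oO); apply: (smooth_mulmx oO).
  - exact: sJ.
  - exact: (sT _ _ _ sJ).
  - exact: (sT _ _ _ sB).
  - exact: sB.
have sI := smooth_invmx oO ext_gram_unit sG.
apply: (smooth_ext oO (f := fun q => (1%:M : 'M[R]_N) a b -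
  ((jac q)^T *m invmx (ext_gram q) *m jac q) a b)).
  by move=> q _; rewrite [RHS]mxE [X in _ = _ + X]mxE.
apply: (smoothB oO); first exact: smooth_cst.
apply: (smooth_mulmx oO); last exact: sJ.
by apply: (smooth_mulmx oO); [exact: (sT _ _ _ sJ)|exact: sI].
Qed.

(** Projecting along a line does not depend on the length of its generator. [W_smooth] evaluates
    fields at [retr r q], which is where this is used. *)
Lemma tangential_retr q u : Om q -> tangential (retr r q) u = tangential q u.
Proof.
move=> Oq; have [f0 s0] := dom_nonzero hr hI Oq.
have inv N' (y c : 'rV[R]_N') (a : R) : y != 0 -> a != 0 ->
    (dot (a *: y) c / dot (a *: y) (a *: y)) *: (a *: y) = (dot y c / dot y y) *: y.
  rewrite -dot_eq0 => y0 a0; rewrite scalerA !dotZl !dotZr; congr (_ *: _).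
  by field; rewrite y0 a0.
rewrite retrE /tangential /scal ?fiber_mkE ?L0_mkE; congr mkE.
  by rewrite inv // invr_eq0 gt_eqF // enorm_gt0.
apply: functional_extensionality_dep => j; rewrite sphere_mkE inv //.
by rewrite mulf_eq0 invr_eq0 !gt_eqF // enorm_gt0.
Qed.

Lemma tangential_smooth u l : smooth Om (fun q => tangential q u ord0 l).
Proof.
have cc c : smooth Om (fun=> c) by exact: smooth_cst.
have aux N' (pi : E -> 'rV[R]_N') (m : 'I_N') :
    (forall i, exists l, forall u, pi u ord0 i = u ord0 l) ->
    (forall q, Om q -> pi q != 0) ->
    smooth Om (fun q => pi u ord0 m - dot (pi q) (pi u) * (dot (pi q) (pi q))^-1 * pi q ord0 m).
  move=> hpi p0; apply: (smoothB oO) => //.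
  apply: (smoothM oO); last exact/dom_smooth/part_coord_smooth.
  apply: (smoothM oO); first exact/dom_smooth/dot_part_smooth.
  apply: (smoothV oO); last exact/dom_smooth/dot_part_sq_smooth.
  by move=> q Oq; rewrite dot_eq0 p0.
case: (coord_cases R l) => [[m hm]|[m hm]|[j [m hm]]].
- apply: (smooth_ext oO (f := fun=> L0_part u ord0 m)) => // q _.
  by rewrite hm /tangential L0_mkE.
- apply: (smooth_ext oO (f := fun q => fiber_part u ord0 m - dot (fiber_part q) (fiber_part u) *
  (dot (fiber_part q) (fiber_part q))^-1 * fiber_part q ord0 m)).
    by move=> q _; rewrite hm /tangential fiber_mkE !mxE.
  by apply: aux => [|q Oq]; [exact: fiber_coord|have [] := dom_nonzero hr hI Oq].
- apply: (smooth_ext oO (f := fun q => sphere_part u j ord0 m - dot (sphere_part q j)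
  (sphere_part u j) * (dot (sphere_part q j) (sphere_part q j))^-1 * sphere_part q j ord0 m)).
    by move=> q _; rewrite hm /tangential sphere_mkE !mxE.
  by apply: (aux _ (fun q => sphere_part q j)) => [|q Oq];
    [exact: sphere_coord|have [_] := dom_nonzero hr hI Oq; apply].
Qed.

End NormalProjector.

(** * Normal curvature and the derivative of the normal projector *)

Section FlatNormalBundle.
Variables (R : realType) (n k : nat) (d : 'I_k -> nat) (r : 'I_k -> R).
Variable (phi : R -> R).
Hypothesis hn : (4 <= n)%N.
Hypothesis hr : forall j, 0 < r j.
Hypothesis hphi : ST_profile n phi.
Notation E := 'rV[R]_(2 + n.-1 + \sum_(j < k) (d j).+1).
Variables (N : nat) (U : set E) (Phi : E -> 'rV[R]_N).
Hypothesis hI : local_isometric_immersion r phi U Phi.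
Variable p : E.
Hypothesis Up : U p.
Local Notation F := (Phi \o retr r).
Local Notation Om := (retr r @^-1` U).
Local Notation NN := (normal_mx r Phi).
Local Notation al := (second_fundamental_form r Phi p).
Implicit Types (q u v w : E).

Let oO : open Om := dom_open hr hI.
Let Wp : W_set r p := dom_W hI Up.
Let Omp : Om p := dom_retr hr hI Up.
Let rp : retr r p = p := retr_id hr Wp.
Let sN := normal_mx_smooth hn hr hphi hI.
Let sF a : smooth Om (vcomp F a) := F_comp_smooth hr hI a.

Definition normal_mx_d u : 'M[R]_N := \matrix_(a, b) 'D_u (fun q => NN q a b) p.

Lemma normal_part_p (w : 'rV[R]_N) : normal_part r Phi p w = w *m NN p.
Proof. by rewrite -{1}rp (normal_partE hn hr hphi hI w Omp). Qed.

Lemma second_fundamental_form_derive u v : W_tangent p u -> al u v = 'D_u ('D_v F) p *m NN p.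
Proof.
move=> tu; rewrite /second_fundamental_form.
have -> : W_diff r (fun q => W_diff r Phi q v) p u = 'D_u ('D_v F) p.
  apply: (derive_retr_tangent hr Wp tu).
  exact: (smooth_on_differentiable (smooth_on_derive v (F_smooth hI)) Omp).
exact: normal_part_p.
Qed.

Lemma vcomp_derive_F v q a : Om q -> ('D_v F q) ord0 a = 'D_v (vcomp F a) q.
Proof. by move=> Oq; rewrite vcomp_derive //; exact/diff_derivable/(F_differentiable hI). Qed.

Lemma vcomp_derive2_F u v a : ('D_u ('D_v F) p) ord0 a = 'D_u ('D_v (vcomp F a)) p.
Proof.
rewrite vcomp_derive; last first.
  exact/diff_derivable/(smooth_on_differentiable (smooth_on_derive v (F_smooth hI)) Omp).
apply: (derive_ext oO _ _ Omp) => q Oq; exact: vcomp_derive_F.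
Qed.

Definition sff_matrix a : 'M[R]_(2 + n.-1 + \sum_(j < k) (d j).+1) :=
  \matrix_(i, j) ('D_(delta_mx ord0 i) ('D_(delta_mx ord0 j) F) p *m NN p) ord0 a.

Lemma derive2_coords (f : E -> R) u v : smooth Om f ->
  'D_u ('D_v f) p = \sum_i \sum_j u ord0 i * v ord0 j *
    'D_(delta_mx ord0 i) ('D_(delta_mx ord0 j) f) p.
Proof.
move=> sf; have sd w := smooth_derive w sf.
rewrite derive_coords; last exact: smooth_differentiable (sd v) Omp.
apply: eq_bigr => i _.
rewrite (derive_comm _ _ oO Omp sf) derive_coords; last first.
  exact: smooth_differentiable (sd _) Omp.
rewrite mulr_sumr; apply: eq_bigr => j _.
by rewrite (derive_comm (delta_mx ord0 j) _ oO Omp sf) mulrA.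
Qed.

Lemma derive2_F_coords u v a : ('D_u ('D_v F) p) ord0 a =
  \sum_i \sum_j u ord0 i * v ord0 j *
    ('D_(delta_mx ord0 i) ('D_(delta_mx ord0 j) F) p) ord0 a.
Proof.
apply: (etrans (vcomp_derive2_F u v a)).
apply: (etrans (derive2_coords u v (sF a))).
apply: eq_bigr => i _; apply: eq_bigr => j _.
exact: (congr1 (fun z => _ * z) (esym (vcomp_derive2_F _ _ a))).
Qed.

(** Bilinearity is what extends information on the frame [sharp] to all tangent vectors in
    [adapted_of_commuting]. *)
Lemma sff_bilinear u v : W_tangent p u -> W_tangent p v ->
  forall a, al u v ord0 a = (u *m sff_matrix a *m v^T) ord0 ord0.
Proof.
move=> tu tv a; rewrite (second_fundamental_form_derive v tu) mxE mulmx_dot /sff_matrix.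
pose D i j := 'D_(delta_mx ord0 i) ('D_(delta_mx ord0 j) F) p.
have -> : \sum_b 'D_u ('D_v F) p ord0 b * NN p b a =
    \sum_b (\sum_i \sum_j u ord0 i * v ord0 j * D i j ord0 b) * NN p b a.
  apply: eq_bigr => b _; exact: (congr1 (fun z => z * _) (derive2_F_coords u v b)).
have -> : \matrix_(i, j) ('D_(delta_mx ord0 i) ('D_(delta_mx ord0 j) F) p *m NN p) ord0 a
   = \matrix_(i, j) (D i j *m NN p) ord0 a by [].
clearbody D; move: (NN p) => P.
transitivity (\sum_b \sum_i \sum_j u ord0 i * v ord0 j * (D i j ord0 b * P b a)).
  apply: eq_bigr => b _; rewrite mulr_suml.
  by apply: eq_bigr => i _; rewrite mulr_suml; apply: eq_bigr => j _; rewrite mulrA.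
rewrite exchange_big; apply: eq_bigr => i _ /=.
rewrite exchange_big /dot [RHS]mulr_sumr; apply: eq_bigr => j _ /=.
rewrite !mxE -mulr_sumr; ring.
Qed.

(** The identity dF(w) P = 0 is differentiated along [u]: the derivative of dF(w) yields alpha(u,
    w), that of P the right-hand side. *)
Lemma second_fundamental_form_shape u w : W_tangent p u -> al u w = - ('D_w F p *m normal_mx_d u).
Proof.
move=> tu; rewrite (second_fundamental_form_derive w tu).
apply/rowP => b; rewrite [LHS]mxE [RHS]mxE [X in _ = - X]mxE.
have z q : Om q -> \sum_a 'D_w (vcomp F a) q * NN q a b = 0.
  move=> Oq; have /(congr1 (fun A : 'rV[R]_N => A ord0 b)) := derive_normal_mx hn hr hphi hI w Oq.
  rewrite [RHS]mxE [LHS]mxE => h; apply: (etrans _ h); apply: eq_bigr => a _.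
  exact: (congr1 (fun z => z * _) (esym (vcomp_derive_F w a Oq))).
have s1 a : smooth Om ('D_w (vcomp F a)) := smooth_derive w (sF a).
have dz : Lie (fun=> u) (fun q => \sum_a 'D_w (vcomp F a) q * NN q a b) p = 0.
  rewrite (Lie_ext oO (fun=> u) (g := fun=> 0) z Omp) LieE; exact: derive_cst.
have dE : \sum_a ('D_u ('D_w F) p ord0 a * NN p a b + 'D_w F p ord0 a * normal_mx_d u a b) = 0.
  apply: (etrans _ dz); symmetry.
  apply: (etrans (Lie_sum oO (fun=> u) (index_enum 'I_N) (fun a => smoothM oO (s1 a) (sN a b))
    Omp)).
  apply: eq_bigr => a _.
  transitivity (Lie (fun=> u) ('D_w (vcomp F a)) p * NN p a b + 'D_w (vcomp F a) p * Lie
    (fun=> u) (fun q => NN q a b) p).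
    exact: (LieM (fun=> u) (s1 a) (sN a b) Omp).
  congr (_ * _ + _ * _).
  - by rewrite LieE; exact: (esym (vcomp_derive2_F u w a)).
  - exact: (esym (vcomp_derive_F w a Omp)).
  - by rewrite LieE [RHS]mxE.
by move: dE; rewrite big_split /= => /eqP; rewrite addr_eq0 => /eqP.
Qed.

Local Notation tf u := (fun q => tangential q u).
Local Notation xi w := (fun q => normal_part r Phi q w).
Local Notation xc w a := (vcomp ((xi w) \o retr r) a).

Lemma frame_smooth_field u : smooth_field Om (tf u).
Proof. by move=> i; exact: (tangential_smooth hr hI u i). Qed.

(** Projections of constant vectors serve as test fields for flatness, here and in
    [frame_normal_field]; their values at [p] fill the tangent and the normal space. *)
Lemma frame_tangent_field u : tangent_field r U (tf u).
Proof.
split=> [|q Uq]; last exact: tangential_tangent (W_nonzero hr (dom_W hI Uq)).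
apply: (vcomp_smooth_on oO) => i.
apply: (smooth_ext oO (f := vcomp (tf u) i)); last exact: frame_smooth_field.
by move=> q Oq; rewrite /vcomp /= (tangential_retr hr hI u Oq).
Qed.

Lemma xi_smooth (w : 'rV[R]_N) a : smooth Om (xc w a).
Proof.
apply: (smooth_ext oO (f := fun q => \sum_b w ord0 b * NN q b a)).
  by move=> q Oq; rewrite /vcomp /= (normal_partE hn hr hphi hI w Oq) mxE.
apply: (smooth_sum oO) => b; apply: (smoothM oO); [exact: smooth_cst|exact: sN].
Qed.

Lemma frame_normal_field (w : 'rV[R]_N) : normal_field r U Phi (xi w).
Proof.
split=> [|q Uq v tv]; first by apply: (vcomp_smooth_on oO) => a; exact: xi_smooth.
have Oq := dom_retr hr hI Uq.
have -> : normal_part r Phi q w = w *m NN q.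
  by rewrite -{1}(retr_id hr (dom_W hI Uq)) (normal_partE hn hr hphi hI w Oq).
rewrite dotE trmx_mul normal_mx_sym mulmxA.
have -> : W_diff r Phi q v *m NN q = 0 := derive_normal_mx hn hr hphi hI v Oq.
by rewrite mul0mx mxE.
Qed.

Lemma derive_xi (w : 'rV[R]_N) v q : Om q ->
  'D_v (xi w \o retr r) q = \row_a 'D_v (xc w a) q.
Proof.
move=> Oq; apply/rowP => a; rewrite [RHS]mxE; apply: vcomp_derive; apply: diff_derivable.
apply: differentiable_vcomp => b; exact: (smooth_differentiable (xi_smooth w b) Oq).
Qed.

Lemma derive_xi_p (w : 'rV[R]_N) v : 'D_v (xi w \o retr r) p = w *m normal_mx_d v.
Proof.
apply: (etrans (derive_xi w v Omp)); apply/rowP => a; rewrite [LHS]mxE [RHS]mxE.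
transitivity (Lie (fun=> v) (fun q => \sum_b w ord0 b * NN q b a) p).
  rewrite LieE; apply: (derive_ext oO _ _ Omp) => q Oq.
  by rewrite /vcomp /= (normal_partE hn hr hphi hI w Oq) mxE.
apply: (etrans (Lie_sum oO (fun=> v) (index_enum 'I_N)
  (fun b => smoothM oO (smooth_cst oO (w ord0 b)) (sN b a)) Omp)).
apply: eq_bigr => b _; apply: (etrans (LieM (fun=> v) (smooth_cst oO (w ord0 b)) (sN b a) Omp)).
rewrite 2!LieE [X in _ = _ * X]mxE.
by rewrite (derive_cst (w ord0 b)) mul0r add0r.
Qed.

Definition connection_row (w : 'rV[R]_N) v q := (\row_a Lie (tf v) (xc w a) q) *m NN q.

Lemma connectionE (w : 'rV[R]_N) v q : U q ->
  normal_connection r Phi (tf v) (xi w) q = connection_row w v q.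
Proof.
move=> Uq; have Oq := dom_retr hr hI Uq; rewrite /normal_connection /connection_row.
have -> : W_diff r (xi w) q (tangential q v) = \row_a Lie (tf v) (xc w a) q.
  apply: (etrans (derive_xi w _ Oq)).
  by apply/rowP => a; rewrite [LHS]mxE [RHS]mxE LieE.
by rewrite -{1}(retr_id hr (dom_W hI Uq)) (normal_partE hn hr hphi hI _ Oq).
Qed.

Lemma connection_row_smooth (w : 'rV[R]_N) v c : smooth Om (vcomp (connection_row w v) c).
Proof.
apply: (smooth_ext oO (f := fun q => \sum_a Lie (tf v) (xc w a) q * NN q a c)).
  by move=> q _; rewrite /vcomp /connection_row [RHS]mxE; apply: eq_bigr => a _;
    rewrite [in RHS]mxE.
apply: (smooth_sum oO) => a; apply: (smoothM oO); last exact: sN.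
exact: (Lie_smooth oO (@frame_smooth_field v) (xi_smooth w a)).
Qed.

Lemma connection2E (w : 'rV[R]_N) u v : W_tangent p u ->
  W_diff r (normal_connection r Phi (tf v) (xi w)) p u =
  (\row_a Lie (tf u) (Lie (tf v) (xc w a)) p) *m NN p
  + (\row_a Lie (tf v) (xc w a) p) *m normal_mx_d u.
Proof.
move=> tu.
have dc : differentiable (connection_row w v) p.
  by apply: differentiable_vcomp => c; exact:
    (smooth_differentiable (connection_row_smooth w v c) Omp).
transitivity ('D_u (connection_row w v \o retr r) p).
  apply: near_eq_derive; apply: filterS (open_nbhs_nbhs (conj oO Omp)) => q Oq.
  exact: (connectionE w v Oq).
apply: (etrans (derive_retr_tangent hr Wp tu dc)).
apply/rowP => c; apply: (etrans (vcomp_derive _ (diff_derivable dc))).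
transitivity (Lie (tf u) (fun q => \sum_a Lie (tf v) (xc w a) q * NN q a c) p).
  rewrite LieE (tangential_id tu); congr ('D_u _ p); apply/funext => q.
  by rewrite /vcomp /connection_row mxE; apply: eq_bigr => a _; rewrite [in LHS]mxE.
have sL a := Lie_smooth oO (@frame_smooth_field v) (xi_smooth w a).
apply: (etrans (Lie_sum oO (tf u) (index_enum 'I_N) (fun a => smoothM oO (sL a) (sN a c)) Omp)).
rewrite [RHS]mxE [X in _ = X + _]mxE [X in _ = _ + X]mxE.
apply: etrans (big_split _ _ _ _ _) => /=.
apply: eq_bigr => a _; rewrite [X in _ = X * _ + _]mxE [X in _ = _ + X * _]mxE.
apply: (etrans (LieM (tf u) (sL a) (sN a c) Omp)).
by rewrite [Lie (tf u) (fun q => NN q a c) p]LieE (tangential_id tu) [normal_mx_d u a c]mxE.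
Qed.

Lemma lie_bracketE u v : W_tangent p u -> W_tangent p v ->
  lie_bracket r (tf u) (tf v) p =
  (\row_i Lie (tf u) (vcomp (tf v) i) p) - (\row_i Lie (tf v) (vcomp (tf u) i) p).
Proof.
have D u' v' : W_tangent p u' ->
    W_diff r (tf v') p (tangential p u') = \row_i Lie (tf u') (vcomp (tf v') i) p.
  move=> tu; rewrite (tangential_id tu).
  have dX : differentiable (tf v') p.
    by apply: differentiable_vcomp => c; exact:
      (smooth_differentiable (@frame_smooth_field v' c) Omp).
  apply: (etrans (derive_retr_tangent hr Wp tu dX)).
  apply/rowP => i; rewrite [RHS]mxE LieE (tangential_id tu).
  exact: (vcomp_derive _ (diff_derivable dX)).
by move=> tu tv; rewrite /lie_bracket (D _ _ tu) (D _ _ tv).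
Qed.

(** For the section w P, two covariant derivatives give its projected second derivatives plus w (D_v
    P)(D_u P) P. After antisymmetrization the second derivatives cancel against the bracket term,
    since P^2 = P. *)
Lemma normal_curvatureE (w : 'rV[R]_N) u v : W_tangent p u -> W_tangent p v ->
  normal_curvature r Phi (tf u) (tf v) (xi w) p =
  w *m (normal_mx_d v *m normal_mx_d u - normal_mx_d u *m normal_mx_d v) *m NN p.
Proof.
move=> tu tv; rewrite /normal_curvature.
have C u' v' : W_tangent p u' -> W_tangent p v' ->
    normal_connection r Phi (tf u') (normal_connection r Phi (tf v') (xi w)) p =
    ((\row_a Lie (tf u') (Lie (tf v') (xc w a)) p) *m NN p
     + (w *m normal_mx_d v') *m normal_mx_d u') *m NN p.
  move=> tu' tv'; rewrite {1}/normal_connection (tangential_id tu') (connection2E w v' tu')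
    normal_part_p.
  congr ((_ + _ *m _) *m _); apply: etrans (derive_xi_p w v'); symmetry.
  apply: (etrans (derive_xi w v' Omp)).
  by apply/rowP => a; rewrite [LHS]mxE [RHS]mxE LieE (tangential_id tv').
have B : normal_connection r Phi (lie_bracket r (tf u) (tf v)) (xi w) p =
    ((\row_a Lie (tf u) (Lie (tf v) (xc w a)) p) - (\row_a Lie (tf v) (Lie (tf u) (xc w a)) p))
      *m NN p.
  rewrite /normal_connection (lie_bracketE tu tv) normal_part_p; congr (_ *m _).
  apply: (etrans (derive_xi w _ Omp)).
  apply/rowP => a; rewrite [LHS]mxE [RHS]mxE [X in _ = X + _]mxE [X in _ = _ + X]mxE
    [X in _ = _ - X]mxE.
  have sf := xi_smooth w a; have df := smooth_differentiable sf Omp.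
  (* Here m and m' are the two orders of the Hessian term in [Lie_Lie]; the first-order terms make
     up the bracket. *)
  have alg (b c m m' : R) : m = m' -> b - c = (b + m) - (c + m') by move=> ->;
    rewrite opprD addrACA subrr addr0.
  have L1 := Lie_Lie oO (@frame_smooth_field u) (@frame_smooth_field v) sf Omp.
  have L2 := Lie_Lie oO (@frame_smooth_field v) (@frame_smooth_field u) sf Omp.
  apply: (etrans _ (esym (congr2 (fun b c => b - c) L1 L2))).
  apply: (etrans _ (alg _ _ _ _ (derive_comm (tangential p u) (tangential p v) oO Omp sf))).
  have dirB b c : 'D_(b - c) (xc w a) p = 'D_b (xc w a) p - 'D_c (xc w a) p.
    by rewrite !(deriveE _ df) linearB.
  exact: dirB.
rewrite (C _ _ tu tv) (C _ _ tv tu) B.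
move: (\row_a Lie (tf u) (Lie (tf v) (xc w a)) p) (\row_a Lie (tf v) (Lie (tf u) (xc w a)) p) =>
  b c.
have := normal_mx_idem hn hr hphi hI Omp.
move: (NN p) (normal_mx_d u) (normal_mx_d v) => P Du Dv PP.
rewrite !mulmxDl mulNmx -!(mulmxA _ P) PP mulmxBr mulmxBl !mulmxA.
move: (b *m P) (c *m P) (w *m Dv *m Du *m P) (w *m Du *m Dv *m P) => b' c' e f.
by apply/eqP; rewrite subr_eq opprD addrACA addrC.
Qed.

End FlatNormalBundle.

(** * Flatness makes the shape operators commute *)

Section CommutingOfFlat.
Variables (R : realType) (n k : nat) (d : 'I_k -> nat) (r : 'I_k -> R).
Variable (phi : R -> R).
Hypothesis hn : (4 <= n)%N.
Hypothesis hr : forall j, 0 < r j.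
Hypothesis hphi : ST_profile n phi.
Notation E := 'rV[R]_(2 + n.-1 + \sum_(j < k) (d j).+1).
Variables (N : nat) (U : set E) (Phi : E -> 'rV[R]_N).
Hypothesis hI : local_isometric_immersion r phi U Phi.
Hypothesis flatU : flat_normal_bundle r U Phi.
Variable p : E.
Hypothesis Up : U p.
Hypothesis xp : L0_part p != 0.
Local Notation F := (Phi \o retr r).
Local Notation Om := (retr r @^-1` U).
Local Notation jac := (jacobian F).
Local Notation NN := (normal_mx r Phi).
Local Notation DN u := (normal_mx_d r Phi p u).
Local Notation al := (second_fundamental_form r Phi p).
Local Notation dl i := (delta_mx ord0 i : E).
Implicit Types (q u v w : E).

Let oO : open Om := dom_open hr hI.
Let Wp : W_set r p := dom_W hI Up.
Let Omp : Om p := dom_retr hr hI Up.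
Let sN := normal_mx_smooth hn hr hphi hI.
Let PP : NN p *m NN p = NN p := normal_mx_idem hn hr hphi hI Omp.
Let PT : (NN p)^T = NN p := normal_mx_sym r Phi p.

Lemma normal_mx_d_comm u v : W_tangent p u -> W_tangent p v ->
  DN v *m DN u *m NN p = DN u *m DN v *m NN p.
Proof.
move=> tu tv; apply/eqP; rewrite -subr_eq0 -mulmxBl; apply/eqP/row_matrixP => a.
rewrite row0 rowE.
have := flatU (frame_tangent_field hr hI u) (frame_tangent_field hr hI v)
  (frame_normal_field hn hr hphi hI (delta_mx ord0 a)) Up.
rewrite (normal_curvatureE hn hr hphi hI Up _ tu tv) => h.
by rewrite mulmxA.
Qed.

Lemma normal_mx_d_sym u : (DN u)^T = DN u.
Proof.
apply/matrixP => a b; rewrite !mxE; congr ('D_u _ p); apply/funext => q.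
by rewrite -{1}(normal_mx_sym r Phi q) mxE.
Qed.

Lemma normal_mx_dE u : DN u = DN u *m NN p + NN p *m DN u.
Proof.
apply/matrixP => a b.
have E1 : Lie (fun=> u) (fun q => \sum_c NN q a c * NN q c b) p = DN u a b.
  rewrite LieE [RHS]mxE; apply: (derive_ext oO _ _ Omp) => q Oq.
  by rewrite -[in RHS](normal_mx_idem hn hr hphi hI Oq) [RHS]mxE.
apply: (etrans (esym E1)).
apply: (etrans (Lie_sum oO (fun=> u) (index_enum 'I_N) (fun c => smoothM oO (sN a c) (sN c b))
  Omp)).
rewrite [RHS]mxE [X in _ = X + _]mxE [X in _ = _ + X]mxE.
apply: etrans (big_split _ _ _ _ _) => /=.
apply: eq_bigr => c _; apply: (etrans (LieM (fun=> u) (sN a c) (sN c b) Omp)).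
by rewrite [normal_mx_d r Phi p u a c]mxE [normal_mx_d r Phi p u c b]mxE !LieE.
Qed.

(** Multiplying [normal_mx_dE] by P on both sides doubles the right-hand side: the derivative of a
    projector exchanges its range and its kernel. *)
Lemma normal_mx_d_normal u : NN p *m DN u *m NN p = 0.
Proof.
have := congr1 (fun A => NN p *m A *m NN p) (normal_mx_dE u).
rewrite mulmxDr mulmxDl !mulmxA PP -(mulmxA (NN p *m DN u)) PP => /eqP.
by rewrite -subr_eq0 opprD addrA subrr sub0r oppr_eq0 => /eqP.
Qed.

Lemma second_fundamental_form_normal_mx u v : W_tangent p u -> al u v *m NN p = al u v.
Proof. by move=> tu; rewrite (second_fundamental_form_derive hn hr hphi hI Up v tu) -mulmxA PP.
  Qed.

Lemma L0_metric_sharp u w :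
  L0_metric phi (L0_part p) (L0_part u) (L0_part (sharp phi p w)) =
  dot (L0_part (flat phi p u)) (L0_part w).
Proof.
have e := L0_metric_fld phi (coef_of p u) (coef_of p (sharp phi p w)) xp.
rewrite (fld_coef_of xp u) (fld_coef_of xp (sharp phi p w)) in e.
apply: (etrans e); rewrite (co_sharp phi xp w) L0_flat dot2E.
have := t_neq0 xp; have := p1_neq0 hphi xp.
move: (enorm _) (derive1 phi _) (coef_of p u).1 (L0_part w) => t P [a b] c P0 t0.
by rewrite !mxE /=; field; rewrite P0 t0.
Qed.

Lemma dot_tangential_l N' (y c c' : 'rV[R]_N') : dot y c = 0 ->
  dot c (c' - (dot y c' / dot y y) *: y) = dot c c'.
Proof. by move=> yc; rewrite dotBr dotZr (dotC c y) yc mulr0 subr0. Qed.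

(** [sharp] divides once by each of the lengths t, phi' and phi, while the metric contains their
    squares; the single factors left are those of [flat]. *)
Lemma gram_sharp u w : W_tangent p u ->
  dot ('D_u F p) ('D_(sharp phi p w) F p) = dot (flat phi p u) w.
Proof.
move=> tu; have [_ _ _ iso] := hI; have [tf ts] := tu.
apply: (etrans (iso _ _ _ Up tu (sharp_tangent phi hr Wp w))).
rewrite /W_metric L0_metric_sharp dot_parts; congr (_ + _ + _).
  rewrite fiber_sharp fiber_flat fiber_tangential dotZr dotZl (dot_tangential_l _ tf).
  have := p0_neq0 hn hphi xp.
  by move: (phi _) (dot _ _) => P b P0; field.
apply: eq_bigr => j _.
by rewrite sphere_sharp sphere_flat sphere_tangential (dot_tangential_l _ (ts j)).
Qed.

Local Notation Sh := (\matrix_(i, l) sharp phi p (dl i) ord0 l).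

(** The rows of G are the images of a Parseval frame under dF, so G^T G is the projection onto the
    tangent space: it fixes the rows of the Jacobian and kills normal vectors. *)
Lemma sharp_parseval : (Sh *m jac p)^T *m (Sh *m jac p) = 1%:M - NN p.
Proof.
set G := Sh *m jac p.
have dF v : 'D_v F p = v *m jac p by apply: deriveEjacobian; exact: (F_differentiable hI Omp).
have GE l : row l G = 'D_(sharp phi p (dl l)) F p.
  by rewrite dF sharp_mulmx rowE -mulmxA.
have tG u : W_tangent p u -> u *m jac p *m G^T = flat phi p u.
  move=> tu; apply/rowP => l; rewrite -dF -[flat _ _ _ in RHS]mulmx1.
  transitivity (dot ('D_u F p) (row l G)).
    by rewrite mxE; apply: eq_bigr => a _; rewrite !mxE.
  by rewrite GE (gram_sharp (dl l) tu) dotC dot_delta mulmx1.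
have JG : jac p *m (G^T *m G) = jac p.
  apply/row_matrixP => i; rewrite row_mul !rowE -dF (derive_tangential hI _ Omp).
  have tt : W_tangent p (tangential p (dl i)) := tangential_tangent _ (W_nonzero hr Wp).
  rewrite dF mulmxA (tG _ tt) /G (mulmxA (flat _ _ _)) -sharp_mulmx.
  by rewrite (sharp_flat hn hphi xp tt).
have GP : G^T *m G *m NN p = 0.
  by rewrite /G -!mulmxA (jac_normal_mx hn hr hphi hI Omp) !mulmx0.
have GJ : G^T *m G *m (jac p)^T = (jac p)^T.
  by rewrite -[in RHS]JG (trmx_mul (jac p)) (trmx_mul G^T) trmxK.
transitivity (G^T *m G *m (1%:M - NN p)).
  by rewrite mulmxBr GP mulmx1 subr0.
by rewrite /normal_mx opprB addrC subrK (mulmxA (G^T *m G)) (mulmxA (G^T *m G)) GJ.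
Qed.

(** With alpha(u, f) = - dF(f) D_u P the sum over the frame becomes P (D_v P)(1 - P)(D_u P) P, and
    the part with P in the middle vanishes by [normal_mx_d_normal]. *)
Lemma sff_sharp_sum u v a b : W_tangent p u -> W_tangent p v ->
  \sum_i al v (sharp phi p (dl i)) ord0 a * al u (sharp phi p (dl i)) ord0 b =
  (NN p *m DN v *m DN u *m NN p) a b.
Proof.
move=> tu tv; set G := Sh *m jac p.
have alE w i c : W_tangent p w ->
    al w (sharp phi p (dl i)) ord0 c = - (G *m DN w *m NN p) i c.
  move=> tw; rewrite -(second_fundamental_form_normal_mx _ tw)
    (second_fundamental_form_shape hn hr hphi hI Up _ tw).
  rewrite deriveEjacobian; last exact: (F_differentiable hI Omp).
  rewrite mulNmx [LHS]mxE; congr (- _).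
  by rewrite sharp_mulmx /G -!mulmxA -rowE mxE.
transitivity (((G *m DN v *m NN p)^T *m (G *m DN u *m NN p)) a b).
  rewrite [RHS]mxE; apply: eq_bigr => i _.
  apply: (etrans (congr2 (fun x y : R => x * y) (alE v i a tv) (alE u i b tu))).
  by rewrite mulrNN [X in _ = X * _]mxE.
have : G^T *m G = 1%:M - NN p := sharp_parseval.
clearbody G => GG; congr (fun_of_matrix _ a b).
rewrite !trmx_mul PT normal_mx_d_sym -!mulmxA (mulmxA G^T) GG.
have := normal_mx_d_normal u; rewrite -mulmxA.
move: (NN p) (DN u) (DN v) => P Du Dv Z.
by rewrite mulmxBl mul1mx Z subr0.
Qed.

Lemma sff_sharp_comm u v : W_tangent p u -> W_tangent p v -> forall a b,
  \sum_i al v (sharp phi p (dl i)) ord0 a * al u (sharp phi p (dl i)) ord0 b =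
  \sum_i al u (sharp phi p (dl i)) ord0 a * al v (sharp phi p (dl i)) ord0 b.
Proof.
move=> tu tv a b.
have c := congr1 (fun A => (NN p *m A) a b) (normal_mx_d_comm tu tv).
apply: (etrans (sff_sharp_sum a b tu tv)); apply: etrans (esym (sff_sharp_sum a b tv tu)).
by move: c; move: (NN p) (DN u) (DN v) => P Du Dv; rewrite !mulmxA.
Qed.

End CommutingOfFlat.

(** A displacement along L_0 does not leave W, and a small one does not leave [U]. *)
Lemma exists_L0_nonzero (R : realType) (n k : nat) (d : 'I_k -> nat)
    (r : 'I_k -> R) (U : set 'rV[R]_(2 + n.-1 + \sum_(j < k) (d j).+1)) :
  W_open r U -> U !=set0 -> exists2 p, U p & L0_part p != 0.
Proof.
move=> [Q [oQ ->]] [p [Qp [Wf Ws]]].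
have [p0|] := eqVneq (L0_part p) 0; last by exists p.
pose e : 'rV[R]_(2 + n.-1 + \sum_(j < k) (d j).+1) := mkE (delta_mx ord0 0) 0 (fun=> 0).
have c : (fun s : R => p + s *: e) @ 0 --> p + 0 *: e.
  by apply: cvgD; [exact: cvg_cst|apply: cvgZr_tmp; exact: cvg_id].
have nQ : \forall s \near (0 : R), Q (p + s *: e).
  by apply: c; rewrite scale0r addr0; exact: open_nbhs_nbhs.
have nQ' : \forall s \near (0 : R)^', Q (p + s *: e) by exact: nbhs_dnbhs nQ.
have [s [Qs s0]] := filter_ex (filterI nQ' (nbhs_dnbhs_neq (0 : R))).
exists (p + s *: e).
  split=> //; split=> [|j].
    by rewrite fiber_partD fiber_partZ fiber_mkE scaler0 addr0.
  by rewrite sphere_partD sphere_partZ sphere_mkE scaler0 addr0.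
rewrite L0_partD L0_partZ L0_mkE p0 add0r; apply/eqP => /rowP/(_ 0)/eqP.
by rewrite !mxE mulr1; apply/negP.
Qed.

Theorem theorem1p4 (R : realType) (n k : nat) (d : 'I_k -> nat)
    (r : 'I_k -> R) (phi : R -> R)
    (hn : (4 <= n)%N) (hk : (1 <= k)%N)
    (hd : forall j, (2 <= d j)%N) (hr : forall j, 0 < r j)
    (hphi : ST_profile n phi) :
  let m := (n + \sum_(j < k) d j)%N in
  let rho := fun j : 'I_k => ((d j)%:R - 1) / r j ^+ 2 in
  (forall (q : nat) (U : set 'rV[R]_(2 + n.-1 + \sum_(j < k) (d j).+1))
          (Phi : 'rV[R]_(2 + n.-1 + \sum_(j < k) (d j).+1) -> 'rV[R]_(m + q)),
      local_isometric_immersion r phi U Phi ->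
      adapted r U Phi ->
      (k + 2 <= q)%N) /\
  ((forall i j, i != j -> rho i != rho j) ->
    forall (q : nat) (U : set 'rV[R]_(2 + n.-1 + \sum_(j < k) (d j).+1))
           (Phi : 'rV[R]_(2 + n.-1 + \sum_(j < k) (d j).+1) -> 'rV[R]_(m + q)),
      (q <= k + 1)%N ->
      local_isometric_immersion r phi U Phi ->
      ~ adapted r U Phi /\ ~ flat_normal_bundle r U Phi).
Proof.
move=> m rho.
(* Adaptedness is asked at the single point [p], because flatness yields it only at points over a
   nonzero x. *)
have codim q U Phi (p : 'rV[R]_(2 + n.-1 + \sum_(j < k) (d j).+1)) :
    @local_isometric_immersion R n k d r phi (m + q) U Phi -> U p -> L0_part p != 0 ->
    (forall (i j : option 'I_k) u v, i != j ->
      factor_tangent i p u -> factor_tangent j p v ->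
      second_fundamental_form r Phi p u v = 0) -> (k + 2 <= q)%N.
  move=> hI Up xp ad; rewrite -(leq_add2l m).
  exact: (adapted_codimension hn hd hr hphi xp (gauss_equation hn hr hphi hI Up xp)
    (second_fundamental_formC hn hr hphi hI Up xp)
    (second_fundamental_form_normal hn hr hphi hI Up xp)
    (rank_jacobian hn hr hphi hI (dom_retr hr hI Up)) ad).
have small q : (q <= k + 1)%N -> (k + 2 <= q)%N -> False.
  by rewrite addn2 addn1 ltnNge => ->.
have adapt q U Phi : @local_isometric_immersion R n k d r phi (m + q) U Phi ->
    adapted r U Phi -> (k + 2 <= q)%N.
  move=> hI ad; have [oU U0 _ _] := hI; have [p Up xp] := exists_L0_nonzero oU U0.
  by apply: (codim q U Phi p hI Up xp) => i j u v ij; exact: ad.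
split; first exact: adapt.
move=> hrho q U Phi hq hI; split; first by move=> /(adapt _ _ _ hI); exact: small.
move=> flatU; have [oU U0 _ _] := hI; have [p Up xp] := exists_L0_nonzero oU U0.
apply: (small q hq); apply: (codim q U Phi p hI Up xp) => i j u v ij fu fv.
exact: (adapted_of_commuting hn hd hr hphi (dom_W hI Up) xp
  (gauss_equation hn hr hphi hI Up xp) (second_fundamental_formC hn hr hphi hI Up xp)
  (sff_bilinear hn hr hphi hI Up) (sff_sharp_comm hn hr hphi hI flatU Up xp) hrho ij fu fv).
Qed.
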